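(* Let $k\ge3$, and let $\chi$ and $\psi$ be primitive Dirichlet characters modulo $L$ and $M$, respectively, such that $\chi(-1)\psi(-1)=(-1)^k$. Let $E(\tau)=E_k(\tau;\chi,\psi)$. Then, for $X$ in the upper half-plane, \[ \hat\rho_E(I)(X)=-\frac{4\psi(-1)}{k-1}\sum_{\substack{s=0\\ \chi(-1)=(-1)^s}}^{k}L(s,\chi)L(k-s,\psi)X^{k-s-1}-\frac{2\psi(-1)}{k-1}\pi i\Big[\varepsilon_\chi L(k-1,\psi)X^{k-2}-\varepsilon_\psi L(k-1,\chi)\Big], \] where $\varepsilon_\chi=1$ if $\chi=1$ and $\varepsilon_\chi=0$ otherwise (similarly for $\varepsilon_\psi$).
   Context: Dirichlet characters include the trivial character $1$ (modulo $1$, identically $1$), which counts as primitive. $L(s,\chi)=\sum_{n\ge1}\chi(n)n^{-s}$ denotes the Dirichlet $L$-function, analytically continued to all $s$ (so e.g. $L(s,1)=\zeta(s)$ and $L(0,1)=-1/2$). For $k>2$ and $\tau$ in the upper half-plane, $E_k(\tau;\chi,\psi)=\sum_{(m,n)\in\mathbb{Z}^2\setminus\{(0,0)\}}\frac{\chi(m)\psi(n)}{(m\tau+n)^k}$, which is a modular form of weight $k$. For $g=\begin{pmatrix}a&b\\c&d\end{pmatrix}\in\mathrm{SL}_2(\mathbb Z)$ put $(h|_k g)(\tau)=(c\tau+d)^{-k}h(\frac{a\tau+b}{c\tau+d})$. For a function $F$ on the upper half-plane with a limit $a_0(F)=\lim_{\operatorname{Im}z\to\infty}F(z)$ (constant term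 of its Fourier expansion) define $\tilde F(\tau)=\int_\tau^{i\infty}[F(z)-a_0(F)](z-\tau)^{k-2}\,dz$. The period function is \[ \hat\rho_E(I)(X)=\tilde E(X)-X^{k-2}\,\tilde F(-1/X),\qquad F=E|_kS^{-1},\ \text{i.e. } F(z)=(-z)^{-k}E(-1/z), \] with $S=\begin{pmatrix}0&-1\\1&0\end{pmatrix}$. *)

(* Defs.v *)
From Stdlib Require Import Reals ZArith List ClassicalEpsilon.
From Coquelicot Require Import Coquelicot.

Local Open Scope C_scope.

Definition Cpowz (z : C) (n : Z) : C :=
  match n with
  | Z0 => 1
  | Zpos p => z ^ Pos.to_nat p
  | Zneg p => / z ^ Pos.to_nat p
  end.

(* The definite description of a complex number: [the P] satisfies [P] as soon
   as exactly one complex number does ([iota_correct]). *)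
Definition the (P : C -> Prop) : C := iota (T := C_CompleteNormedModule) P.

(* For [N = 1] this forces [chi] to be identically 1, including at 0. *)
Definition dirichlet_character (N : Z) (chi : Z -> C) : Prop :=
  (0 < N)%Z
  /\ (forall n, chi (n + N)%Z = chi n)
  /\ (forall m n, chi (m * n)%Z = chi m * chi n)
  /\ (forall n, chi n <> 0 <-> Z.gcd n N = 1%Z).

Definition induced_from (N : Z) (chi : Z -> C) (d : Z) : Prop :=
  exists chi', dirichlet_character d chi'
    /\ forall n, Z.gcd n N = 1%Z -> chi n = chi' n.

Definition primitive_character (N : Z) (chi : Z -> C) : Prop :=
  dirichlet_character N chi
  /\ forall d, (0 < d < N)%Z -> (d | N)%Z -> ~ induced_from N chi d.

Definition principal (chi : Z -> C) : Prop :=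
  forall n, chi n <> 0 -> chi n = 1.

Definition epsilon_char (chi : Z -> C) : C :=
  if excluded_middle_informative (forall n, chi n = 1) then 1 else 0.

(* x ^ s for x > 0, with the real logarithm of x. *)
Definition Rcpower (x : R) (s : C) : C :=
  RtoC (exp (Re s * ln x))
  * (cos (Im s * ln x)%R, sin (Im s * ln x)%R).

Definition analytic_at (f : C -> C) (z0 : C) : Prop :=
  exists (a : nat -> C) (r : R), (0 < r)%R /\
    forall z, (Cmod (z - z0) < r)%R ->
      is_pseries (K := C_AbsRing) (V := C_NormedModule) a (z - z0) (f z).

(* [f] continues the Dirichlet series of [chi] analytically to the half-plane
   Re s > sigma; the point 1 is a pole, hence excluded, when [chi] is
   principal. *)
Definition L_continuation (chi : Z -> C) (sigma : R) (f : C -> C) : Prop :=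
  (forall s, (1 < Re s)%R ->
     is_series (K := C_AbsRing) (V := C_NormedModule)
       (fun n => chi (Z.of_nat (S n)) * Rcpower (INR (S n)) (- s)) (f s))
  /\ (forall s, (sigma < Re s)%R -> (principal chi -> s <> 1) ->
        analytic_at f s).

(* L(s, chi). By the identity theorem, continuations to different half-planes
   agree wherever both are analytic, so the value does not depend on sigma and
   [f]; it is meaningless only at the pole s = 1 of a principal character. *)
Definition dirichlet_L (chi : Z -> C) (s : C) : C :=
  the (fun v => exists (sigma : R) (f : C -> C),
         (sigma < Re s)%R /\ L_continuation chi sigma f /\ f s = v).

(* Unconditional summation over [D]: the limit of the finite partial sums along
   the finite subsets of [D], represented by duplicate-free lists. *)
Definition finite_subsets {T : Type} (D : T -> Prop) (P : list T -> Prop) :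
  Prop :=
  exists S0, (forall x, In x S0 -> D x)
    /\ forall S, NoDup S -> (forall x, In x S -> D x) -> incl S0 S -> P S.

Definition is_sum {T : Type} (D : T -> Prop) (f : T -> C) (l : C) : Prop :=
  filterlim (fun S => fold_right Cplus 0 (map f S)) (finite_subsets D)
    (locally l).

Definition eisenstein (k : nat) (chi psi : Z -> C) (tau : C) : C :=
  the (is_sum (fun p : Z * Z => p <> (0, 0)%Z)
         (fun p => chi (fst p) * psi (snd p)
                   / (RtoC (IZR (fst p)) * tau + RtoC (IZR (snd p))) ^ k)).

Record SL2Z := mkSL2Z {
  sl_a : Z; sl_b : Z; sl_c : Z; sl_d : Z;
  sl_det : (sl_a * sl_d - sl_b * sl_c = 1)%Z }.

Lemma SL2Z_inv_det (g : SL2Z) :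
  (sl_d g * sl_a g - (- sl_b g) * (- sl_c g) = 1)%Z.
Proof. rewrite <- (sl_det g); ring. Qed.

Definition SL2Z_inv (g : SL2Z) : SL2Z :=
  mkSL2Z (sl_d g) (- sl_b g) (- sl_c g) (sl_a g) (SL2Z_inv_det g).

Definition SL2Z_S : SL2Z := mkSL2Z 0 (-1) 1 0 eq_refl.

Definition slash (k : nat) (h : C -> C) (g : SL2Z) (tau : C) : C :=
  / (RtoC (IZR (sl_c g)) * tau + RtoC (IZR (sl_d g))) ^ k
  * h ((RtoC (IZR (sl_a g)) * tau + RtoC (IZR (sl_b g)))
       / (RtoC (IZR (sl_c g)) * tau + RtoC (IZR (sl_d g)))).

Definition im_infty (P : C -> Prop) : Prop :=
  exists Y : R, forall z, (Y < Im z)%R -> P z.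

Definition a0 (F : C -> C) : C :=
  the (fun l => filterlim F im_infty (locally l)).

(* The integral from tau to i oo of (F(z) - a0(F)) (z - tau)^(k-2) dz, along
   the vertical ray z = tau + i t, t >= 0. *)
Definition tilde (k : nat) (F : C -> C) (tau : C) : C :=
  RInt_gen (V := C_R_CompleteNormedModule)
    (fun t => (F (tau + Ci * RtoC t) - a0 F) * (Ci * RtoC t) ^ (k - 2) * Ci)
    (at_point 0%R) (Rbar_locally p_infty).

Definition period_function (k : nat) (E : C -> C) (X : C) : C :=
  tilde k E X - X ^ (k - 2) * tilde k (slash k E (SL2Z_inv SL2Z_S)) (- 1 / X).

(* Main.v *)
(* For m > 0 one has, termwise in n,
     int_tau^(i oo) (z - tau)^(k-2) / (m z + n)^k dz = 1 / ((k-1) m^(k-1) (m tau + n)),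
   but the sum over n of the right-hand sides converges only when taken
   symmetrically, and exchanging sum and integral produces a boundary term.
   Integrating up to tau + i T and expanding c^(k-1) / (A B^(k-1)), with
   A = m tau + n, c = i m T and B = A + c, as 1/A - 1/B - c/B^2 - ... -
   c^(k-2)/B^(k-1), the boundary term is governed by the sums of psi(n)/(w + n)^j
   for Im w -> oo. A comparison with an integral (psi = 1) or a summation by parts
   (psi <> 1) shows that they tend to -pi i when j = 1 and psi = 1, and to 0 at the
   rate (Im w)^-j otherwise: this is the origin of the pi i terms.
   Hence tilde E and, since E|S^-1 = psi(-1) E_k(psi, chi), also the second integral
   are double series. The partial fraction decomposition of
     1/(m^(k-1) (m X + n)) + (-1)^k X^(k-1) / (n^(k-1) (m X + n))
   into monomials in 1/m and 1/n recombines them into products of L-values; the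
   terms with n = 0 or m = 0 give s = k and s = 0, because L(0, chi) = -chi(0)/2
   for even chi. The values L(1, chi) and L(0, chi) require the continuation of the
   Dirichlet series to Re s > -1. *)
Require Import Defs.
From Stdlib Require Import Reals ZArith List Lia Lra ClassicalEpsilon Permutation FinFun.
From Coquelicot Require Import Coquelicot.

Local Open Scope C_scope.

(** * Limits and series of complex numbers *)

(** All notions are given by descriptions ([the]), so each one costs existence and uniqueness. For
    [dirichlet_L], uniqueness ranges over all continuations to all half-planes and amounts to the
    identity theorem; existence rests on a Weierstrass theorem for power series, reached through
    Cauchy's inequality. Both constructions of L gain two powers of n: second differences of n^-s
    against a bounded second antiderivative of a nontrivial character, trapezoid errors for zeta.
    The resulting terms of size n^(-Re s - 2) are summable exactly for Re s > -1, a half-plane that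
    contains s = 0. The other obstacle is conditional convergence: the series of the first integral
    is summed rows first, that of the second columns first. Subtracting 1/n from one kernel and 1/(m
    X) from the other brings both below a multiple of (m n)^(-3/2). Both are then limits over the
    same square boxes, where the partial fraction identity applies termwise. The exponent 3/2 is
    half of the least weight 3 and exceeds 1, so that one majorant serves all the lattice sums. *)

Lemma RtoC_neq_0 (x : R) : x <> 0%R -> RtoC x <> 0.
Proof. intros H E. apply H. now apply RtoC_inj. Qed.

(** Encoded through the real sequence of distances, so that the calculus of real limits applies;
    [Clim_filterlim] links it to filters. *)
Definition Clim (u : nat -> C) (l : C) : Prop :=
  is_lim_seq (fun n => Cmod (u n - l)) 0%R.

Lemma Clim_bound (u : nat -> C) (l : C) (e : nat -> R) :
  (forall n, Cmod (u n - l) <= e n)%R -> is_lim_seq e 0%R -> Clim u l.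
Proof.
  intros H He. apply (is_lim_seq_le_le (fun _ => 0%R) _ e).
  - intros n; split; [apply Cmod_ge_0 | apply H].
  - apply is_lim_seq_const.
  - exact He.
Qed.

Lemma Clim_ext_loc (u v : nat -> C) (l : C) :
  (exists N, forall n, (N <= n)%nat -> u n = v n) -> Clim u l -> Clim v l.
Proof.
  intros [N H] Hu. apply is_lim_seq_ext_loc with (2 := Hu).
  exists N; intros n Hn. now rewrite (H n Hn).
Qed.

Lemma Clim_ext (u v : nat -> C) (l : C) :
  (forall n, u n = v n) -> Clim u l -> Clim v l.
Proof. intros H; apply Clim_ext_loc; exists 0%nat; auto. Qed.

Lemma Clim_const (c : C) : Clim (fun _ => c) c.
Proof.
  apply Clim_bound with (fun _ => 0%R).
  - intros n. replace (c - c) with (RtoC 0) by ring. rewrite Cmod_0; lra.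
  - apply is_lim_seq_const.
Qed.

Lemma Clim_plus (u v : nat -> C) (a b : C) :
  Clim u a -> Clim v b -> Clim (fun n => u n + v n) (a + b).
Proof.
  intros Hu Hv. apply Clim_bound with (fun n => Cmod (u n - a) + Cmod (v n - b))%R.
  - intros n. replace (u n + v n - (a + b)) with ((u n - a) + (v n - b)) by ring.
    apply Cmod_triangle.
  - replace (Finite 0) with (Finite (0 + 0)) by (f_equal; ring).
    now apply is_lim_seq_plus'.
Qed.

Lemma Clim_scal (c : C) (u : nat -> C) (a : C) :
  Clim u a -> Clim (fun n => c * u n) (c * a).
Proof.
  intros Hu. apply Clim_bound with (fun n => Cmod c * Cmod (u n - a))%R.
  - intros n. replace (c * u n - c * a) with (c * (u n - a)) by ring.
    rewrite Cmod_mult; lra.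
  - replace (Finite 0) with (Rbar_mult (Cmod c) 0%R)
      by (simpl; f_equal; ring).
    now apply is_lim_seq_scal_l.
Qed.

Lemma Clim_opp (u : nat -> C) (a : C) : Clim u a -> Clim (fun n => - u n) (- a).
Proof.
  intros Hu. apply Clim_ext with (fun n => - (1) * u n); [intros; ring|].
  replace (- a) with (- (1) * a) by ring. now apply Clim_scal.
Qed.

Lemma Clim_minus (u v : nat -> C) (a b : C) :
  Clim u a -> Clim v b -> Clim (fun n => u n - v n) (a - b).
Proof. intros Hu Hv. apply Clim_plus; auto. now apply Clim_opp. Qed.

Lemma Clim_norm_le (u : nat -> C) (l : C) (B : R) :
  Clim u l -> (forall n, Cmod (u n) <= B)%R -> (Cmod l <= B)%R.
Proof.
  intros Hu HB.
  assert (H : Rbar_le (Cmod l - B)%R 0%R).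
  { apply (is_lim_seq_le (fun _ => Cmod l - B)%R (fun n => Cmod (u n - l))); auto.
    - intros n. pose proof (Cmod_triangle (u n) (l - u n)) as H.
      replace (u n + (l - u n)) with l in H by ring.
      replace (l - u n) with (- (u n - l)) in H by ring. rewrite Cmod_opp in H.
      specialize (HB n); lra.
    - apply is_lim_seq_const. }
  simpl in H; lra.
Qed.

Lemma Clim_unique (u : nat -> C) (a b : C) : Clim u a -> Clim u b -> a = b.
Proof.
  intros Ha Hb. assert (H : Clim (fun n => u n - u n) (a - b)) by now apply Clim_minus.
  assert (H0 : (Cmod (a - b) <= 0)%R).
  { apply Clim_norm_le with (1 := H). intros n.
    replace (u n - u n) with (RtoC 0) by ring. rewrite Cmod_0; lra. }
  assert (H1 : a - b = 0).
  { apply Cmod_eq_0. pose proof (Cmod_ge_0 (a - b)); lra. }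
  replace a with (a - b + b) by ring. rewrite H1; ring.
Qed.

Lemma Clim_incr_1 (u : nat -> C) (l : C) : Clim (fun n => u (S n)) l <-> Clim u l.
Proof. unfold Clim. symmetry. apply (is_lim_seq_incr_1 (fun n => Cmod (u n - l))). Qed.

Lemma Clim_close (u v : nat -> C) (l : C) (e : nat -> R) :
  Clim u l -> (forall n, Cmod (v n - u n) <= e n)%R -> is_lim_seq e 0%R -> Clim v l.
Proof.
  intros Hu He H0. apply Clim_ext with (fun n => u n + (v n - u n)); [intros; ring|].
  replace l with (l + 0) by ring. apply Clim_plus; auto.
  apply Clim_bound with e; auto. intros n.
  replace (v n - u n - 0) with (v n - u n) by ring. auto.
Qed.

Lemma locally_Cmod (l : C) (P : C -> Prop) :
  locally l P <-> exists e, (0 < e)%R /\ forall z, (Cmod (z - l) < e)%R -> P z.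
Proof.
  split.
  - intros [e He]. exists e; split; [apply cond_pos|]. intros z Hz. apply He.
    now apply (C_NormedModule_mixin_compat1 l z e).
  - intros [e [He H]].
    (* The balls of [locally] come from the product structure and compare with [Cmod] up to the
       factor sqrt 2, which is at most 2. *)
    assert (Hs : (0 < e / 2)%R) by lra.
    exists (mkposreal _ Hs). intros z Hz. apply H.
    pose proof (C_NormedModule_mixin_compat2 l z (mkposreal _ Hs) Hz) as H1.
    simpl in H1. change (Cmod (z - l) < sqrt 2 * (e / 2))%R in H1.
    assert (sqrt 2 <= 2)%R; [|nra].
    rewrite <- (sqrt_Rsqr 2) at 2 by lra. apply sqrt_le_1_alt; unfold Rsqr; lra.
Qed.

Lemma filterlim_C {T : Type} (F : (T -> Prop) -> Prop) {FF : Filter F} (f : T -> C) (l : C) :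
  filterlim f F (locally l) <->
  forall e, (0 < e)%R -> F (fun x => (Cmod (f x - l) < e)%R).
Proof.
  split.
  - intros H e He. apply (H (fun z => (Cmod (z - l) < e)%R)). apply locally_Cmod.
    exists e; auto.
  - intros H P HP. apply locally_Cmod in HP. destruct HP as [e [He HP]].
    unfold filtermap. generalize (H e He). apply filter_imp. auto.
Qed.

Lemma Clim_eps (u : nat -> C) (l : C) :
  Clim u l <-> forall e, (0 < e)%R ->
    exists N, forall n, (N <= n)%nat -> (Cmod (u n - l) < e)%R.
Proof.
  unfold Clim. rewrite <- is_lim_seq_spec. simpl. split.
  - intros H e He. destruct (H (mkposreal e He)) as [N HN]. exists N. intros n Hn.
    specialize (HN n Hn). simpl in HN. rewrite Rminus_0_r, Rabs_pos_eq in HN; auto.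
    apply Cmod_ge_0.
  - intros H e. destruct (H e (cond_pos e)) as [N HN]. exists N. intros n Hn.
    rewrite Rminus_0_r, Rabs_pos_eq; auto. apply Cmod_ge_0.
Qed.

Lemma Clim_filterlim (u : nat -> C) (l : C) :
  Clim u l <-> filterlim u eventually (locally l).
Proof. rewrite Clim_eps, filterlim_C by apply eventually_filter. reflexivity. Qed.

(** * Finite sums and series *)

(** The upper index is excluded, unlike in [sum_n]: the empty sum exists and summation formulas have
    no special first term. [csum_sum_n] converts. *)
Fixpoint csum (f : nat -> C) (n : nat) : C :=
  match n with O => 0 | S n' => csum f n' + f n' end.

Fixpoint rsum (f : nat -> R) (n : nat) : R :=
  match n with O => 0%R | S n' => (rsum f n' + f n')%R end.

Lemma csum_ext (f g : nat -> C) (n : nat) :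
  (forall i, (i < n)%nat -> f i = g i) -> csum f n = csum g n.
Proof.
  induction n; simpl; intros H; auto. rewrite IHn, H; auto.
Qed.

Lemma csum_plus (f g : nat -> C) (n : nat) :
  csum (fun i => f i + g i) n = csum f n + csum g n.
Proof. induction n; simpl; [|rewrite IHn]; ring. Qed.

Lemma csum_scal (c : C) (f : nat -> C) (n : nat) :
  csum (fun i => c * f i) n = c * csum f n.
Proof. induction n; simpl; [|rewrite IHn]; ring. Qed.

Lemma csum_opp (f : nat -> C) (n : nat) :
  csum (fun i => - f i) n = - csum f n.
Proof. induction n; simpl; [|rewrite IHn]; ring. Qed.

Lemma csum_const (c : C) (n : nat) : csum (fun _ => c) n = RtoC (INR n) * c.
Proof.
  induction n; simpl csum; [simpl; ring|]. rewrite IHn, S_INR, RtoC_plus. ring.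
Qed.

Lemma csum_zero (n : nat) : csum (fun _ => 0) n = 0.
Proof. rewrite csum_const; ring. Qed.

Lemma csum_shift (f : nat -> C) (n : nat) :
  csum f (S n) = f O + csum (fun i => f (S i)) n.
Proof.
  induction n. simpl; ring. change (csum f (S (S n))) with (csum f (S n) + f (S n)).
  rewrite IHn. simpl; ring.
Qed.

Lemma csum_add (f : nat -> C) (n p : nat) :
  csum f (n + p) = csum f n + csum (fun i => f (n + i)%nat) p.
Proof.
  induction p; simpl. rewrite Nat.add_0_r; ring.
  rewrite Nat.add_succ_r; simpl. rewrite IHp; ring.
Qed.

Lemma csum_swap (f : nat -> nat -> C) (n p : nat) :
  csum (fun i => csum (f i) p) n = csum (fun j => csum (fun i => f i j) n) p.
Proof.
  induction n; simpl. now rewrite csum_zero. now rewrite IHn, csum_plus.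
Qed.

Lemma csum_telescope (f : nat -> C) (n : nat) :
  csum (fun i => f (S i) - f i) n = f n - f O.
Proof. induction n; simpl; [|rewrite IHn]; ring. Qed.

Lemma csum_norm (f : nat -> C) (n : nat) :
  (Cmod (csum f n) <= rsum (fun i => Cmod (f i)) n)%R.
Proof.
  induction n; simpl. rewrite Cmod_0; lra.
  pose proof (Cmod_triangle (csum f n) (f n)). lra.
Qed.

Lemma rsum_le (f g : nat -> R) (n : nat) :
  (forall i, (i < n)%nat -> f i <= g i)%R -> (rsum f n <= rsum g n)%R.
Proof.
  induction n; simpl; intros H. lra.
  assert (rsum f n <= rsum g n)%R by (apply IHn; auto).
  assert (f n <= g n)%R by auto. lra.
Qed.

Lemma rsum_scal (c : R) (f : nat -> R) (n : nat) :
  rsum (fun i => c * f i)%R n = (c * rsum f n)%R.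
Proof. induction n; simpl; [|rewrite IHn]; ring. Qed.

Lemma rsum_const (c : R) (n : nat) : rsum (fun _ => c) n = (INR n * c)%R.
Proof. induction n; simpl rsum; [simpl; ring|]. rewrite IHn, S_INR. ring. Qed.

Lemma rsum_telescope (f : nat -> R) (n : nat) :
  rsum (fun i => f (S i) - f i)%R n = (f n - f O)%R.
Proof. induction n; simpl; [|rewrite IHn]; ring. Qed.

Lemma rsum_nonneg (f : nat -> R) (n : nat) :
  (forall i, 0 <= f i)%R -> (0 <= rsum f n)%R.
Proof. intros H; induction n; simpl. lra. specialize (H n); lra. Qed.

Lemma rsum_mono (f : nat -> R) (n p : nat) :
  (forall i, 0 <= f i)%R -> (n <= p)%nat -> (rsum f n <= rsum f p)%R.
Proof. intros H Hn; induction Hn; simpl. lra. specialize (H m); lra. Qed.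

Lemma csum_norm_le (f : nat -> C) (u : nat -> R) (n : nat) :
  (forall i, (i < n)%nat -> Cmod (f i) <= u i)%R -> (Cmod (csum f n) <= rsum u n)%R.
Proof.
  intros H. apply Rle_trans with (1 := csum_norm f n). now apply rsum_le.
Qed.

Lemma rsum_sum_n (u : nat -> R) (n : nat) : rsum u (S n) = sum_n u n.
Proof.
  induction n.
  - simpl. rewrite sum_O. ring.
  - rewrite sum_Sn, <- IHn. reflexivity.
Qed.

Lemma csum_sum_n (u : nat -> C) (n : nat) :
  csum u (S n) = sum_n (G := C_AbelianMonoid) u n.
Proof.
  induction n.
  - simpl. rewrite sum_O. ring.
  - rewrite sum_Sn, <- IHn. reflexivity.
Qed.

Lemma rsum_bounded_ex_series (u : nat -> R) (B : R) :
  (forall n, 0 <= u n)%R -> (forall n, rsum u n <= B)%R -> ex_series u.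
Proof.
  intros Hu HB. destruct (ex_finite_lim_seq_incr (sum_n u) B) as [l Hl].
  - intros n. rewrite sum_Sn. unfold plus; simpl. specialize (Hu (S n)); lra.
  - intros n. rewrite <- rsum_sum_n; auto.
  - exists l. exact Hl.
Qed.

Lemma rsum_lim (u : nat -> R) : ex_series u -> is_lim_seq (rsum u) (Series u).
Proof.
  intros H. apply is_lim_seq_incr_1. apply is_lim_seq_ext with (sum_n u).
  - intros n; now rewrite rsum_sum_n.
  - exact (Series_correct u H).
Qed.

Lemma rsum_le_Series (u : nat -> R) (n : nat) :
  (forall i, 0 <= u i)%R -> ex_series u -> (rsum u n <= Series u)%R.
Proof.
  intros Hu H. apply (is_lim_seq_incr_compare (rsum u)).
  - now apply rsum_lim.
  - intros i; simpl; specialize (Hu i); lra.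
Qed.

Lemma Series_le_bound (u : nat -> R) (B : R) :
  ex_series u -> (forall n, rsum u n <= B)%R -> (Series u <= B)%R.
Proof.
  intros H HB. change (Rbar_le (Series u) B).
  apply (is_lim_seq_le (rsum u) (fun _ => B)); auto.
  - now apply rsum_lim.
  - apply is_lim_seq_const.
Qed.

Lemma rsum_tail (u : nat -> R) :
  ex_series u -> is_lim_seq (fun n => Series u - rsum u n)%R 0%R.
Proof.
  intros H. replace (Finite 0) with (Finite (Series u - Series u)) by (f_equal; ring).
  apply is_lim_seq_minus'. apply is_lim_seq_const. now apply rsum_lim.
Qed.

Definition Csum (a : nat -> C) (l : C) : Prop := Clim (csum a) l.

Lemma Csum_is_series (a : nat -> C) (l : C) :
  Csum a l <-> is_series (K := C_AbsRing) (V := C_NormedModule) a l.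
Proof.
  unfold Csum. rewrite <- Clim_incr_1, Clim_filterlim. unfold is_series.
  split; apply filterlim_ext; intros n; rewrite <- csum_sum_n; reflexivity.
Qed.

Lemma Csum_ext (a b : nat -> C) (l : C) :
  (forall n, a n = b n) -> Csum a l -> Csum b l.
Proof. intros H. apply Clim_ext. intros n; apply csum_ext; auto. Qed.

Lemma Csum_unique (a : nat -> C) (l l' : C) : Csum a l -> Csum a l' -> l = l'.
Proof. apply Clim_unique. Qed.

Lemma Csum_plus (a b : nat -> C) (l l' : C) :
  Csum a l -> Csum b l' -> Csum (fun n => a n + b n) (l + l').
Proof.
  intros Ha Hb. unfold Csum. apply Clim_ext with (fun n => csum a n + csum b n).
  intros n; now rewrite csum_plus. now apply Clim_plus.
Qed.

Lemma Csum_scal (c : C) (a : nat -> C) (l : C) :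
  Csum a l -> Csum (fun n => c * a n) (c * l).
Proof.
  intros Ha. unfold Csum. apply Clim_ext with (fun n => c * csum a n).
  intros n; now rewrite csum_scal. now apply Clim_scal.
Qed.

Lemma Csum_opp (a : nat -> C) (l : C) : Csum a l -> Csum (fun n => - a n) (- l).
Proof.
  intros H. apply Csum_ext with (fun n => - (1) * a n); [intros; ring|].
  replace (- l) with (- (1) * l) by ring. now apply Csum_scal.
Qed.

Lemma Csum_minus (a b : nat -> C) (l l' : C) :
  Csum a l -> Csum b l' -> Csum (fun n => a n - b n) (l - l').
Proof. intros. apply Csum_plus; auto. now apply Csum_opp. Qed.

Lemma Csum_zero : Csum (fun _ => 0) 0.
Proof.
  apply Clim_ext with (fun _ => 0); [|apply Clim_const].
  intros n; now rewrite csum_zero.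
Qed.

Lemma Csum_csum (a : nat -> nat -> C) (l : nat -> C) (n : nat) :
  (forall i, (i < n)%nat -> Csum (a i) (l i)) ->
  Csum (fun j => csum (fun i => a i j) n) (csum l n).
Proof.
  induction n; simpl; intros H. apply Csum_zero.
  apply Csum_plus; auto.
Qed.

Lemma Csum_shift (a : nat -> C) (l : C) :
  Csum (fun n => a (S n)) l <-> Csum a (a O + l).
Proof.
  unfold Csum. rewrite <- (Clim_incr_1 (csum a)). split; intros H.
  - apply Clim_ext with (fun n => a O + csum (fun i => a (S i)) n).
    intros n; now rewrite csum_shift. apply Clim_plus; auto. apply Clim_const.
  - apply Clim_ext with (fun n => csum a (S n) - a O).
    intros n; rewrite csum_shift; ring.
    replace l with (a O + l - a O) by ring. apply Clim_minus; auto. apply Clim_const.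
Qed.

Lemma Csum_exists (a : nat -> C) (u : nat -> R) :
  (forall n, Cmod (a n) <= u n)%R -> ex_series u -> exists l, Csum a l.
Proof.
  intros Ha Hu.
  destruct (@ex_series_le C_AbsRing C_CompleteNormedModule a u) as [l Hl]; auto.
  exists l. apply Csum_is_series. exact Hl.
Qed.

(** The difference is the limit in p of the blocks from n to n + p, and each block is bounded by the
    same block of the majorant. *)
Lemma Csum_tail (a : nat -> C) (u : nat -> R) (l : C) (n : nat) :
  (forall i, Cmod (a i) <= u i)%R -> ex_series u -> Csum a l ->
  (Cmod (l - csum a n) <= Series u - rsum u n)%R.
Proof.
  intros Ha Hu Hl.
  assert (Hp : forall i, (0 <= u i)%R).
  { intros i. apply Rle_trans with (2 := Ha i). apply Cmod_ge_0. }
  apply Clim_norm_le with (fun p => csum a (n + p)%nat - csum a n).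
  - apply Clim_minus; [|apply Clim_const].
    apply Clim_ext with (fun p => csum a (p + n)%nat).
    { intros; f_equal; lia. }
    unfold Clim. apply (is_lim_seq_incr_n (fun p => Cmod (csum a p - l)) n). exact Hl.
  - intros p. replace (csum a (n + p) - csum a n) with (csum (fun i => a (n + i)%nat) p)
      by (rewrite csum_add; ring).
    apply Rle_trans with (rsum (fun i => u (n + i)%nat) p).
    + apply csum_norm_le; auto.
    + assert (H : (rsum u (n + p) = rsum u n + rsum (fun i => u (n + i)%nat) p)%R).
      { clear; induction p; simpl. rewrite Nat.add_0_r; ring.
        rewrite Nat.add_succ_r; simpl; rewrite IHp; ring. }
      pose proof (rsum_le_Series u (n + p) Hp Hu). lra.
Qed.

Lemma Csum_norm_le (a : nat -> C) (u : nat -> R) (l : C) :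
  (forall i, Cmod (a i) <= u i)%R -> ex_series u -> Csum a l ->
  (Cmod l <= Series u)%R.
Proof.
  intros Ha Hu Hl. pose proof (Csum_tail a u l O Ha Hu Hl) as H. simpl in H.
  replace (l - 0) with l in H by ring. lra.
Qed.

Lemma ex_series_Rscal (c : R) (u : nat -> R) :
  ex_series u -> ex_series (fun n => c * u n)%R.
Proof. intros H. now apply (ex_series_scal_l (V := R_NormedModule) c u). Qed.

(** * Double series dominated by a product *)

Lemma dominated_row (a : nat -> nat -> C) (u v : nat -> R) (m : nat) :
  (forall m n, Cmod (a m n) <= u m * v n)%R -> ex_series v -> exists l, Csum (a m) l.
Proof.
  intros Ha Ev.
  apply Csum_exists with (fun n => u m * v n)%R; auto. now apply ex_series_Rscal.
Qed.

Lemma dominated_rows (a : nat -> nat -> C) (u v : nat -> R) :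
  (forall m n, Cmod (a m n) <= u m * v n)%R -> ex_series u -> ex_series v ->
  exists r l, (forall m, Csum (a m) (r m)) /\ Csum r l.
Proof.
  intros Ha Eu Ev.
  pose (r := fun m => proj1_sig (constructive_indefinite_description _
                                   (dominated_row a u v m Ha Ev))).
  assert (Hr : forall m, Csum (a m) (r m)).
  { intros m. unfold r.
    destruct (constructive_indefinite_description _ (dominated_row a u v m Ha Ev)); auto. }
  destruct (Csum_exists r (fun m => Series v * u m)%R) as [l Hl].
  - intros m. rewrite Rmult_comm, <- Series_scal_l. apply Csum_norm_le with (a m); auto.
    now apply ex_series_Rscal.
  - now apply ex_series_Rscal.
  - exists r, l; auto.
Qed.

(** The error consists of the tails of the first N rows and the tail of the series of row sums. An
    explicit rate, depending only on [u] and [v], later gives convergence that is uniform in a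
    parameter. *)
Lemma dominated_box_rate (a : nat -> nat -> C) (u v : nat -> R) (r : nat -> C) (l : C) (N : nat) :
  (forall m, 0 <= u m)%R -> (forall n, 0 <= v n)%R ->
  (forall m n, Cmod (a m n) <= u m * v n)%R -> ex_series u -> ex_series v ->
  (forall m, Csum (a m) (r m)) -> Csum r l ->
  (Cmod (csum (fun m => csum (a m) N) N - l)
   <= Series u * (Series v - rsum v N) + Series v * (Series u - rsum u N))%R.
Proof.
  intros Hu Hv Ha Eu Ev Hr Hl.
  replace (csum (fun m => csum (a m) N) N - l)
    with (- csum (fun m => r m - csum (a m) N) N + - (l - csum r N))
    by (unfold Cminus; rewrite csum_plus, csum_opp; ring).
  eapply Rle_trans; [apply Cmod_triangle|]. rewrite !Cmod_opp. apply Rplus_le_compat.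
  - apply Rle_trans with (rsum (fun m => (Series v - rsum v N) * u m)%R N).
    + apply csum_norm_le. intros m _.
      pose proof (Csum_tail (a m) (fun n => u m * v n)%R (r m) N (Ha m)
                    (ex_series_Rscal _ _ Ev) (Hr m)) as H.
      rewrite Series_scal_l, rsum_scal in H. lra.
    + rewrite rsum_scal. pose proof (rsum_le_Series u N Hu Eu).
      pose proof (rsum_le_Series v N Hv Ev). nra.
  - rewrite Rmult_minus_distr_l, <- Series_scal_l, <- rsum_scal.
    apply Csum_tail; auto.
    + intros m. rewrite Rmult_comm, <- Series_scal_l. apply Csum_norm_le with (a m); auto.
      now apply ex_series_Rscal.
    + now apply ex_series_Rscal.
Qed.

Lemma dominated_box (a : nat -> nat -> C) (u v : nat -> R) (r : nat -> C) (l : C) :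
  (forall m, 0 <= u m)%R -> (forall n, 0 <= v n)%R ->
  (forall m n, Cmod (a m n) <= u m * v n)%R -> ex_series u -> ex_series v ->
  (forall m, Csum (a m) (r m)) -> Csum r l ->
  Clim (fun N => csum (fun m => csum (a m) N) N) l.
Proof.
  intros Hu Hv Ha Eu Ev Hr Hl.
  apply Clim_bound with (fun N => Series u * (Series v - rsum v N)
                                  + Series v * (Series u - rsum u N))%R.
  - intros N. now apply dominated_box_rate with r.
  - replace (Finite 0) with (Finite (Series u * 0 + Series v * 0)) by (f_equal; ring).
    apply is_lim_seq_plus'.
    + apply (is_lim_seq_scal_l _ _ (Finite 0)). now apply rsum_tail.
    + apply (is_lim_seq_scal_l _ _ (Finite 0)). now apply rsum_tail.
Qed.

(** Rows first and columns first both agree with the limit over square boxes, because a finite box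
    sum does not depend on the order. *)
Lemma dominated_fubini (a : nat -> nat -> C) (u v : nat -> R) :
  (forall m, 0 <= u m)%R -> (forall n, 0 <= v n)%R ->
  (forall m n, Cmod (a m n) <= u m * v n)%R -> ex_series u -> ex_series v ->
  exists r c l, (forall m, Csum (a m) (r m)) /\ (forall n, Csum (fun m => a m n) (c n))
    /\ Csum r l /\ Csum c l /\ Clim (fun N => csum (fun m => csum (a m) N) N) l.
Proof.
  intros Hu Hv Ha Eu Ev.
  destruct (dominated_rows a u v Ha Eu Ev) as [r [l [Hr Hl]]].
  assert (Ha' : forall n m, (Cmod (a m n) <= v n * u m)%R)
    by (intros; rewrite Rmult_comm; auto).
  destruct (dominated_rows (fun n m => a m n) v u Ha' Ev Eu) as [c [l' [Hc Hl']]].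
  pose proof (dominated_box a u v r l Hu Hv Ha Eu Ev Hr Hl) as B1.
  pose proof (dominated_box (fun n m => a m n) v u c l' Hv Hu Ha' Ev Eu Hc Hl') as B2.
  assert (E : l' = l).
  { apply Clim_unique with (2 := B1). apply Clim_ext with (2 := B2).
    intros N. symmetry. apply csum_swap. }
  rewrite E in Hl'. exists r, c, l; auto 6.
Qed.

(** * Complex-valued functions of a real variable *)

(** By components, so that the real mean value theorem and the real fundamental theorem of calculus
    apply directly. *)
Definition Cder (f : R -> C) (x : R) (l : C) : Prop :=
  is_derive (fun t => Re (f t)) x (Re l) /\ is_derive (fun t => Im (f t)) x (Im l).

Lemma Cder_const (c : C) (x : R) : Cder (fun _ => c) x 0.
Proof. split; simpl; auto_derive; auto. Qed.

Lemma Cder_RtoC (f : R -> R) (x l : R) :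
  is_derive f x l -> Cder (fun t => RtoC (f t)) x (RtoC l).
Proof. intros H; split; simpl; auto. auto_derive; auto. Qed.

Lemma Cder_id (x : R) : Cder (fun t => RtoC t) x 1.
Proof. apply Cder_RtoC. auto_derive; auto. Qed.

Lemma Cder_plus (f g : R -> C) (x : R) (a b : C) :
  Cder f x a -> Cder g x b -> Cder (fun t => f t + g t) x (a + b).
Proof.
  intros [H1 H2] [H3 H4]; split; simpl.
  - exact (is_derive_plus _ _ x _ _ H1 H3).
  - exact (is_derive_plus _ _ x _ _ H2 H4).
Qed.

Lemma Cder_mult (f g : R -> C) (x : R) (a b : C) :
  Cder f x a -> Cder g x b -> Cder (fun t => f t * g t) x (a * g x + f x * b).
Proof.
  intros [H1 H2] [H3 H4].
  assert (M : forall u v du dv, is_derive u x du -> is_derive v x dv ->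
             is_derive (fun t => u t * v t)%R x (du * v x + u x * dv)%R).
  { intros u v du dv Hu Hv. apply (is_derive_mult u v x du dv Hu Hv).
    intros; apply Rmult_comm. }
  split; simpl.
  - replace (_ + _)%R with ((Re a * Re (g x) + Re (f x) * Re b)
        - (Im a * Im (g x) + Im (f x) * Im b))%R by (unfold Re, Im; ring).
    apply (is_derive_minus (fun t => Re (f t) * Re (g t))%R (fun t => Im (f t) * Im (g t))%R);
      now apply M.
  - replace (_ + _)%R with ((Re a * Im (g x) + Re (f x) * Im b)
        + (Im a * Re (g x) + Im (f x) * Re b))%R by (unfold Re, Im; ring).
    apply (is_derive_plus (fun t => Re (f t) * Im (g t))%R (fun t => Im (f t) * Re (g t))%R);
      now apply M.
Qed.

Lemma Cder_scal (c : C) (f : R -> C) (x : R) (a : C) :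
  Cder f x a -> Cder (fun t => c * f t) x (c * a).
Proof.
  intros H. replace (c * a) with (0 * f x + c * a) by ring.
  apply (Cder_mult (fun _ => c)); auto. apply Cder_const.
Qed.

Lemma Cder_opp (f : R -> C) (x : R) (a : C) :
  Cder f x a -> Cder (fun t => - f t) x (- a).
Proof.
  intros [H1 H2]; split; simpl.
  - exact (is_derive_opp _ x _ H1).
  - exact (is_derive_opp _ x _ H2).
Qed.

Lemma Cder_minus (f g : R -> C) (x : R) (a b : C) :
  Cder f x a -> Cder g x b -> Cder (fun t => f t - g t) x (a - b).
Proof. intros Hf Hg. apply Cder_plus; auto. now apply Cder_opp. Qed.

Lemma Cder_eq (f : R -> C) (x : R) (a b : C) : Cder f x a -> a = b -> Cder f x b.
Proof. now intros H <-. Qed.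

Lemma Cder_pow (f : R -> C) (x : R) (a : C) (n : nat) :
  Cder f x a -> Cder (fun t => f t ^ S n) x (RtoC (INR (S n)) * a * f x ^ n).
Proof.
  intros H. induction n.
  - simpl. apply Cder_eq with (a * 1 + f x * 0); [|ring].
    apply (Cder_mult f (fun _ => 1)); auto. apply Cder_const.
  - apply Cder_eq with (a * f x ^ S n + f x * (RtoC (INR (S n)) * a * f x ^ n)).
    + apply (Cder_mult f (fun t => f t ^ S n)); auto.
    + rewrite (S_INR (S n)), RtoC_plus. simpl (f x ^ S n). ring.
Qed.

Lemma Cder_inv (f : R -> C) (x : R) (a : C) :
  f x <> 0 -> Cder f x a -> Cder (fun t => / f t) x (- a / (f x * f x)).
Proof.
  intros Hx [H1 H2].
  assert (Hn : ((Re (f x)) ^ 2 + (Im (f x)) ^ 2 <> 0)%R).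
  { rewrite <- Cmod2_alt. apply pow_nonzero. intros E; apply Hx; now apply Cmod_eq_0. }
  assert (D : is_derive (fun t => (Re (f t)) ^ 2 + (Im (f t)) ^ 2)%R x
                (2 * Re (f x) * Re a + 2 * Im (f x) * Im a)%R).
  { apply (is_derive_plus (fun t => (Re (f t)) ^ 2)%R (fun t => (Im (f t)) ^ 2)%R).
    - replace (2 * Re (f x) * Re a)%R with (INR 2 * Re a * Re (f x) ^ 1)%R by (simpl; ring).
      exact (is_derive_pow _ 2 x _ H1).
    - replace (2 * Im (f x) * Im a)%R with (INR 2 * Im a * Im (f x) ^ 1)%R by (simpl; ring).
      exact (is_derive_pow _ 2 x _ H2). }
  assert (E : - a / (f x * f x)
            = - a * ((/ f x) * (/ f x))) by (field; auto).
  rewrite E.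
  destruct (f x) as [p q] eqn:Ef. destruct a as [a1 a2].
  simpl in *.
  split; simpl.
  - replace (_ - _)%R with ((a1 * (p ^ 2 + q ^ 2) - p * (2 * p * a1 + 2 * q * a2))
       / (p ^ 2 + q ^ 2) ^ 2)%R by (field; intros Z0; apply Hn; rewrite <- Z0; ring).
    pose proof (is_derive_div _ _ x _ _ H1 D) as HD. simpl in HD. rewrite Ef in HD.
    simpl in HD. apply HD. exact Hn.
  - replace (_ + _)%R with ((- a2 * (p ^ 2 + q ^ 2) - - q * (2 * p * a1 + 2 * q * a2))
       / (p ^ 2 + q ^ 2) ^ 2)%R by (field; intros Z0; apply Hn; rewrite <- Z0; ring).
    pose proof (is_derive_div _ _ x _ _ (is_derive_opp _ x _ H2) D) as HD. simpl in HD.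
    rewrite Ef in HD. simpl in HD. apply HD. exact Hn.
Qed.

Lemma Cder_comp_shift (f : R -> C) (c x : R) (a : C) :
  Cder f (c + x)%R a -> Cder (fun t => f (c + t)%R) x a.
Proof.
  intros [H1 H2].
  assert (S : is_derive (fun t => c + t)%R x 1%R) by (auto_derive; auto).
  split.
  - replace (Re a) with (1 * Re a)%R by ring. exact (is_derive_comp _ _ x _ _ H1 S).
  - replace (Im a) with (1 * Im a)%R by ring. exact (is_derive_comp _ _ x _ _ H2 S).
Qed.

(* Apply the real mean value inequality to the component of [f] in the direction
   of [f b - f a]; this keeps the constant equal to 1. *)
Lemma Cder_mean_value (f f' : R -> C) (h h' : R -> R) (a b : R) :
  (a <= b)%R ->
  (forall t, (a <= t <= b)%R -> Cder f t (f' t)) ->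
  (forall t, (a <= t <= b)%R -> is_derive h t (h' t)) ->
  (forall t, (a <= t <= b)%R -> (Cmod (f' t) <= h' t)%R) ->
  (Cmod (f b - f a) <= h b - h a)%R.
Proof.
  intros Hab Hf Hh Hle.
  set (d := f b - f a).
  destruct (Req_dec (Cmod d) 0) as [Z|Z].
  - rewrite Z.
    destruct (MVT_gen h a b h') as [c [Hc E]].
    + intros x Hx. rewrite Rmin_left, Rmax_right in Hx by auto. apply Hh; lra.
    + intros x Hx. rewrite Rmin_left, Rmax_right in Hx by auto.
      apply continuity_pt_filterlim. apply (ex_derive_continuous h). exists (h' x). auto.
    + rewrite Rmin_left, Rmax_right in Hc by auto. rewrite E.
      pose proof (Hle c Hc). pose proof (Cmod_ge_0 (f' c)). nra.
  - set (u := (/ RtoC (Cmod d)) * Cconj d).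
    assert (Zd : RtoC (Cmod d) <> 0) by (intros E; apply Z; now injection E).
    assert (Hu : Cmod u = 1%R).
    { unfold u. rewrite Cmod_mult, Cmod_inv, Cmod_conj, Cmod_R, Rabs_pos_eq; auto.
      now field. apply Cmod_ge_0. }
    assert (Hud : Re (u * d) = Cmod d).
    { assert (E : u * d = RtoC (Cmod d)).
      { unfold u. replace (/ Cmod d * Cconj d * d) with (/ Cmod d * (d * Cconj d)) by ring.
        rewrite <- Cmod2_conj. simpl. rewrite Rmult_1_r, RtoC_mult. field. auto. }
      rewrite E. reflexivity. }
    set (phi := fun t => (Re (u * f t) - h t)%R).
    destruct (MVT_gen phi a b (fun t => (Re (u * f' t) - h' t)%R)) as [c [Hc E]].
    + intros x Hx. rewrite Rmin_left, Rmax_right in Hx by auto.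
      apply (is_derive_minus (fun t => Re (u * f t)) h).
      * apply (Cder_scal u f x (f' x)). apply Hf; lra.
      * apply Hh; lra.
    + intros x Hx. rewrite Rmin_left, Rmax_right in Hx by auto.
      apply continuity_pt_filterlim. apply (ex_derive_continuous phi).
      exists (Re (u * f' x) - h' x)%R.
      apply (is_derive_minus (fun t => Re (u * f t)) h).
      * apply (Cder_scal u f x (f' x)). apply Hf; lra.
      * apply Hh; lra.
    + rewrite Rmin_left, Rmax_right in Hc by auto.
      assert (L : (Re (u * f' c) - h' c <= 0)%R).
      { pose proof (re_le_Cmod (u * f' c)) as H1. rewrite Cmod_mult, Hu in H1.
        pose proof (Rle_abs (Re (u * f' c))). pose proof (Hle c Hc). lra. }
      assert (E2 : (phi b - phi a = Cmod d - (h b - h a))%R).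
      { rewrite <- Hud. unfold phi, d.
        replace (Re (u * (f b - f a))) with (Re (u * f b) - Re (u * f a))%R
          by (simpl; ring). ring. }
      rewrite E2 in E. nra.
Qed.

Lemma Cder_diff_le (f f' : R -> C) (K a b : R) :
  (a <= b)%R ->
  (forall t, (a <= t <= b)%R -> Cder f t (f' t)) ->
  (forall t, (a <= t <= b)%R -> (Cmod (f' t) <= K)%R) ->
  (Cmod (f b - f a) <= K * (b - a))%R.
Proof.
  intros Hab Hf HK.
  replace (K * (b - a))%R with (K * b - K * a)%R by ring.
  apply (Cder_mean_value f f' (fun t => K * t)%R (fun _ => K)); auto.
  intros; auto_derive; auto; ring.
Qed.

(** The function [f s - f a - (s - a) * f' s] vanishes at [a] and has derivative
    [- (s - a) * f'' s], so the first-order bound applies to it. *)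
Lemma Cder_taylor_end (f f' f'' : R -> C) (K a b : R) :
  (a <= b)%R ->
  (forall t, (a <= t <= b)%R -> Cder f t (f' t)) ->
  (forall t, (a <= t <= b)%R -> Cder f' t (f'' t)) ->
  (forall t, (a <= t <= b)%R -> (Cmod (f'' t) <= K)%R) ->
  (Cmod (f b - f a - RtoC (b - a) * f' b) <= K * (b - a) ^ 2)%R.
Proof.
  intros Hab Hf Hf' HK.
  assert (K0 : (0 <= K)%R).
  { apply Rle_trans with (2 := HK a ltac:(lra)). apply Cmod_ge_0. }
  pose proof (Cder_diff_le (fun s => f s - f a - (RtoC s - RtoC a) * f' s)
                (fun s => - (RtoC s - RtoC a) * f'' s) (K * (b - a)) a b Hab) as H.
  replace (f b - f a - RtoC (b - a) * f' b)
    with (f b - f a - (RtoC b - RtoC a) * f' b - (f a - f a - (RtoC a - RtoC a) * f' a))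
    by (rewrite RtoC_minus; ring).
  apply Rle_trans with (K * (b - a) * (b - a))%R; [|lra].
  apply H.
  - intros t Ht.
    apply Cder_eq with (f' t - 0 - ((1 - 0) * f' t + (RtoC t - RtoC a) * f'' t)); [|ring].
    apply Cder_minus.
    + apply Cder_minus; auto. apply Cder_const.
    + apply (Cder_mult (fun s => RtoC s - RtoC a) f'); auto.
      apply Cder_minus. apply Cder_id. apply Cder_const.
  - intros t Ht. rewrite Cmod_mult, Cmod_opp, <- RtoC_minus, Cmod_R, Rabs_pos_eq by lra.
    pose proof (HK t Ht). pose proof (Cmod_ge_0 (f'' t)). nra.
Qed.

(** The first-order bound is used twice: for [t -> f (1 + t) - f t], and for its derivative, which
    is itself an increment of [f']. *)
Lemma Cder_second_difference (f f' f'' : R -> C) (K a : R) :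
  (forall t, (a <= t <= a + 2)%R -> Cder f t (f' t)) ->
  (forall t, (a <= t <= a + 2)%R -> Cder f' t (f'' t)) ->
  (forall t, (a <= t <= a + 2)%R -> (Cmod (f'' t) <= K)%R) ->
  (Cmod (f (1 + (a + 1))%R - f (a + 1)%R - (f (1 + a)%R - f a)) <= K)%R.
Proof.
  intros Hf Hf' HK.
  pose proof (Cder_diff_le (fun t => f (1 + t)%R - f t) (fun t => f' (1 + t)%R - f' t)
                K a (a + 1) ltac:(lra)) as H.
  apply Rle_trans with (K * (a + 1 - a))%R; [apply H|lra].
  - intros t Ht. apply Cder_minus; [apply Cder_comp_shift|]; apply Hf; lra.
  - intros t Ht. apply Rle_trans with (K * (1 + t - t))%R; [|lra].
    apply (Cder_diff_le f' f''); [lra| |]; intros s Hs; [apply Hf' | apply HK]; lra.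
Qed.

(** With the right end s variable, the error has derivative [/ 2 * (f' s - f' a - (s - a) * f'' s)],
    which is the Taylor error of [f'] at s. *)
Lemma Cder_trapezoid (f f' f'' f''' : R -> C) (K a : R) :
  (forall t, (a <= t <= a + 1)%R -> Cder f t (f' t)) ->
  (forall t, (a <= t <= a + 1)%R -> Cder f' t (f'' t)) ->
  (forall t, (a <= t <= a + 1)%R -> Cder f'' t (f''' t)) ->
  (forall t, (a <= t <= a + 1)%R -> (Cmod (f''' t) <= K)%R) ->
  (Cmod (f (a + 1)%R - f a - / 2 * (f' a + f' (a + 1)%R)) <= K)%R.
Proof.
  intros H1 H2 H3 HK.
  assert (K0 : (0 <= K)%R).
  { apply Rle_trans with (2 := HK a ltac:(lra)). apply Cmod_ge_0. }
  pose proof (Cder_diff_le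
     (fun s => f s - f a - / 2 * ((RtoC s - RtoC a) * (f' a + f' s)))
     (fun s => / 2 * (f' s - f' a - (RtoC s - RtoC a) * f'' s)) K a (a + 1) ltac:(lra)) as H.
  replace (f (a + 1)%R - f a - / 2 * (f' a + f' (a + 1)%R)) with
    (f (a + 1)%R - f a - / 2 * ((RtoC (a + 1) - RtoC a) * (f' a + f' (a + 1)%R))
     - (f a - f a - / 2 * ((RtoC a - RtoC a) * (f' a + f' a))))
    by (rewrite RtoC_plus; ring).
  apply Rle_trans with (K * (a + 1 - a))%R; [apply H|lra].
  - intros t Ht.
    apply Cder_eq with (f' t - 0 - / 2 * ((1 - 0) * (f' a + f' t)
                                  + (RtoC t - RtoC a) * (0 + f'' t))).
    + apply Cder_minus; [apply Cder_minus; auto; apply Cder_const|].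
      apply Cder_scal. apply (Cder_mult (fun s => RtoC s - RtoC a) (fun s => f' a + f' s)).
      * apply Cder_minus. apply Cder_id. apply Cder_const.
      * apply Cder_plus; auto. apply Cder_const.
    + field. try (apply RtoC_neq_0; lra).
  - intros t Ht. rewrite Cmod_mult.
    assert (E : Cmod (/ 2) = (/ 2)%R).
    { rewrite <- RtoC_inv, Cmod_R, Rabs_pos_eq by lra; auto. }
    rewrite E.
    assert (T : (Cmod (f' t - f' a - RtoC (t - a) * f'' t) <= K * (t - a) ^ 2)%R).
    { apply (Cder_taylor_end f' f'' f'''); [lra| | |]; intros s Hs;
        [apply H2 | apply H3 | apply HK]; lra. }
    rewrite RtoC_minus in T.
    assert ((t - a) ^ 2 <= 1)%R by nra. nra.
Qed.

(** * Complex powers of a positive real and the exponential series *)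

Lemma Rcpower_plus (x : R) (s t : C) : Rcpower x (s + t) = Rcpower x s * Rcpower x t.
Proof.
  unfold Rcpower. simpl. rewrite !Rmult_plus_distr_r, exp_plus, cos_plus, sin_plus.
  apply injective_projections; simpl; unfold Re, Im; ring.
Qed.

Lemma Rcpower_0 (x : R) : Rcpower x 0 = 1.
Proof.
  unfold Rcpower; simpl. rewrite !Rmult_0_l, exp_0, cos_0, sin_0.
  apply injective_projections; simpl; ring.
Qed.

Lemma Rcpower_1_l (s : C) : Rcpower 1 s = 1.
Proof.
  unfold Rcpower; simpl. rewrite ln_1, !Rmult_0_r, exp_0, cos_0, sin_0.
  apply injective_projections; simpl; ring.
Qed.

Lemma Rcpower_1_r (x : R) : (0 < x)%R -> Rcpower x 1 = RtoC x.
Proof.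
  intros Hx. unfold Rcpower; simpl. rewrite Rmult_0_l, Rmult_1_l, exp_ln, cos_0, sin_0 by auto.
  apply injective_projections; simpl; ring.
Qed.

Lemma Rcpower_opp_nat (x : R) (n : nat) :
  (0 < x)%R -> Rcpower x (- RtoC (INR n)) = / RtoC x ^ n.
Proof.
  intros Hx. assert (Zx : RtoC x <> 0) by (apply RtoC_neq_0; lra).
  induction n.
  - simpl INR. replace (- 0) with (RtoC 0) by ring. rewrite Rcpower_0. simpl. field.
  - assert (E : Rcpower x (- RtoC (INR (S n))) * Rcpower x 1 = Rcpower x (- RtoC (INR n))).
    { rewrite <- Rcpower_plus. f_equal. rewrite S_INR, RtoC_plus. ring. }
    rewrite Rcpower_1_r, IHn in E by auto.
    replace (Rcpower x (- RtoC (INR (S n))))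
      with (Rcpower x (- RtoC (INR (S n))) * RtoC x * / RtoC x) by (field; auto).
    rewrite E. rewrite Cpow_S. field. split; auto. now apply Cpow_nz.
Qed.

Lemma Cmod_Rcpower (x : R) (s : C) : Cmod (Rcpower x s) = Rpower x (Re s).
Proof.
  unfold Rcpower. rewrite Cmod_mult, Cmod_R, Rabs_pos_eq by (left; apply exp_pos).
  unfold Rpower. replace (Cmod (_, _)) with 1%R; [ring|].
  transitivity (sqrt 1); [symmetry; apply sqrt_1|].
  unfold Cmod; f_equal; simpl.
  pose proof (sin2_cos2 (Im s * ln x)) as H. unfold Rsqr in H. lra.
Qed.

Lemma Cder_Rcpower (s : C) (x : R) :
  (0 < x)%R -> Cder (fun t => Rcpower t s) x (s * Rcpower x (s - 1)).
Proof.
  intros Hx. assert (Zx : RtoC x <> 0) by (apply RtoC_neq_0; lra).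
  apply Cder_eq with (s * (/ RtoC x * Rcpower x s)).
  - unfold Rcpower. rewrite <- RtoC_inv by lra. split; simpl; auto_derive; auto; unfold Re, Im; field; lra.
  - assert (E : Rcpower x (s - 1) * Rcpower x 1 = Rcpower x s)
      by (rewrite <- Rcpower_plus; f_equal; ring).
    rewrite Rcpower_1_r in E by auto. rewrite <- E. field; auto.
Qed.

Lemma exp_le_compat (x y : R) : (x <= y)%R -> (exp x <= exp y)%R.
Proof. intros [H|H]; [left; now apply exp_increasing | rewrite H; lra]. Qed.

Lemma ln_le_compat (x y : R) : (0 < x)%R -> (x <= y)%R -> (ln x <= ln y)%R.
Proof. intros Hx [H|H]; [left; now apply ln_increasing | rewrite H; lra]. Qed.

(** Comparison with the antiderivative -x^(1-p)/(p-1) of x^-p: its increment over [i+1, i+2] is at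
    least (i+2)^-p. The first term of the series is dropped to fit this comparison. *)
Lemma ex_series_Rpower (p : R) :
  (1 < p)%R -> ex_series (fun n => Rpower (INR (S n)) (- p)).
Proof.
  intros Hp.
  apply (ex_series_incr_1 (fun n => Rpower (INR (S n)) (- p))).
  apply rsum_bounded_ex_series with (/ (p - 1))%R.
  - intros n; left; apply exp_pos.
  - intros n.
    set (g := fun n : nat => (- / (p - 1) * Rpower (INR (S n)) (1 - p))%R).
    apply Rle_trans with (rsum (fun i => g (S i) - g i)%R n).
    + apply rsum_le. intros i _.
      assert (Hi : (0 < INR (S i))%R) by (apply lt_0_INR; lia).
      destruct (MVT_gen (fun t => - / (p - 1) * Rpower t (1 - p))%R (INR (S i)) (INR (S (S i)))
                  (fun t => Rpower t (- p))) as [c [Hc E]];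
        rewrite ?(S_INR (S i)) in *; rewrite Rmin_left, Rmax_right in * by lra.
      * intros x Hx. unfold Rpower. auto_derive. lra.
        replace ((1 - p) * ln x)%R with (- p * ln x + ln x)%R by ring.
        rewrite exp_plus, exp_ln by lra. field. lra.
      * intros x Hx. apply continuity_pt_filterlim.
        apply (ex_derive_continuous (fun t => - / (p - 1) * Rpower t (1 - p))%R).
        unfold Rpower; auto_derive. lra.
      * unfold g. rewrite (S_INR (S i)). rewrite E.
        replace (Rpower c (- p) * _)%R with (Rpower c (- p)) by ring.
        unfold Rpower. apply exp_le_compat.
        assert (ln c <= ln (INR (S i) + 1))%R by (apply ln_le_compat; lra).
        nra.
    + rewrite rsum_telescope. unfold g. simpl (INR 1).
      assert (0 < / (p - 1))%R by (apply Rinv_0_lt_compat; lra).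
      assert (0 < Rpower (INR (S n)) (1 - p))%R by apply exp_pos.
      assert (Rpower 1 (1 - p) = 1)%R by (unfold Rpower; rewrite ln_1, Rmult_0_r; apply exp_0).
      rewrite H1. nra.
Qed.

Definition cexp (z : C) : C := RtoC (exp (Re z)) * (cos (Im z), sin (Im z)).

Lemma Rcpower_cexp (x : R) (s : C) : Rcpower x s = cexp (RtoC (ln x) * s).
Proof.
  unfold Rcpower, cexp. simpl. unfold Re, Im.
  replace (ln x * fst s - 0 * snd s)%R with (fst s * ln x)%R by ring.
  replace (ln x * snd s + 0 * fst s)%R with (snd s * ln x)%R by ring. reflexivity.
Qed.

Lemma Cmod_cexp (z : C) : Cmod (cexp z) = exp (Re z).
Proof.
  pose proof (Rcpower_cexp (exp 1) z) as H. rewrite ln_exp in H.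
  replace (1 * z) with z in H by ring. rewrite <- H, Cmod_Rcpower.
  unfold Rpower. rewrite ln_exp. f_equal; ring.
Qed.

Lemma cexp_plus (z w : C) : cexp (z + w) = cexp z * cexp w.
Proof.
  unfold cexp; simpl. rewrite exp_plus, cos_plus, sin_plus.
  apply injective_projections; simpl; unfold Re, Im; ring.
Qed.

Lemma cexp_0 : cexp 0 = 1.
Proof.
  unfold cexp; simpl. rewrite exp_0, cos_0, sin_0.
  apply injective_projections; simpl; ring.
Qed.

Lemma cexp_pow (z : C) (n : nat) : cexp z ^ n = cexp (RtoC (INR n) * z).
Proof.
  induction n.
  - simpl. replace (0 * z) with (RtoC 0) by ring. now rewrite cexp_0.
  - rewrite Cpow_S, IHn, <- cexp_plus, S_INR, RtoC_plus. f_equal. ring.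
Qed.

Definition exp_term (z : C) (j : nat) : C := / RtoC (INR (fact j)) * z ^ j.

Lemma INR_fact_C (j : nat) : RtoC (INR (fact j)) <> 0.
Proof. apply RtoC_neq_0, INR_fact_neq_0. Qed.

Lemma Cder_cexp (z : C) (t : R) :
  Cder (fun t => cexp (RtoC t * z)) t (z * cexp (RtoC t * z)).
Proof.
  unfold cexp; split; simpl; auto_derive; auto; unfold Re, Im, Rminus; ring.
Qed.

Lemma Cder_exp_sum (z : C) (n : nat) (t : R) :
  Cder (fun t => csum (exp_term (RtoC t * z)) (S n)) t (z * csum (exp_term (RtoC t * z)) n).
Proof.
  induction n.
  - simpl. apply (Cder_eq _ _ (RtoC 0)); [|ring].
    unfold exp_term; simpl. apply Cder_const.
  - apply Cder_eq with (z * csum (exp_term (RtoC t * z)) n + z * exp_term (RtoC t * z) n);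
      [|simpl; ring].
    apply (Cder_plus (fun t => csum (exp_term (RtoC t * z)) (S n))
             (fun t => exp_term (RtoC t * z) (S n))); auto.
    apply Cder_eq with (/ RtoC (INR (fact (S n))) *
              (RtoC (INR (S n)) * (1 * z + RtoC t * 0) * (RtoC t * z) ^ n)).
    + apply Cder_scal. apply (Cder_pow (fun t => RtoC t * z)).
      apply Cder_mult. apply Cder_id. apply Cder_const.
    + unfold exp_term. rewrite fact_simpl, mult_INR, RtoC_mult. field. split.
      apply INR_fact_C. apply RtoC_neq_0, not_0_INR; lia.
Qed.

(** Induction on n: along the ray t z, the remainder of order n + 1 vanishes at t = 0 and its
    derivative is z times the remainder of order n. The factor [exp (Cmod z)] stems from n = 0. *)
Lemma exp_remainder (z : C) (n : nat) (t : R) :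
  (0 <= t <= 1)%R ->
  (Cmod (cexp (RtoC t * z) - csum (exp_term (RtoC t * z)) n)
   <= exp (Cmod z) * (Cmod z ^ n * t ^ n / INR (fact n)))%R.
Proof.
  revert t; induction n; intros t Ht.
  - simpl. replace (cexp (t * z) - 0) with (cexp (t * z)) by ring. rewrite Cmod_cexp.
    rewrite Rmult_1_r, Rdiv_1_r, Rmult_1_r. apply exp_le_compat. simpl.
    pose proof (re_le_Cmod z). pose proof (Rle_abs (Re z)). unfold Re in *.
    pose proof (Cmod_ge_0 z). nra.
  - set (f := fun t => cexp (RtoC t * z) - csum (exp_term (RtoC t * z)) (S n)).
    set (h := fun t => (exp (Cmod z) * (Cmod z ^ S n * t ^ S n / INR (fact (S n))))%R).
    assert (F0 : f 0%R = 0).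
    { unfold f. rewrite csum_shift. replace (RtoC 0 * z) with (RtoC 0) by ring.
      rewrite cexp_0, (csum_ext _ (fun _ => 0)), csum_zero.
      - unfold exp_term; simpl. field.
      - intros i _. unfold exp_term. rewrite Cpow_S. ring. }
    assert (H0 : h 0%R = 0%R) by (unfold h; simpl; unfold Rdiv; ring).
    change (Cmod (f t) <= h t)%R.
    replace (f t) with (f t - f 0%R) by (rewrite F0; ring).
    replace (h t) with (h t - h 0)%R by (rewrite H0; ring).
    apply (Cder_mean_value f (fun t => z * (cexp (RtoC t * z) - csum (exp_term (RtoC t * z)) n))
             h (fun t => exp (Cmod z) * (Cmod z ^ S n * t ^ n / INR (fact n)))%R); [lra| | |].
    + intros s _. apply Cder_eq with (z * cexp (RtoC s * z) - z * csum (exp_term (RtoC s * z)) n);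
        [|ring].
      apply Cder_minus. apply Cder_cexp. apply Cder_exp_sum.
    + intros s _. unfold h. rewrite fact_simpl, mult_INR. auto_derive; auto.
      simpl pred. change (match n with 0%nat => 1%R | S _ => (INR n + 1)%R end) with (INR (S n)). simpl (_ ^ S n)%R. field. split. apply INR_fact_neq_0.
      apply not_0_INR; lia.
    + intros s Hs. rewrite Cmod_mult. specialize (IHn s ltac:(lra)).
      replace (exp (Cmod z) * (Cmod z ^ S n * s ^ n / INR (fact n)))%R
        with (Cmod z * (exp (Cmod z) * (Cmod z ^ n * s ^ n / INR (fact n))))%R
        by (simpl; unfold Rdiv; ring).
      apply Rmult_le_compat_l; auto. apply Cmod_ge_0.
Qed.

Lemma Csum_exp (z : C) : Csum (exp_term z) (cexp z).
Proof.
  apply Clim_bound with (fun n => exp (Cmod z) * (Cmod z ^ n / INR (fact n)))%R.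
  - intros n. pose proof (exp_remainder z n 1 ltac:(lra)) as H.
    replace (RtoC 1 * z) with z in H by ring. rewrite pow1, Rmult_1_r in H.
    replace (csum (exp_term z) n - cexp z) with (- (cexp z - csum (exp_term z) n)) by ring.
    now rewrite Cmod_opp.
  - replace (Finite 0) with (Rbar_mult (exp (Cmod z)) 0%R) by (simpl; f_equal; ring).
    apply is_lim_seq_scal_l. apply is_lim_seq_Reals. apply cv_speed_pow_fact.
Qed.

(** * Power series and the Weierstrass theorem *)

(** In contrast to [analytic_at] the radius is a parameter, because the Weierstrass theorem needs
    one disc for all terms. *)
Definition power_series_on (f : C -> C) (s0 : C) (R : R) : Prop :=
  exists b, forall w, (Cmod w < R)%R -> Csum (fun j => b j * w ^ j) (f (s0 + w)).

Lemma pow_n_Cpow (z : C) (n : nat) : pow_n (K := C_Ring) z n = z ^ n.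
Proof. induction n; simpl; [|rewrite IHn]; reflexivity. Qed.

Lemma analytic_at_power_series (f : C -> C) (z0 : C) :
  analytic_at f z0 <-> exists r, (0 < r)%R /\ power_series_on f z0 r.
Proof.
  assert (E : forall (a : nat -> C) x l,
     is_pseries (K := C_AbsRing) (V := C_NormedModule) a x l <-> Csum (fun j => a j * x ^ j) l).
  { intros a x l.
    assert (S : forall n, scal (pow_n (K := C_Ring) x n) (a n) = a n * x ^ n).
    { intros n. rewrite pow_n_Cpow. change (x ^ n * a n = a n * x ^ n). ring. }
    unfold is_pseries. split; intros H.
    - apply Csum_is_series in H. apply Csum_ext with (2 := H). exact S.
    - apply Csum_is_series. apply Csum_ext with (2 := H). intros n; symmetry; apply S. }
  split.
  - intros [a [r [Hr H]]]. exists r; split; auto. exists a. intros w Hw.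
    apply E. replace w with (z0 + w - z0) at 1 by ring. apply H.
    replace (z0 + w - z0) with w by ring. exact Hw.
  - intros [r [Hr [a H]]]. exists a, r. split; auto. intros z Hz. apply E.
    replace (f z) with (f (z0 + (z - z0))) by (f_equal; ring). apply H, Hz.
Qed.

Lemma power_series_on_le (f : C -> C) (s0 : C) (r r' : R) :
  (r' <= r)%R -> power_series_on f s0 r -> power_series_on f s0 r'.
Proof. intros H [b Hb]. exists b. intros w Hw. apply Hb. lra. Qed.

Lemma power_series_on_ext (f g : C -> C) (s0 : C) (r : R) :
  (forall w, (Cmod w < r)%R -> f (s0 + w) = g (s0 + w)) ->
  power_series_on f s0 r -> power_series_on g s0 r.
Proof. intros H [b Hb]. exists b. intros w Hw. rewrite <- H; auto. Qed.

Lemma power_series_on_plus (f g : C -> C) (s0 : C) (r : R) :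
  power_series_on f s0 r -> power_series_on g s0 r ->
  power_series_on (fun s => f s + g s) s0 r.
Proof.
  intros [b Hb] [c Hc]. exists (fun j => b j + c j). intros w Hw.
  apply Csum_ext with (fun j => b j * w ^ j + c j * w ^ j); [intros; ring|].
  apply Csum_plus; auto.
Qed.

Lemma power_series_on_scal (c : C) (f : C -> C) (s0 : C) (r : R) :
  power_series_on f s0 r -> power_series_on (fun s => c * f s) s0 r.
Proof.
  intros [b Hb]. exists (fun j => c * b j). intros w Hw.
  apply Csum_ext with (fun j => c * (b j * w ^ j)); [intros; ring|].
  apply Csum_scal; auto.
Qed.

Lemma power_series_on_minus (f g : C -> C) (s0 : C) (r : R) :
  power_series_on f s0 r -> power_series_on g s0 r ->
  power_series_on (fun s => f s - g s) s0 r.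
Proof.
  intros Hf Hg. apply power_series_on_ext with (fun s => f s + - (1) * g s);
    [intros; ring|].
  apply power_series_on_plus; auto. now apply power_series_on_scal.
Qed.

(** With s = s0 + w the factor w shifts the coefficients by one, so the new j-th coefficient is s0
    b_j + b_(j-1). *)
Lemma power_series_on_mult_id (f : C -> C) (s0 : C) (r : R) :
  power_series_on f s0 r -> power_series_on (fun s => s * f s) s0 r.
Proof.
  intros [b Hb]. exists (fun j => s0 * b j + match j with O => RtoC 0 | S i => b i end).
  intros w Hw.
  apply Csum_ext with (fun j => s0 * (b j * w ^ j)
                        + match j with O => RtoC 0 | S i => w * (b i * w ^ i) end).
  { intros [|j]; simpl; ring. }
  replace ((s0 + w) * f (s0 + w)) with (s0 * f (s0 + w) + (0 + w * f (s0 + w))) by ring.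
  apply Csum_plus.
  - apply Csum_scal; auto.
  - apply Csum_shift with (a := fun j => match j with O => RtoC 0 | S i => w * (b i * w ^ i) end).
    apply Csum_scal; auto.
Qed.

Lemma power_series_on_const (c s0 : C) (r : R) : power_series_on (fun _ => c) s0 r.
Proof.
  exists (fun j => match j with O => c | S _ => 0 end). intros w Hw.
  cut (Csum (fun j => match j with O => c | S _ => RtoC 0 end * w ^ j) (c * w ^ 0 + 0)).
  { intros H. replace (c * w ^ 0 + 0) with c in H by (simpl; ring). exact H. }
  apply (Csum_shift (fun j => match j with O => c | S _ => 0 end * w ^ j)).
  apply Csum_ext with (fun _ => 0); [intros; ring|]. apply Csum_zero.
Qed.

Lemma power_series_on_Rcpower (x : R) (c s0 : C) (r : R) :
  power_series_on (fun s => Rcpower x (c - s)) s0 r.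
Proof.
  exists (fun j => Rcpower x (c - s0) * (/ RtoC (INR (fact j)) * (- RtoC (ln x)) ^ j)).
  intros w _.
  apply Csum_ext with (fun j => Rcpower x (c - s0) * exp_term (- RtoC (ln x) * w) j).
  { intros j. unfold exp_term. rewrite Cpow_mult_l. ring. }
  replace (c - (s0 + w)) with (c - s0 + - w) by ring. rewrite Rcpower_plus.
  apply Csum_scal. rewrite (Rcpower_cexp x (- w)).
  replace (ln x * - w) with (- ln x * w) by ring. apply Csum_exp.
Qed.

(** Abel's lemma: a bound B on the partial sums at radius R bounds each term by 2 B, and passing to
    radius r inserts the geometric factor (r/R)^j. *)
Lemma power_series_abs (b : nat -> C) (R r : R) :
  (0 <= r < R)%R -> (exists l, Csum (fun j => b j * RtoC R ^ j) l) ->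
  ex_series (fun j => Cmod (b j) * r ^ j)%R.
Proof.
  intros Hr [l Hl].
  destruct (filterlim_bounded (K := C_AbsRing) (V := C_NormedModule)
              (csum (fun j => b j * RtoC R ^ j))) as [B HB'].
  { exists l. now apply Clim_filterlim. }
  assert (HB : forall j, (Cmod (b j * RtoC R ^ j) <= 2 * B)%R).
  { intros j. assert (H : forall n, (Cmod (csum (fun j => b j * RtoC R ^ j)%C n) <= B)%R)
      by exact HB'.
    pose proof (H j) as H1. pose proof (H (S j)) as H2. simpl in H2.
    set (p := csum (fun j => b j * RtoC R ^ j) j) in *.
    replace (b j * RtoC R ^ j) with (p + b j * RtoC R ^ j + - p) by ring.
    pose proof (Cmod_triangle (p + b j * RtoC R ^ j) (- p)) as H3.
    rewrite Cmod_opp in H3. lra. }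
  apply (ex_series_le (V := R_CompleteNormedModule) _ (fun j => 2 * B * (r / R) ^ j)%R).
  - intros j. specialize (HB j).
    rewrite Cmod_mult, Cmod_pow, Cmod_R, Rabs_pos_eq in HB by lra.
    change (norm (Cmod (b j) * r ^ j)%R) with (Rabs (Cmod (b j) * r ^ j)).
    assert (0 <= r ^ j)%R by (apply pow_le; lra).
    pose proof (Cmod_ge_0 (b j)).
    rewrite Rabs_pos_eq by nra.
    replace (Cmod (b j) * r ^ j)%R with (Cmod (b j) * R ^ j * (r / R) ^ j)%R.
    + apply Rmult_le_compat_r; auto. apply pow_le. apply Rmult_le_pos. lra.
      left; apply Rinv_0_lt_compat; lra.
    + rewrite Rmult_assoc, <- Rpow_mult_distr. do 2 f_equal. field. lra.
  - apply ex_series_Rscal. apply ex_series_geom.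
    rewrite Rabs_pos_eq.
    + apply Rmult_lt_reg_r with R; [lra|]. replace (r / R * R)%R with r by (field; lra). lra.
    + apply Rmult_le_pos. lra. left; apply Rinv_0_lt_compat; lra.
Qed.

Lemma geometric_csum (q : C) (n : nat) : csum (fun l => q ^ l) n * (q - 1) = q ^ n - 1.
Proof.
  induction n; simpl. ring.
  replace ((csum (fun l => q ^ l) n + q ^ n) * (q - 1))
    with (csum (fun l => q ^ l) n * (q - 1) + q ^ n * (q - 1)) by ring.
  rewrite IHn. ring.
Qed.

Lemma csum_single (f : nat -> C) (j n : nat) :
  (j < n)%nat -> (forall i, (i < n)%nat -> i <> j -> f i = 0) -> csum f n = f j.
Proof.
  induction n; intros Hj H. lia. simpl. destruct (Nat.eq_dec j n) as [->|Hn].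
  - rewrite (csum_ext f (fun _ => 0)), csum_zero. ring.
    intros i Hi; apply H; lia.
  - rewrite IHn, (H n); try lia. ring. intros i Hi Hij; apply H; lia.
Qed.

Definition root_of_unity (n : nat) : C := cexp (Ci * RtoC (2 * PI / INR n)).

Lemma Cmod_root_of_unity (n l : nat) : Cmod (root_of_unity n ^ l) = 1%R.
Proof.
  rewrite Cmod_pow. unfold root_of_unity. rewrite Cmod_cexp. simpl.
  replace (_ - _)%R with 0%R by ring. rewrite exp_0. apply pow1.
Qed.

Lemma root_of_unity_pow_n (n : nat) : (0 < n)%nat -> root_of_unity n ^ n = 1.
Proof.
  intros Hn. unfold root_of_unity. rewrite cexp_pow. unfold cexp. simpl.
  assert (INR n <> 0)%R by (apply not_0_INR; lia).
  match goal with |- context [exp ?e] => replace e with 0%R by ring end.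
  match goal with |- context [cos ?e] => replace e with (2 * PI)%R by (field; auto) end.
  rewrite exp_0, cos_2PI, sin_2PI. apply injective_projections; simpl; ring.
Qed.

Lemma root_of_unity_sum (n p : nat) :
  (0 < p < n)%nat -> csum (fun l => (root_of_unity n ^ p) ^ l) n = 0.
Proof.
  intros Hp. set (q := root_of_unity n ^ p).
  assert (Hq : q <> 1).
  { unfold q, root_of_unity. rewrite cexp_pow. unfold cexp. simpl. intros E.
    (* Half the argument of q. If q were 1, then cos (2 th) = 1 - 2 sin^2 th would be 1, although 0
       < th < PI. *)
    set (th := (PI * (INR p / INR n))%R).
    assert (Hn : (0 < INR n)%R) by (apply lt_0_INR; lia).
    assert (Hth : (0 < th < PI)%R).
    { unfold th. assert (0 < INR p / INR n < 1)%R.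
      { split. apply Rdiv_lt_0_compat; auto; apply lt_0_INR; lia.
        apply Rmult_lt_reg_r with (INR n); auto.
        replace (INR p / INR n * INR n)%R with (INR p) by (field; lra).
        rewrite Rmult_1_l. apply lt_INR; lia. }
      pose proof PI_RGT_0. nra. }
    pose proof (f_equal fst E) as E1. simpl in E1.
    match type of E1 with context [exp ?e] => replace e with 0%R in E1 by ring end.
    match type of E1 with context [cos ?e] =>
      replace e with (2 * th)%R in E1 by (unfold th; field; lra) end.
    rewrite exp_0, cos_2a_sin in E1.
    pose proof (sin_gt_0 th (proj1 Hth) (proj2 Hth)). nra. }
  assert (H : csum (fun l => q ^ l) n * (q - 1) = 0).
  { rewrite geometric_csum. unfold q. rewrite <- Cpow_mult_r, Nat.mul_comm, Cpow_mult_r.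
    rewrite root_of_unity_pow_n by lia. rewrite Cpow_1_l. ring. }
  assert (Hq1 : q - 1 <> 0).
  { intros E. apply Hq. replace q with (q - 1 + 1) by ring. rewrite E. ring. }
  replace (csum (fun l => q ^ l) n) with (csum (fun l => q ^ l) n * (q - 1) * / (q - 1))
    by (field; auto).
  rewrite H; ring.
Qed.

(* The average of [z^(-j) f(z)] over the n-th roots of unity on the circle of
   radius r is [a_j r^j] up to the tail of the series from index n on. *)
Lemma cauchy_inequality (a : nat -> C) (f : C -> C) (r M : R) (j : nat) :
  (0 <= r)%R -> ex_series (fun i => Cmod (a i) * r ^ i)%R ->
  (forall z, Cmod z = r -> Csum (fun i => a i * z ^ i) (f z)) ->
  (forall z, Cmod z = r -> (Cmod (f z) <= M)%R) ->
  (Cmod (a j) * r ^ j <= M)%R.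
Proof.
  intros Hr Ea Hf HM.
  set (u := fun i => (Cmod (a i) * r ^ i)%R) in *.
  assert (K : forall n, (j < n)%nat -> (u j <= M + (Series u - rsum u n))%R).
  { intros n Hn.
    set (om := root_of_unity n). set (z := fun l => RtoC r * om ^ l).
    assert (Hz : forall l, Cmod (z l) = r).
    { intros l. unfold z. rewrite Cmod_mult, Cmod_R, Rabs_pos_eq by auto.
      unfold om. rewrite Cmod_root_of_unity. ring. }
    (* As om^n = 1, the power om^(n-j) plays the part of om^(-j) with a natural exponent. *)
    set (W := csum (fun l => (om ^ (n - j)) ^ l * csum (fun i => a i * z l ^ i) n) n).
    assert (EW : W = RtoC (INR n) * (a j * RtoC r ^ j)).
    { unfold W.
      rewrite (csum_ext _ (fun l => csum (fun i => a i * RtoC r ^ i * (om ^ (n - j + i)) ^ l) n)).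
      2:{ intros l _. rewrite <- csum_scal. apply csum_ext. intros i _. unfold z.
          rewrite Cpow_mult_l, <- !Cpow_mult_r, Nat.mul_add_distr_r, Cpow_add_r.
          rewrite (Nat.mul_comm l i). ring. }
      rewrite csum_swap, (csum_single _ j n Hn).
      - rewrite csum_scal. replace (n - j + j)%nat with n by lia.
        unfold om. rewrite root_of_unity_pow_n by lia.
        rewrite (csum_ext _ (fun _ => 1)) by (intros; apply Cpow_1_l).
        rewrite csum_const. ring.
      - intros i Hi Hij. rewrite csum_scal.
        enough (E : csum (fun l => (om ^ (n - j + i)) ^ l) n = 0) by (transitivity (a i * RtoC r ^ i * 0); [f_equal; exact E | ring]).
        destruct (Nat.lt_ge_cases i j) as [L|L].
        + apply root_of_unity_sum. lia.
        + replace (n - j + i)%nat with (n + (i - j))%nat by lia.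
          rewrite Cpow_add_r. unfold om at 1. rewrite root_of_unity_pow_n by lia.
          replace (1 * om ^ (i - j)) with (om ^ (i - j)) by ring.
          apply root_of_unity_sum. lia. }
    assert (BW : (Cmod W <= INR n * (M + (Series u - rsum u n)))%R).
    { rewrite <- rsum_const. apply csum_norm_le. intros l _.
      rewrite Cmod_mult, <- Cpow_mult_r. unfold om at 1. rewrite Cmod_root_of_unity, Rmult_1_l.
      assert (T : (Cmod (f (z l) - csum (fun i => a i * z l ^ i)%C n) <= Series u - rsum u n)%R).
      { apply Csum_tail; auto. intros i. rewrite Cmod_mult, Cmod_pow, Hz. unfold u. lra. }
      pose proof (HM (z l) (Hz l)).
      replace (csum (fun i => a i * z l ^ i) n)
        with (f (z l) + - (f (z l) - csum (fun i => a i * z l ^ i) n)) by ring.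
      eapply Rle_trans; [apply Cmod_triangle|]. rewrite Cmod_opp. lra. }
    rewrite EW, !Cmod_mult, Cmod_pow, !Cmod_R, (Rabs_pos_eq r), (Rabs_pos_eq (INR n)) in BW
      by (auto using pos_INR).
    apply Rmult_le_reg_l with (INR n); auto. apply lt_0_INR; lia. }
  change (Rbar_le (u j) M).
  apply (is_lim_seq_le_loc (fun _ => u j) (fun n => M + (Series u - rsum u n))%R).
  - exists (S j). intros n Hn. apply K; lia.
  - apply is_lim_seq_const.
  - replace (Finite M) with (Finite (M + 0)) by (f_equal; ring).
    apply is_lim_seq_plus'. apply is_lim_seq_const. now apply rsum_tail.
Qed.

(** Cauchy's inequality on the circle of radius rho/2 bounds the j-th coefficient of [T n] by M n /
    (rho/2)^j. For Cmod w < rho/4 the double series of all Taylor terms is therefore dominated by M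
    n 2^-j, and exchanging the sums produces the coefficients of f. *)
Lemma weierstrass_analytic (T : nat -> C -> C) (f : C -> C) (s0 : C) (rho : R) (M : nat -> R) :
  (0 < rho)%R -> (forall n, power_series_on (T n) s0 rho) ->
  (forall n w, (Cmod w < rho)%R -> (Cmod (T n (s0 + w)%C) <= M n)%R) -> ex_series M ->
  (forall w, (Cmod w < rho)%R -> Csum (fun n => T n (s0 + w)) (f (s0 + w))) ->
  exists r, (0 < r)%R /\ power_series_on f s0 r.
Proof.
  intros HR HT HM EM Hf.
  assert (M0 : forall n, (0 <= M n)%R).
  { intros n. apply Rle_trans with (2 := HM n 0 ltac:(rewrite Cmod_0; auto)). apply Cmod_ge_0. }
  set (b := fun n => proj1_sig (constructive_indefinite_description _ (HT n))).
  assert (Hb : forall n w, (Cmod w < rho)%R -> Csum (fun j => b n j * w ^ j) (T n (s0 + w))).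
  { intros n. unfold b. destruct (constructive_indefinite_description _ (HT n)); auto. }
  assert (Cb : forall n j, (Cmod (b n j) * (rho / 2) ^ j <= M n)%R).
  { intros n j. apply cauchy_inequality with (fun w => T n (s0 + w)); [lra| | |].
    - apply power_series_abs with (3 / 4 * rho)%R; [lra|].
      exists (T n (s0 + RtoC (3 / 4 * rho))). apply Hb.
      rewrite Cmod_R, Rabs_pos_eq; lra.
    - intros z Hz. apply Hb. lra.
    - intros z Hz. apply HM. lra. }
  set (A := fun j => epsilon (inhabits (RtoC 0)) (fun l => Csum (fun n => b n j) l)).
  assert (HA : forall j, Csum (fun n => b n j) (A j)).
  { intros j. unfold A. apply epsilon_spec.
    apply Csum_exists with (fun n => / (rho / 2) ^ j * M n)%R.
    - intros n. specialize (Cb n j). assert (0 < (rho / 2) ^ j)%R by (apply pow_lt; lra).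
      apply Rmult_le_reg_r with ((rho / 2) ^ j)%R; auto.
      replace (/ (rho / 2) ^ j * M n * (rho / 2) ^ j)%R with (M n) by (field; lra). auto.
    - now apply ex_series_Rscal. }
  exists (rho / 4)%R. split; [lra|]. exists A. intros w Hw.
  destruct (dominated_fubini (fun n j => b n j * w ^ j) M (fun j => (/ 2) ^ j)%R)
    as [rr [c [l [Hrr [Hc [Hl [Hl' _]]]]]]]; auto.
  - intros j; apply pow_le; lra.
  - intros n j. rewrite Cmod_mult, Cmod_pow. specialize (Cb n j).
    assert (Cmod w ^ j <= (rho / 2 * / 2) ^ j)%R.
    { apply pow_incr. split. apply Cmod_ge_0. lra. }
    rewrite Rpow_mult_distr in H.
    pose proof (Cmod_ge_0 (b n j)).
    assert (0 < (/ 2) ^ j)%R by (apply pow_lt; lra).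
    nra.
  - apply ex_series_geom. rewrite Rabs_pos_eq; lra.
  - apply Csum_ext with c.
    + intros j. apply Csum_unique with (1 := Hc j).
      apply Csum_ext with (fun n => w ^ j * b n j); [intros; ring|].
      replace (A j * w ^ j) with (w ^ j * A j) by ring. apply Csum_scal, HA.
    + replace (f (s0 + w)) with l; auto.
      apply Csum_unique with (1 := Hl). apply Csum_ext with (fun n => T n (s0 + w)).
      * intros n. apply Csum_unique with (2 := Hrr n). apply Hb. lra.
      * apply Hf. lra.
Qed.

(** * Continuation of Dirichlet series to the half-plane Re s > -1 *)

Lemma abel_summation (x g : nat -> C) (n : nat) :
  csum (fun i => (x (S i) - x i) * g i) n
  = x n * g n - x O * g O - csum (fun i => x (S i) * (g (S i) - g i)) n.
Proof. induction n; simpl; [|rewrite IHn]; ring. Qed.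

Lemma Rpower_le_exponent (x p q : R) :
  (1 <= x)%R -> (p <= q)%R -> (Rpower x p <= Rpower x q)%R.
Proof.
  intros Hx Hp. unfold Rpower. apply exp_le_compat. apply Rmult_le_compat_r; auto.
  rewrite <- ln_1. apply ln_le_compat; lra.
Qed.

Lemma Rpower_le_base (x y p : R) :
  (0 < x <= y)%R -> (p <= 0)%R -> (Rpower y p <= Rpower x p)%R.
Proof.
  intros Hx Hp. unfold Rpower. apply exp_le_compat.
  pose proof (ln_le_compat x y (proj1 Hx) (proj2 Hx)). nra.
Qed.

Lemma Rpower_lim_0 (p : R) :
  (p < 0)%R -> is_lim_seq (fun n => Rpower (INR (S n)) p) 0%R.
Proof.
  intros Hp. apply is_lim_seq_spec. intros [e He]. simpl.
  set (t := exp (ln e / p)%R).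
  assert (E : Rpower t p = e).
  { unfold Rpower, t. rewrite ln_exp. replace (p * (ln e / p))%R with (ln e) by (field; lra).
    now apply exp_ln. }
  destruct (archimed t) as [Ht _].
  exists (Z.to_nat (up t)). intros n Hn. rewrite Rminus_0_r.
  rewrite Rabs_pos_eq by (left; apply exp_pos). rewrite <- E.
  unfold Rpower at 2. unfold Rpower. apply exp_increasing.
  assert (0 < t)%R by apply exp_pos.
  assert (t < INR (S n))%R.
  { apply Rlt_le_trans with (1 := Ht). rewrite <- (Z2Nat.id (up t)).
    - rewrite <- INR_IZR_INZ. apply le_INR; lia.
    - apply le_IZR. lra. }
  assert (ln t < ln (INR (S n)))%R by now apply ln_increasing.
  now apply Rmult_lt_gt_compat_neg_l.
Qed.

Lemma Cmod_Rcpower_le (x : R) (s : C) (p : R) :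
  (1 <= x)%R -> (Re s <= p)%R -> (Cmod (Rcpower x s) <= Rpower x p)%R.
Proof. intros Hx Hp. rewrite Cmod_Rcpower. now apply Rpower_le_exponent. Qed.

(** The second derivative of x^-s is s (s+1) x^(-s-2), whence A (A+1). The condition -2 <= sigma
    makes the exponent -(sigma+2) nonpositive, so that the bound on [x, x+2] is attained at the left
    end. *)
Lemma Rcpower_second_difference (x : R) (s : C) (sigma A : R) :
  (1 <= x)%R -> (-2 <= sigma <= Re s)%R -> (Cmod s <= A)%R ->
  (Cmod (Rcpower (x + 2) (- s) - Rcpower (x + 1) (- s)
         - (Rcpower (x + 1) (- s) - Rcpower x (- s)))
   <= A * (A + 1) * Rpower x (- (sigma + 2)))%R.
Proof.
  intros Hx Hs HA.
  replace (x + 2)%R with (1 + (x + 1))%R by ring.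
  replace (Rcpower (x + 1) (- s) - Rcpower x (- s))
    with (Rcpower (1 + x) (- s) - Rcpower x (- s)) by (rewrite (Rplus_comm x 1); reflexivity).
  apply (Cder_second_difference (fun t => Rcpower t (- s))
           (fun t => - s * Rcpower t (- s - 1))
           (fun t => - s * ((- s - 1) * Rcpower t (- s - 1 - 1)))).
  - intros t Ht. apply Cder_Rcpower; lra.
  - intros t Ht. apply Cder_scal. apply Cder_Rcpower; lra.
  - intros t Ht. rewrite !Cmod_mult, Cmod_opp, <- Rmult_assoc.
    assert (H1 : (Cmod (- s - 1) <= A + 1)%R).
    { replace (- s - 1) with (- (s + 1)) by ring. rewrite Cmod_opp.
      pose proof (Cmod_triangle s 1). rewrite Cmod_1 in H. lra. }
    assert (H2 : (Cmod (Rcpower t (- s - 1 - 1)) <= Rpower x (- (sigma + 2)))%R).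
    { apply Rle_trans with (Rpower t (- (sigma + 2))).
      - apply Cmod_Rcpower_le. lra. simpl. unfold Re in Hs. lra.
      - apply Rpower_le_base; lra. }
    pose proof (Cmod_ge_0 s). pose proof (Cmod_ge_0 (- s - 1)).
    apply Rmult_le_compat; auto.
    + apply Rmult_le_pos; auto.
    + apply Cmod_ge_0.
    + apply Rmult_le_compat; auto.
Qed.

(** The third derivative of x^(1-s) is (1-s) s (s+1) x^(-s-2). Working with x^(1-s) instead of its
    quotient by 1 - s keeps s = 1 regular. *)
Lemma Rcpower_trapezoid (x : R) (s : C) (sigma A : R) :
  (1 <= x)%R -> (-2 <= sigma <= Re s)%R -> (Cmod s <= A)%R ->
  (Cmod (Rcpower (x + 1) (1 - s) - Rcpower x (1 - s)
         - / 2 * ((1 - s) * Rcpower x (- s) + (1 - s) * Rcpower (x + 1) (- s)))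
   <= (A + 1) * (A * (A + 1)) * Rpower x (- (sigma + 2)))%R.
Proof.
  intros Hx Hs HA.
  apply (Cder_trapezoid (fun t => Rcpower t (1 - s))
           (fun t => (1 - s) * Rcpower t (- s))
           (fun t => (1 - s) * (- s * Rcpower t (- s - 1)))
           (fun t => (1 - s) * (- s * ((- s - 1) * Rcpower t (- s - 1 - 1))))).
  - intros t Ht. apply Cder_eq with ((1 - s) * Rcpower t (1 - s - 1)).
    apply Cder_Rcpower; lra. do 2 f_equal; ring.
  - intros t Ht. apply Cder_scal. apply Cder_Rcpower; lra.
  - intros t Ht. apply Cder_scal, Cder_scal. apply Cder_Rcpower; lra.
  - intros t Ht. rewrite !Cmod_mult, Cmod_opp.
    assert (H0 : (Cmod (1 - s) <= A + 1)%R).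
    { pose proof (Cmod_triangle 1 (- s)). rewrite Cmod_1, Cmod_opp in H.
      unfold Cminus. lra. }
    assert (H1 : (Cmod (- s - 1) <= A + 1)%R).
    { replace (- s - 1) with (- (s + 1)) by ring. rewrite Cmod_opp.
      pose proof (Cmod_triangle s 1). rewrite Cmod_1 in H. lra. }
    assert (H2 : (Cmod (Rcpower t (- s - 1 - 1)) <= Rpower x (- (sigma + 2)))%R).
    { apply Rle_trans with (Rpower t (- (sigma + 2))).
      - apply Cmod_Rcpower_le. lra. simpl. unfold Re in Hs. lra.
      - apply Rpower_le_base; lra. }
    pose proof (Cmod_ge_0 s). pose proof (Cmod_ge_0 (- s - 1)).
    pose proof (Cmod_ge_0 (1 - s)). pose proof (Cmod_ge_0 (Rcpower t (- s - 1 - 1))).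
    rewrite !Rmult_assoc. repeat apply Rmult_le_compat; auto;
      repeat apply Rmult_le_pos; auto.
Qed.

Lemma power_series_on_Rcpower_opp (x : R) (s0 : C) (r : R) :
  power_series_on (fun s => Rcpower x (- s)) s0 r.
Proof.
  apply power_series_on_ext with (fun s => Rcpower x (0 - s)).
  - intros w _. f_equal. ring.
  - apply power_series_on_Rcpower.
Qed.

(** The radius is half the distance from [s0] to the line Re s = -1. The real part on the disc stays
    above (Re s0 - 1)/2 > -1, so the exponent sigma + 2 of the majorants exceeds 1. *)
Lemma disc_bounds (s0 w : C) :
  (-1 < Re s0)%R -> (Cmod w < (Re s0 + 1) / 2)%R ->
  (-2 <= (Re s0 - 1) / 2 <= Re (s0 + w))%R /\ (Cmod (s0 + w) <= Cmod s0 + (Re s0 + 1) / 2)%R.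
Proof.
  intros H1 H2. pose proof (re_le_Cmod w). pose proof (Cmod_triangle s0 w).
  simpl. unfold Re in *. assert (Rabs (fst w) < (fst s0 + 1) / 2)%R by lra.
  apply Rabs_def2 in H3. lra.
Qed.

Lemma ex_series_disc (c sigma : R) :
  (-1 < sigma)%R -> ex_series (fun n => c * Rpower (INR (S n)) (- (sigma + 2)))%R.
Proof. intros H. apply ex_series_Rscal, ex_series_Rpower. lra. Qed.

Lemma INR_S_ge_1 (n : nat) : (1 <= INR (S n))%R.
Proof. rewrite S_INR. pose proof (pos_INR n). lra. Qed.

Definition Z_antiderivative (F f : Z -> C) : Prop := forall n, F (n + 1)%Z - F n = f n.

Definition Z_bounded (F : Z -> C) : Prop := exists B, forall n, (Cmod (F n) <= B)%R.

Section Nonprincipal.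

Variables (chi X Y : Z -> C).
Hypothesis HX : Z_antiderivative X chi.
Hypothesis HY : Z_antiderivative Y X.
Hypothesis bX : Z_bounded X.
Hypothesis bY : Z_bounded Y.

Let g (s : C) (n : nat) : C := Rcpower (INR (S n)) (- s).
Let d (s : C) (n : nat) : C := g s (S n) - g s n.
Let T (n : nat) (s : C) : C := Y (Z.of_nat n + 3)%Z * (d s (S n) - d s n).

(* Two summations by parts turn the Dirichlet series of [chi = Delta X = Delta^2 Y]
   into a series of second differences of [n^-s]. *)
Definition balanced_L (s : C) : C :=
  - X 1%Z + Y 2%Z * d s O + epsilon (inhabits (RtoC 0)) (fun l => Csum (fun n => T n s) l).

Lemma balanced_term_bound (B sigma A : R) (n : nat) (s : C) :
  (forall n, Cmod (Y n) <= B)%R -> (-2 <= sigma <= Re s)%R -> (Cmod s <= A)%R ->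
  (Cmod (T n s) <= B * (A * (A + 1)) * Rpower (INR (S n)) (- (sigma + 2)))%R.
Proof.
  intros HB Hs HA. unfold T. rewrite Cmod_mult, Rmult_assoc.
  apply Rmult_le_compat; auto using Cmod_ge_0.
  unfold d, g. pose proof (Rcpower_second_difference (INR (S n)) s sigma A
    (INR_S_ge_1 n) Hs HA) as H.
  replace (INR (S n) + 2)%R with (INR (S (S (S n)))) in H by (rewrite !S_INR; ring).
  replace (INR (S n) + 1)%R with (INR (S (S n))) in H by (rewrite !S_INR; ring).
  exact H.
Qed.

Lemma balanced_sum (s : C) :
  (-1 < Re s)%R ->
  Csum (fun n => T n s) (epsilon (inhabits (RtoC 0)) (fun l => Csum (fun n => T n s) l)).
Proof.
  intros Hs. apply epsilon_spec. destruct bY as [B HB].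
  apply Csum_exists with
    (fun n => B * (Cmod s * (Cmod s + 1)) * Rpower (INR (S n)) (- (Re s + 2)))%R.
  - intros n. apply balanced_term_bound; auto; lra.
  - apply ex_series_disc; auto.
Qed.

(** The boundary terms of the two summations by parts are bounded multiples of n^-s and of its first
    difference, and vanish in the limit as soon as Re s > 0. This range includes the value at s =
    1. *)
Lemma balanced_L_series (s : C) :
  (0 < Re s)%R ->
  Csum (fun n => chi (Z.of_nat (S n)) * Rcpower (INR (S n)) (- s)) (balanced_L s).
Proof.
  intros Hs.
  assert (E : forall n, csum (fun i => chi (Z.of_nat (S i)) * g s i) n
     = X (Z.of_nat n + 1)%Z * g s n - X 1%Z - Y (Z.of_nat n + 2)%Z * d s n
       + Y 2%Z * d s O + csum (fun i => T i s) n).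
  { intros n.
    rewrite (csum_ext _ (fun i => (X (Z.of_nat (S i) + 1)%Z - X (Z.of_nat i + 1)%Z) * g s i)).
    2:{ intros i _. rewrite <- (HX (Z.of_nat (S i))). do 3 f_equal. f_equal. lia. }
    rewrite (abel_summation (fun i => X (Z.of_nat i + 1)%Z)).
    rewrite (csum_ext (fun i => X (Z.of_nat (S i) + 1)%Z * _)
               (fun i => (Y (Z.of_nat (S i) + 2)%Z - Y (Z.of_nat i + 2)%Z) * d s i)).
    2:{ intros i _. rewrite <- (HY (Z.of_nat (S i) + 1)%Z). unfold d.
        replace (Z.of_nat (S i) + 1 + 1)%Z with (Z.of_nat (S i) + 2)%Z by lia.
        replace (Z.of_nat (S i) + 1)%Z with (Z.of_nat i + 2)%Z by lia. reflexivity. }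
    rewrite (abel_summation (fun i => Y (Z.of_nat i + 2)%Z)).
    rewrite (csum_ext (fun i => Y (Z.of_nat (S i) + 2)%Z * _) (fun i => T i s)).
    2:{ intros i _. unfold T. do 2 f_equal. lia. }
    assert (G : g s O = 1) by (unfold g; simpl INR; apply Rcpower_1_l).
    rewrite G. simpl (Z.of_nat 0). simpl (0 + 1)%Z. simpl (0 + 2)%Z. ring. }
  destruct bX as [B1 HB1]. destruct bY as [B2 HB2].
  assert (Lg : is_lim_seq (fun n => Cmod (g s n)) 0%R).
  { apply is_lim_seq_ext with (fun n => Rpower (INR (S n)) (- Re s)).
    - intros n. unfold g. rewrite Cmod_Rcpower. reflexivity.
    - apply Rpower_lim_0; lra. }
  assert (Lg' : is_lim_seq (fun n => Cmod (g s (S n))) 0%R)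
    by now apply (is_lim_seq_incr_1 (fun n => Cmod (g s n))).
  unfold Csum.
  apply Clim_close with (fun n => - X 1%Z + Y 2%Z * d s O + csum (fun i => T i s) n)
    (fun n => B1 * Cmod (g s n) + B2 * (Cmod (g s (S n)) + Cmod (g s n)))%R.
  - unfold balanced_L. apply Clim_plus. apply Clim_const. apply balanced_sum. lra.
  - intros n. pose proof (E n) as En. unfold g at 1 in En. rewrite En.
    match goal with |- (Cmod ?e <= _)%R => replace e with
      (X (Z.of_nat n + 1)%Z * g s n + - (Y (Z.of_nat n + 2)%Z * d s n)) by ring end.
    eapply Rle_trans; [apply Cmod_triangle|]. rewrite Cmod_opp, !Cmod_mult.
    apply Rplus_le_compat.
    + apply Rmult_le_compat_r; auto using Cmod_ge_0.
    + apply Rmult_le_compat; auto using Cmod_ge_0. unfold d, Cminus.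
      eapply Rle_trans; [apply Cmod_triangle|]. rewrite Cmod_opp. lra.
  - replace (Finite 0) with (Finite (B1 * 0 + B2 * (0 + 0))) by (f_equal; ring).
    apply is_lim_seq_plus'.
    + apply (is_lim_seq_scal_l _ B1 (Finite 0)). exact Lg.
    + apply (is_lim_seq_scal_l _ B2 (Finite (0 + 0))). now apply is_lim_seq_plus'.
Qed.

Lemma balanced_L_analytic (s0 : C) : (-1 < Re s0)%R -> analytic_at balanced_L s0.
Proof.
  intros Hs. apply analytic_at_power_series.
  set (S := fun s => epsilon (inhabits (RtoC 0)) (fun l => Csum (fun n => T n s) l)).
  destruct bY as [B HB].
  destruct (weierstrass_analytic T S s0 ((Re s0 + 1) / 2)
    (fun n => B * ((Cmod s0 + (Re s0 + 1) / 2) * (Cmod s0 + (Re s0 + 1) / 2 + 1))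
              * Rpower (INR (Datatypes.S n)) (- ((Re s0 - 1) / 2 + 2)))%R) as [r [Hr H]].
  - lra.
  - intros n. apply power_series_on_scal.
    repeat apply power_series_on_minus; apply power_series_on_Rcpower_opp.
  - intros n w Hw. destruct (disc_bounds s0 w Hs Hw).
    apply balanced_term_bound; auto.
  - apply ex_series_disc. lra.
  - intros w Hw. apply balanced_sum. destruct (disc_bounds s0 w Hs Hw). lra.
  - exists r. split; auto. apply power_series_on_plus; auto.
    apply power_series_on_plus. apply power_series_on_const.
    apply power_series_on_scal.
    apply power_series_on_minus; apply power_series_on_Rcpower_opp.
Qed.

(** At s = 0 the powers n^-s are constant, all their differences vanish, and one boundary term
    survives. *)
Lemma balanced_L_0 : balanced_L 0 = - X 1%Z.
Proof.
  assert (G : forall n, g 0 n = 1).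
  { intros n. unfold g. replace (- 0) with (RtoC 0) by ring. apply Rcpower_0. }
  assert (E : epsilon (inhabits (RtoC 0)) (fun l => Csum (fun n => T n 0) l) = 0).
  { apply Csum_unique with (fun n => T n 0).
    - apply balanced_sum. simpl. lra.
    - apply Csum_ext with (fun _ => 0). 2: apply Csum_zero.
      intros n. unfold T, d. rewrite !G. ring. }
  unfold balanced_L, d. rewrite E, !G. ring.
Qed.

End Nonprincipal.

(** * The zeta function *)

Lemma power_series_on_bounded (f : C -> C) (s0 : C) (r : R) :
  (0 < r)%R -> power_series_on f s0 r ->
  exists M, forall w, (Cmod w < r / 4)%R -> (Cmod (f (s0 + w)%C) <= M)%R.
Proof.
  intros Hr [b Hb].
  assert (E : ex_series (fun j => Cmod (b j) * (r / 4) ^ j)%R).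
  { apply power_series_abs with (r / 2)%R; [lra|]. exists (f (s0 + RtoC (r / 2))).
    apply Hb. rewrite Cmod_R, Rabs_pos_eq; lra. }
  exists (Series (fun j => Cmod (b j) * (r / 4) ^ j)%R). intros w Hw.
  apply Csum_norm_le with (fun j => b j * w ^ j); auto.
  - intros j. rewrite Cmod_mult, Cmod_pow. apply Rmult_le_compat_l. apply Cmod_ge_0.
    apply pow_incr. split. apply Cmod_ge_0. lra.
  - apply Hb. lra.
Qed.

Lemma Csum_geometric (q : C) : (Cmod q < 1)%R -> Csum (fun i => q ^ i) (/ (1 - q)).
Proof.
  intros Hq.
  assert (Z : 1 - q <> 0).
  { intros E. assert (E1 : q = 1) by (replace q with (1 - (1 - q)) by ring; rewrite E; ring).
    rewrite E1, Cmod_1 in Hq. lra. }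
  apply Clim_bound with (fun n => / Cmod (1 - q) * Cmod q ^ n)%R.
  - intros n. pose proof (geometric_csum q n) as H.
    replace (csum (fun i => q ^ i) n - / (1 - q))
      with (- (csum (fun i => q ^ i) n * (q - 1) + 1) * / (1 - q)) by (field; auto).
    rewrite H, Cmod_mult, Cmod_inv, Cmod_opp by auto.
    replace (q ^ n - 1 + 1) with (q ^ n) by ring. rewrite Cmod_pow. lra.
  - replace (Finite 0) with (Rbar_mult (/ Cmod (1 - q))%R 0%R) by (simpl; f_equal; ring).
    apply is_lim_seq_scal_l. apply is_lim_seq_geom. rewrite Rabs_pos_eq; auto.
    apply Cmod_ge_0.
Qed.

(** Around [s0] the factor 1/(s - p) is a geometric series in -w/c with c = s0 - p. For Cmod w <
    Cmod c / 2 its ratio is below 1/2, and the Weierstrass theorem applies to the products with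
    f. *)
Lemma power_series_on_div (f : C -> C) (s0 p : C) (r : R) :
  (0 < r)%R -> s0 <> p -> power_series_on f s0 r ->
  exists r', (0 < r')%R /\ power_series_on (fun s => f s / (s - p)) s0 r'.
Proof.
  intros Hr Hp Hf.
  set (c := s0 - p).
  assert (Hc : c <> 0).
  { intros E. apply Hp. replace s0 with (c + p) by (unfold c; ring). rewrite E; ring. }
  assert (Hc' : (0 < Cmod c)%R) by now apply Cmod_gt_0.
  destruct (power_series_on_bounded f s0 r Hr Hf) as [M HM].
  set (rho := Rmin (r / 4) (Cmod c / 2)).
  assert (Hrho : (0 < rho)%R) by (apply Rmin_glb_lt; lra).
  assert (R1 : (rho <= r / 4)%R) by apply Rmin_l.
  assert (R2 : (rho <= Cmod c / 2)%R) by apply Rmin_r.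
  apply weierstrass_analytic with
    (T := fun i s => / c ^ S i * ((-(1)) ^ i * ((s - s0) ^ i * f s)))
    (rho := rho) (M := fun i => (M / Cmod c * (/ 2) ^ i)%R); auto.
  - intros i. apply power_series_on_scal, power_series_on_scal.
    apply power_series_on_le with r; [lra|].
    induction i.
    + apply power_series_on_ext with f; auto. intros; simpl; ring.
    + apply power_series_on_ext with (fun s => s * ((s - s0) ^ i * f s)
                                          - s0 * ((s - s0) ^ i * f s)).
      { intros; simpl; ring. }
      apply power_series_on_minus. now apply power_series_on_mult_id.
      now apply power_series_on_scal.
  - intros i w Hw. replace (s0 + w - s0) with w by ring.
    rewrite !Cmod_mult, Cmod_inv, !Cmod_pow, Cmod_m1, pow1 by now apply Cpow_nz.
    specialize (HM w ltac:(lra)).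
    assert (Hq : (Cmod w ^ i <= (Cmod c * / 2) ^ i)%R).
    { apply pow_incr. split. apply Cmod_ge_0. lra. }
    rewrite Rpow_mult_distr in Hq. simpl.
    assert (0 < Cmod c ^ i)%R by now apply pow_lt.
    assert (0 < (/ 2) ^ i)%R by (apply pow_lt; lra).
    replace (M / Cmod c * (/ 2) ^ i)%R
      with (/ (Cmod c * Cmod c ^ i) * (1 * ((Cmod c ^ i * (/ 2) ^ i) * M)))%R by (field; lra).
    apply Rmult_le_compat_l.
    + left. apply Rinv_0_lt_compat. nra.
    + rewrite !Rmult_1_l. apply Rmult_le_compat; auto using Cmod_ge_0.
      apply pow_le, Cmod_ge_0.
  - apply ex_series_Rscal, ex_series_geom. rewrite Rabs_pos_eq; lra.
  - intros w Hw.
    assert (Hcw : c + w <> 0).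
    { intros E. assert (Cmod c = Cmod w).
      { replace c with (- w) by (replace (- w) with (c - (c + w)) by ring; rewrite E; ring).
        apply Cmod_opp. }
      lra. }
    apply Csum_ext with (fun i => f (s0 + w) / c * (- w / c) ^ i).
    + intros i. replace (s0 + w - s0) with w by ring.
      replace (- w / c) with (- (1) * (w * / c)) by (field; auto).
      rewrite !Cpow_mult_l, Cpow_inv, Cpow_S by auto. field. split; auto.
      now apply Cpow_nz.
    + replace (f (s0 + w) / (s0 + w - p)) with (f (s0 + w) / c * / (1 - - w / c)).
      * apply Csum_scal, Csum_geometric. rewrite Cmod_div, Cmod_opp by auto.
        apply Rmult_lt_reg_r with (Cmod c); auto.
        replace (Cmod w / Cmod c * Cmod c)%R with (Cmod w) by (field; lra). lra.
      * replace (s0 + w - p) with (c + w) by (unfold c; ring). field.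
        repeat split; auto.
Qed.

(* Errors of the trapezoid rule for the integral of [(1 - s) x^-s] over [n, n+1];
   [zeta_numerator s] is [(s - 1) zeta(s)]. *)
Definition zeta_term (n : nat) (s : C) : C :=
  Rcpower (INR (S (S n))) (1 - s) - Rcpower (INR (S n)) (1 - s)
  - / 2 * ((1 - s) * Rcpower (INR (S n)) (- s) + (1 - s) * Rcpower (INR (S (S n))) (- s)).

Definition zeta_numerator (s : C) : C :=
  1 + / 2 * (s - 1)
  + epsilon (inhabits (RtoC 0)) (fun l => Csum (fun n => zeta_term n s) l).

Lemma zeta_term_bound (sigma A : R) (n : nat) (s : C) :
  (-2 <= sigma <= Re s)%R -> (Cmod s <= A)%R ->
  (Cmod (zeta_term n s)
   <= (A + 1) * (A * (A + 1)) * Rpower (INR (S n)) (- (sigma + 2)))%R.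
Proof.
  intros Hs HA. unfold zeta_term. rewrite (S_INR (S n)).
  apply Rcpower_trapezoid; auto. apply INR_S_ge_1.
Qed.

Lemma zeta_sum (s : C) :
  (-1 < Re s)%R ->
  Csum (fun n => zeta_term n s)
    (epsilon (inhabits (RtoC 0)) (fun l => Csum (fun n => zeta_term n s) l)).
Proof.
  intros Hs. apply epsilon_spec.
  apply Csum_exists with
    (fun n => (Cmod s + 1) * (Cmod s * (Cmod s + 1)) * Rpower (INR (S n)) (- (Re s + 2)))%R.
  - intros n. apply zeta_term_bound; lra.
  - now apply ex_series_disc.
Qed.

Lemma zeta_numerator_analytic (s0 : C) :
  (-1 < Re s0)%R -> exists r, (0 < r)%R /\ power_series_on zeta_numerator s0 r.
Proof.
  intros Hs.
  set (S := fun s => epsilon (inhabits (RtoC 0)) (fun l => Csum (fun n => zeta_term n s) l)).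
  set (A := (Cmod s0 + (Re s0 + 1) / 2)%R).
  destruct (weierstrass_analytic zeta_term S s0 ((Re s0 + 1) / 2)
    (fun n => (A + 1) * (A * (A + 1))
              * Rpower (INR (Datatypes.S n)) (- ((Re s0 - 1) / 2 + 2)))%R) as [r [Hr H]].
  - lra.
  - intros n. unfold zeta_term.
    assert (P : forall m r, power_series_on (fun s => (1 - s) * Rcpower (INR m) (- s)) s0 r).
    { intros m r. apply power_series_on_ext with
        (fun s => Rcpower (INR m) (- s) - s * Rcpower (INR m) (- s)); [intros; ring|].
      apply power_series_on_minus; [|apply power_series_on_mult_id];
        apply power_series_on_Rcpower_opp. }
    apply power_series_on_minus.
    + apply power_series_on_minus; apply power_series_on_Rcpower.
    + apply power_series_on_scal, power_series_on_plus; apply P.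
  - intros n w Hw. destruct (disc_bounds s0 w Hs Hw). apply zeta_term_bound; auto.
  - apply ex_series_disc. lra.
  - intros w Hw. apply zeta_sum. destruct (disc_bounds s0 w Hs Hw). lra.
  - exists r. split; auto. apply power_series_on_plus; auto.
    apply power_series_on_plus. apply power_series_on_const.
    apply power_series_on_scal.
    apply power_series_on_ext with (fun s => s * 1 - 1); [intros; ring|].
    apply power_series_on_minus; [apply power_series_on_mult_id|];
      apply power_series_on_const.
Qed.

(** The trapezoid errors add up in closed form to (n+1)^(1-s) - 1 + (s-1) (partial sum - 1/2 + g n /
    2). Solving for the partial sum explains the terms 1 + (s-1)/2 in [zeta_numerator]. *)
Lemma zeta_series (s : C) :
  (1 < Re s)%R ->
  Csum (fun n => Rcpower (INR (S n)) (- s)) (zeta_numerator s / (s - 1)).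
Proof.
  intros Hs.
  assert (Z : s - 1 <> 0).
  { intros E. assert (E1 : Re (s - 1) = 0%R) by (rewrite E; reflexivity).
    simpl in E1. unfold Re in Hs. lra. }
  set (g := fun n => Rcpower (INR (S n)) (- s)).
  assert (E : forall n, csum (fun i => zeta_term i s) n
    = Rcpower (INR (S n)) (1 - s) - 1 + (s - 1) * (csum g n - / 2 + / 2 * g n)).
  { induction n.
    - assert (G : g O = 1) by (unfold g; simpl INR; apply Rcpower_1_l).
      simpl csum. rewrite G. simpl INR. rewrite Rcpower_1_l. ring.
    - simpl csum. rewrite IHn. unfold zeta_term.
      fold (g n). fold (g (S n)). field. }
  assert (L1 : is_lim_seq (fun n => Cmod (Rcpower (INR (S n)) (1 - s))) 0%R).
  { apply is_lim_seq_ext with (fun n => Rpower (INR (S n)) (1 - Re s)).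
    - intros n. rewrite Cmod_Rcpower. reflexivity.
    - apply Rpower_lim_0; lra. }
  assert (L2 : is_lim_seq (fun n => Cmod (g n)) 0%R).
  { apply is_lim_seq_ext with (fun n => Rpower (INR (S n)) (- Re s)).
    - intros n. unfold g. rewrite Cmod_Rcpower. reflexivity.
    - apply Rpower_lim_0; lra. }
  unfold Csum.
  apply Clim_close with
    (fun n => / (s - 1) * (1 + / 2 * (s - 1) + csum (fun i => zeta_term i s) n))
    (fun n => Cmod (/ (s - 1)) * Cmod (Rcpower (INR (S n)) (1 - s)) + / 2 * Cmod (g n))%R.
  - replace (zeta_numerator s / (s - 1)) with (/ (s - 1) * zeta_numerator s) by (unfold Cdiv; ring). apply Clim_scal. apply Clim_plus. apply Clim_const.
    apply zeta_sum. lra.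
  - intros n. rewrite E. change (csum _ n) with (csum g n) at 1.
    match goal with |- (Cmod ?e <= _)%R => replace e with
      (- (/ (s - 1) * Rcpower (INR (S n)) (1 - s)) + - (/ 2 * g n)) by (field; auto) end.
    eapply Rle_trans; [apply Cmod_triangle|]. rewrite !Cmod_opp, !Cmod_mult.
    rewrite <- RtoC_inv by lra. rewrite (Cmod_R (/ 2)), (Rabs_pos_eq (/ 2)) by lra. lra.
  - replace (Finite 0) with (Finite (Cmod (/ (s - 1)) * 0 + / 2 * 0)) by (f_equal; ring).
    apply is_lim_seq_plus'.
    + apply (is_lim_seq_scal_l _ _ (Finite 0)). exact L1.
    + apply (is_lim_seq_scal_l _ _ (Finite 0)). exact L2.
Qed.

(** For s = 0 the integrand is constant and the trapezoid rule exact, which leaves 1 - 1/2. Division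
    by s - 1 then gives zeta(0) = -1/2. *)
Lemma zeta_numerator_0 : zeta_numerator 0 = / 2.
Proof.
  assert (E : epsilon (inhabits (RtoC 0)) (fun l => Csum (fun n => zeta_term n 0) l) = 0).
  { apply Csum_unique with (fun n => zeta_term n 0).
    - apply zeta_sum. simpl. lra.
    - apply Csum_ext with (fun _ => 0). 2: apply Csum_zero.
      intros n. unfold zeta_term. replace (1 - 0) with (RtoC 1) by ring.
      replace (- 0) with (RtoC 0) by ring.
      rewrite !Rcpower_0, !Rcpower_1_r by (apply lt_0_INR; lia).
      rewrite (S_INR (S n)), RtoC_plus. field. }
  unfold zeta_numerator. rewrite E. field.
Qed.

(** * Values of Dirichlet L-functions *)

(** At u = e r the vanishing sum expresses -b_0 by the terms of positive degree, which are bounded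
    by e K; then e tends to 0. *)
Lemma power_series_zero_first (b : nat -> C) (delta : R) :
  (0 < delta)%R ->
  (forall u, (0 < u < delta)%R -> Csum (fun j => b j * RtoC u ^ j) 0) -> b O = 0.
Proof.
  intros Hd H.
  set (r := (delta / 3)%R).
  assert (E : ex_series (fun j => Cmod (b j) * r ^ j)%R).
  { apply power_series_abs with (delta / 2)%R; [unfold r; lra|]. exists 0. apply H. lra. }
  assert (E1 : ex_series (fun j => Cmod (b (S j)) * r ^ S j)%R)
    by now apply (ex_series_incr_1 (fun j => Cmod (b j) * r ^ j)%R).
  set (K := Series (fun j => Cmod (b (S j)) * r ^ S j)%R).
  assert (B : forall e, (0 < e < 1)%R -> (Cmod (b O) <= e * K)%R).
  { intros e He. rewrite <- Cmod_opp. unfold K. rewrite <- Series_scal_l.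
    assert (Hr : (0 < r)%R) by (unfold r; lra).
    apply Csum_norm_le with (fun j => b (S j) * RtoC (e * r) ^ S j).
    - intros j. rewrite Cmod_mult, Cmod_pow, Cmod_R, Rabs_pos_eq, Rpow_mult_distr by nra.
      assert (e ^ S j <= e)%R.
      { simpl. assert (e ^ j <= 1)%R by (rewrite <- (pow1 j); apply pow_incr; lra). nra. }
      assert (0 <= r ^ S j)%R by (apply pow_le; lra).
      replace (e * (Cmod (b (S j)) * r ^ S j))%R with (Cmod (b (S j)) * (e * r ^ S j))%R by ring.
      apply Rmult_le_compat_l. apply Cmod_ge_0. nra.
    - now apply ex_series_Rscal.
    - apply (Csum_shift (fun j => b j * RtoC (e * r) ^ j)).
      replace (b O * RtoC (e * r) ^ 0 + - b O) with (RtoC 0) by (simpl; ring).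
      apply H. unfold r in *. nra. }
  apply Cmod_eq_0. apply Rle_antisym; [|apply Cmod_ge_0].
  assert (K0 : (0 <= K)%R).
  { pose proof (B (/ 2)%R ltac:(lra)). pose proof (Cmod_ge_0 (b O)). lra. }
  apply Rle_plus_epsilon. intros e He.
  assert (Hq : (0 < Rmin (/ 2) (e / (K + 1)) < 1)%R).
  { split. apply Rmin_glb_lt; [lra|]. apply Rdiv_lt_0_compat; lra.
    pose proof (Rmin_l (/ 2) (e / (K + 1))). lra. }
  pose proof (B _ Hq). pose proof (Rmin_r (/ 2) (e / (K + 1))).
  assert (e / (K + 1) * (K + 1) = e)%R by (field; lra).
  assert (0 < e / (K + 1))%R by (apply Rdiv_lt_0_compat; lra). nra.
Qed.

Lemma power_series_zero (b : nat -> C) (delta : R) :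
  (0 < delta)%R ->
  (forall u, (0 < u < delta)%R -> Csum (fun j => b j * RtoC u ^ j) 0) ->
  forall j, b j = 0.
Proof.
  intros Hd H j. revert b H. induction j; intros b H.
  - now apply power_series_zero_first with delta.
  - apply (IHj (fun j => b (S j))). intros u Hu.
    assert (Zu : RtoC u <> 0) by (apply RtoC_neq_0; lra).
    assert (B0 : b O = 0) by now apply power_series_zero_first with delta.
    apply Csum_ext with (fun j => / RtoC u * (b (S j) * RtoC u ^ S j)).
    { intros i. rewrite Cpow_S. field. auto. }
    replace (RtoC 0) with (/ RtoC u * 0) by ring. apply Csum_scal.
    apply (Csum_shift (fun j => b j * RtoC u ^ j)). rewrite B0.
    replace (0 * RtoC u ^ 0 + 0) with (RtoC 0) by ring. auto.
Qed.

Lemma power_series_on_vanish (h : C -> C) (s0 d : C) (r delta : R) :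
  (0 < r)%R -> (0 < delta)%R -> d <> 0 -> power_series_on h s0 r ->
  (forall u, (0 < u < delta)%R -> h (s0 + RtoC u * d) = 0) ->
  forall w, (Cmod w < r)%R -> h (s0 + w) = 0.
Proof.
  intros Hr Hd Zd [b Hb] H0 w Hw.
  assert (Hdm : (0 < Cmod d)%R) by now apply Cmod_gt_0.
  assert (Z : forall j, b j * d ^ j = 0).
  { apply (power_series_zero _ (Rmin delta (r / Cmod d))).
    - apply Rmin_glb_lt; auto. now apply Rdiv_lt_0_compat.
    - intros u Hu. pose proof (Rmin_l delta (r / Cmod d)). pose proof (Rmin_r delta (r / Cmod d)).
      rewrite <- (H0 u) by lra.
      apply Csum_ext with (fun j => b j * (RtoC u * d) ^ j).
      { intros j. rewrite Cpow_mult_l. ring. }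
      apply Hb. rewrite Cmod_mult, Cmod_R, Rabs_pos_eq by lra.
      apply Rmult_lt_reg_r with (/ Cmod d)%R; [now apply Rinv_0_lt_compat|].
      replace (u * Cmod d * / Cmod d)%R with u by (field; lra). unfold Rdiv in *. lra. }
  apply Csum_unique with (1 := Hb w Hw). apply Csum_ext with (fun _ => 0).
  - intros j. assert (Zj : d ^ j <> 0) by now apply Cpow_nz.
    replace (b j) with (b j * d ^ j * / d ^ j) by (field; auto). rewrite Z. ring.
  - apply Csum_zero.
Qed.

(** Let m be the supremum of the lengths of end pieces of the segment on which h vanishes. The power
    series at the point 1 - m vanishes along such a piece, hence on a whole disc; unless m = 1, this
    would lengthen the piece. *)
Lemma identity_segment (h : C -> C) (p d : C) :
  d <> 0 ->
  (forall t, (0 <= t <= 1)%R -> exists r, (0 < r)%R /\ power_series_on h (p + RtoC t * d) r) ->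
  (forall t, (/ 2 < t <= 1)%R -> h (p + RtoC t * d) = 0) ->
  h p = 0.
Proof.
  intros Zd Ha H1.
  set (S := fun x => (0 <= x <= 1)%R
                     /\ forall t, (1 - x < t <= 1)%R -> h (p + RtoC t * d) = 0).
  destruct (completeness S) as [m [Hub Hlub]].
  - exists 1%R. intros x [Hx _]. lra.
  - exists (/ 2)%R. split. lra. intros t Ht. apply H1. lra.
  - assert (Hm : (/ 2 <= m)%R).
    { apply Hub. split. lra. intros t Ht. apply H1. lra. }
    assert (Hm1 : (m <= 1)%R) by (apply Hlub; intros x [Hx _]; lra).
    assert (Hz : forall t, (1 - m < t <= 1)%R -> h (p + RtoC t * d) = 0).
    { intros t Ht. destruct (classic (exists x, S x /\ (1 - t < x)%R)) as [[x [[Hx Sx] Hxt]]|N].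
      - apply Sx. lra.
      - exfalso. assert (m <= 1 - t)%R; [|lra]. apply Hlub. intros x Sx.
        apply Rnot_lt_le. intros L. apply N. exists x; auto. }
    destruct (Ha (1 - m)%R ltac:(lra)) as [r [Hr Hp]].
    assert (V : forall w, (Cmod w < r)%R -> h (p + RtoC (1 - m) * d + w) = 0).
    { apply power_series_on_vanish with d (m / 2)%R; auto; [lra|]. intros u Hu.
      replace (p + RtoC (1 - m) * d + RtoC u * d) with (p + RtoC (1 - m + u) * d)
        by (rewrite RtoC_plus; ring).
      apply Hz. lra. }
    destruct (Req_dec m 1) as [E|NE].
    + specialize (V 0 ltac:(rewrite Cmod_0; auto)). rewrite E in V.
      replace (p + RtoC (1 - 1) * d + 0) with p in V; auto.
      replace (1 - 1)%R with 0%R by ring. ring.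
    + exfalso. assert (Hdm : (0 < Cmod d)%R) by now apply Cmod_gt_0.
      set (e := Rmin (1 - m) (r / Cmod d / 2)).
      assert (He : (0 < e)%R).
      { apply Rmin_glb_lt. lra. assert (0 < r / Cmod d)%R by now apply Rdiv_lt_0_compat. lra. }
      pose proof (Rmin_l (1 - m) (r / Cmod d / 2)) as E1.
      pose proof (Rmin_r (1 - m) (r / Cmod d / 2)) as E2. fold e in E1, E2.
      assert (m + e <= m)%R; [|lra]. apply Hub. split. lra. intros t Ht.
      destruct (Rlt_le_dec (1 - m) t) as [L|L]. apply Hz; lra.
      replace (p + RtoC t * d) with (p + RtoC (1 - m) * d + RtoC (t - (1 - m)) * d)
        by (rewrite (RtoC_minus t); ring).
      apply V. rewrite Cmod_mult, Cmod_R, Rabs_left1 by lra.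
      assert (Hre : (e * Cmod d < r)%R).
      { apply Rmult_lt_reg_r with (/ Cmod d)%R; [now apply Rinv_0_lt_compat|].
        replace (e * Cmod d * / Cmod d)%R with e by (field; lra).
        assert (0 < r / Cmod d)%R by now apply Rdiv_lt_0_compat. unfold Rdiv in *. lra. }
      nra.
Qed.

Lemma the_unique (P : C -> Prop) (v : C) : P v -> (forall w, P w -> w = v) -> the P = v.
Proof.
  intros Hv Hu. apply Hu. apply (iota_correct (V := C_CompleteNormedModule)).
  exists v. split; auto. intros w Hw. symmetry; auto.
Qed.

(** Two continuations, possibly to different half-planes, are compared along a segment that ends
    where both equal the Dirichlet series: with direction 2 + i and x >= 0, the points with t > 1/2
    have real part above 1. *)
Lemma dirichlet_L_eq (chi : Z -> C) (sigma x : R) (f : C -> C) :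
  L_continuation chi sigma f -> (sigma < x)%R -> (0 <= x)%R ->
  (principal chi -> x <> 1%R) -> dirichlet_L chi (RtoC x) = f (RtoC x).
Proof.
  intros Hf Hx H0 Hp. apply the_unique. exists sigma, f. auto.
  intros v [sigma' [f' [Hx' [Hf' E]]]]. rewrite <- E. simpl in Hx'.
  enough (H : f' (RtoC x) - f (RtoC x) = 0).
  { replace (f' (RtoC x)) with (f' (RtoC x) - f (RtoC x) + f (RtoC x)) by ring.
    rewrite H. ring. }
  (* The segment from [x] to [x + 2 + i] meets the possible pole 1 at most in [x]. *)
  apply (identity_segment (fun s => f' s - f s) (RtoC x) (2, 1)).
  - intros Z. injection Z. intros; lra.
  - intros t Ht. destruct Hf as [_ Ha]. destruct Hf' as [_ Ha'].
    assert (R0 : (x <= Re (RtoC x + RtoC t * (2, 1)))%R) by (simpl; lra).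
    assert (N1 : principal chi -> RtoC x + RtoC t * (2, 1) <> 1).
    { intros P Z. apply (Hp P). injection Z. intros. assert (t = 0)%R by lra. subst t. lra. }
    specialize (Ha (RtoC x + RtoC t * (2, 1)) ltac:(lra) N1).
    specialize (Ha' (RtoC x + RtoC t * (2, 1)) ltac:(lra) N1).
    apply analytic_at_power_series in Ha. apply analytic_at_power_series in Ha'.
    destruct Ha as [r [Hr P]]. destruct Ha' as [r' [Hr' P']].
    exists (Rmin r r'). split. now apply Rmin_glb_lt.
    apply power_series_on_minus; eapply power_series_on_le; eauto;
      [apply Rmin_r | apply Rmin_l].
  - intros t Ht. destruct Hf as [Hs _]. destruct Hf' as [Hs' _].
    assert (R1 : (1 < Re (RtoC x + RtoC t * (2, 1)))%R) by (simpl; lra).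
    specialize (Hs _ R1). specialize (Hs' _ R1).
    apply Csum_is_series in Hs. apply Csum_is_series in Hs'.
    rewrite (Csum_unique _ _ _ Hs Hs'). ring.
Qed.

(** * Dirichlet characters: parity, sums over a period, periodic antiderivatives *)

Lemma csum_fold_right (f : Z -> C) (n : nat) :
  csum (fun i => f (Z.of_nat i)) n
  = fold_right Cplus 0 (map f (map Z.of_nat (seq 0 n))).
Proof.
  induction n; auto. rewrite seq_S, !map_app. simpl csum. rewrite IHn.
  change (map f (map Z.of_nat ((0 + n)%nat :: nil))) with (f (Z.of_nat n) :: nil).
  generalize (map f (map Z.of_nat (seq 0 n))). intros l.
  induction l; simpl; [|rewrite <- IHl]; ring.
Qed.

Lemma fold_right_Permutation (l l' : list C) :
  Permutation l l' -> fold_right Cplus 0 l = fold_right Cplus 0 l'.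
Proof. induction 1; simpl; try congruence; ring. Qed.

Lemma dirichlet_character_1 (N : Z) (chi : Z -> C) :
  dirichlet_character N chi -> chi 1%Z = 1.
Proof.
  intros [_ [_ [Hm Hz]]].
  assert (Z1 : chi 1%Z <> 0) by (apply Hz; apply Z.gcd_1_l).
  pose proof (Hm 1%Z 1%Z) as H. simpl in H.
  replace (chi 1%Z) with (chi 1%Z * chi 1%Z * / chi 1%Z) by (field; auto).
  rewrite <- H. field. auto.
Qed.

Lemma dirichlet_character_opp (N : Z) (chi : Z -> C) (n : Z) :
  dirichlet_character N chi -> chi (- n)%Z = chi (-1)%Z * chi n.
Proof. intros [_ [_ [Hm _]]]. rewrite <- Hm. f_equal. Qed.

Lemma dirichlet_character_parity (N : Z) (chi : Z -> C) :
  dirichlet_character N chi -> chi (-1)%Z = 1 \/ chi (-1)%Z = - (1).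
Proof.
  intros Hc. pose proof (dirichlet_character_1 N chi Hc) as H1.
  destruct Hc as [_ [_ [Hm _]]]. pose proof (Hm (-1)%Z (-1)%Z) as H. simpl in H.
  rewrite H1 in H.
  assert (E : (chi (-1)%Z - 1) * (chi (-1)%Z + 1) = 0).
  { replace ((chi (-1)%Z - 1) * (chi (-1)%Z + 1)) with (chi (-1)%Z * chi (-1)%Z - 1) by ring.
    rewrite <- H. ring. }
  destruct (Ceq_dec (chi (-1)%Z - 1) 0) as [Z|Z].
  - left. replace (chi (-1)%Z) with (chi (-1)%Z - 1 + 1) by ring. rewrite Z; ring.
  - right. replace (chi (-1)%Z) with ((chi (-1)%Z - 1) * (chi (-1)%Z + 1) * / (chi (-1)%Z - 1) - 1)
      by (field; auto). rewrite E. ring.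
Qed.

Lemma periodic_mod (N : Z) (f : Z -> C) (n : Z) :
  (0 < N)%Z -> (forall n, f (n + N)%Z = f n) -> f (n mod N)%Z = f n.
Proof.
  intros HN Hp.
  assert (P : forall (k : nat) n, f (n + Z.of_nat k * N)%Z = f n).
  { induction k; intros m. f_equal; lia.
    rewrite <- (IHk m), <- (Hp (m + Z.of_nat k * N)%Z). f_equal. lia. }
  assert (Q : forall k n, f (n + k * N)%Z = f n).
  { intros k m. destruct (Z.le_ge_cases 0 k).
    - rewrite <- (P (Z.to_nat k) m). f_equal. lia.
    - rewrite <- (P (Z.to_nat (- k)) (m + k * N)%Z). f_equal. lia. }
  rewrite <- (Q (n / N)%Z (n mod N)%Z). f_equal. pose proof (Z.div_mod n N). lia.
Qed.

Lemma rsum_term_le (u : nat -> R) (i n : nat) :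
  (forall j, 0 <= u j)%R -> (i < n)%nat -> (u i <= rsum u n)%R.
Proof.
  intros Hu Hi. apply Rle_trans with (rsum u (S i)).
  - simpl. pose proof (rsum_nonneg u i Hu). lra.
  - apply rsum_mono; auto.
Qed.

Lemma periodic_bounded (N : Z) (f : Z -> C) :
  (0 < N)%Z -> (forall n, f (n + N)%Z = f n) -> Z_bounded f.
Proof.
  intros HN Hp. exists (rsum (fun i => Cmod (f (Z.of_nat i))) (Z.to_nat N)).
  intros n. rewrite <- (periodic_mod N f n HN Hp).
  pose proof (Z.mod_pos_bound n N HN) as Hb.
  replace (n mod N)%Z with (Z.of_nat (Z.to_nat (n mod N))) by lia.
  apply (rsum_term_le (fun i => Cmod (f (Z.of_nat i)))).
  - intros j; apply Cmod_ge_0.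
  - lia.
Qed.

(** The partial sum up to [n mod N] is periodic by construction; at the end of a period, where it
    falls back to 0, the vanishing total makes the difference correct. *)
Lemma periodic_antiderivative (N : Z) (f : Z -> C) :
  (0 < N)%Z -> (forall n, f (n + N)%Z = f n) ->
  csum (fun i => f (Z.of_nat i)) (Z.to_nat N) = 0 ->
  exists F, Z_antiderivative F f /\ forall n, F (n + N)%Z = F n.
Proof.
  intros HN Hp H0.
  exists (fun n => csum (fun i => f (Z.of_nat i)) (Z.to_nat (n mod N))). split.
  - intros n. rewrite <- (periodic_mod N f n HN Hp).
    pose proof (Z.mod_pos_bound n N HN) as Hb. set (m := (n mod N)%Z) in *.
    assert (E : ((n + 1) mod N = (m + 1) mod N)%Z) by (unfold m; now rewrite Zplus_mod_idemp_l).
    rewrite E. destruct (Z.eq_dec (m + 1) N) as [W|W].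
    + rewrite W, Z_mod_same_full. simpl csum at 1.
      replace (Z.to_nat N) with (S (Z.to_nat m)) in H0 by lia. simpl in H0.
      rewrite Z2Nat.id in H0 by lia.
      replace (f m) with (csum (fun i => f (Z.of_nat i)) (Z.to_nat m) + f m
                          - csum (fun i => f (Z.of_nat i)) (Z.to_nat m)) by ring.
      rewrite H0. ring.
    + rewrite Z.mod_small by lia. replace (Z.to_nat (m + 1)) with (S (Z.to_nat m)) by lia.
      simpl. rewrite Z2Nat.id by lia. ring.
  - intros n. do 2 f_equal. rewrite <- (Z.mul_1_l N) at 1. apply Z_mod_plus_full.
Qed.

(** Subtracting its mean from a first antiderivative keeps its differences and makes its sum over a
    period vanish, so that a second periodic antiderivative exists. *)
Lemma balanced_antiderivatives (N : Z) (f : Z -> C) :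
  (0 < N)%Z -> (forall n, f (n + N)%Z = f n) ->
  csum (fun i => f (Z.of_nat i)) (Z.to_nat N) = 0 ->
  exists X Y, Z_antiderivative X f /\ Z_antiderivative Y X /\ Z_bounded X /\ Z_bounded Y.
Proof.
  intros HN Hp H0. destruct (periodic_antiderivative N f HN Hp H0) as [F [HF PF]].
  set (mu := csum (fun i => F (Z.of_nat i)) (Z.to_nat N) / RtoC (IZR N)).
  assert (ZN : RtoC (IZR N) <> 0) by (apply RtoC_neq_0, eq_IZR_contrapositive; lia).
  destruct (periodic_antiderivative N (fun n => F n - mu) HN) as [Y [HY PY]].
  - intros n. now rewrite PF.
  - unfold Cminus. rewrite csum_plus, csum_const.
    rewrite INR_IZR_INZ, Z2Nat.id by lia. unfold mu. field. auto.
  - exists (fun n => F n - mu), Y. repeat split; auto.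
    + intros n. rewrite <- (HF n). ring.
    + apply (periodic_bounded N); auto. intros n; now rewrite PF.
    + apply (periodic_bounded N); auto.
Qed.

(* For even [f], [X n + X (1 - n)] is constant; summing it up to [n] shows that
   [n] times this constant stays bounded. *)
Lemma even_antiderivative (f X Y : Z -> C) :
  (forall n, f (- n)%Z = f n) -> f 0%Z = 0 ->
  Z_antiderivative X f -> Z_antiderivative Y X -> Z_bounded Y -> X 1%Z = 0.
Proof.
  intros He H0 HX HY [B HB].
  set (c := X 0%Z + X 1%Z).
  assert (Hc : forall n : nat, X (Z.of_nat n) + X (1 - Z.of_nat n)%Z = c).
  { induction n. reflexivity.
    rewrite <- IHn. pose proof (HX (Z.of_nat n)) as H1. pose proof (HX (- Z.of_nat n)%Z) as H2.
    rewrite He in H2.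
    replace (Z.of_nat (S n)) with (Z.of_nat n + 1)%Z by lia.
    replace (1 - (Z.of_nat n + 1))%Z with (- Z.of_nat n)%Z by lia.
    replace (- Z.of_nat n + 1)%Z with (1 - Z.of_nat n)%Z in H2 by lia.
    rewrite <- H1 in H2. replace (X (1 - Z.of_nat n)%Z)
      with (X (1 - Z.of_nat n)%Z - X (- Z.of_nat n)%Z + X (- Z.of_nat n)%Z) by ring.
    rewrite H2. ring. }
  assert (Hs : forall n : nat, RtoC (INR n) * c
     = Y (Z.of_nat n) - Y 0%Z + Y 2%Z - Y (2 - Z.of_nat n)%Z).
  { intros n. rewrite <- csum_const.
    rewrite (csum_ext _ (fun i => (Y (Z.of_nat (S i)) - Y (2 - Z.of_nat (S i))%Z)
                                - (Y (Z.of_nat i) - Y (2 - Z.of_nat i)%Z))).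
    - rewrite (csum_telescope (fun i => Y (Z.of_nat i) - Y (2 - Z.of_nat i)%Z)).
      simpl (Z.of_nat 0). simpl (2 - 0)%Z. ring.
    - intros i _. rewrite <- (Hc i), <- (HY (Z.of_nat i)), <- (HY (1 - Z.of_nat i)%Z).
      replace (Z.of_nat (S i)) with (Z.of_nat i + 1)%Z by lia.
      replace (1 - Z.of_nat i + 1)%Z with (2 - Z.of_nat i)%Z by lia.
      replace (2 - (Z.of_nat i + 1))%Z with (1 - Z.of_nat i)%Z by lia. ring. }
  assert (Zc : c = 0).
  { destruct (Ceq_dec c 0) as [Z|Z]; auto. exfalso.
    apply Cmod_gt_0 in Z. destruct (INR_archimed (Cmod c) (4 * B) Z) as [n Hn].
    specialize (Hs n). apply (f_equal Cmod) in Hs.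
    rewrite Cmod_mult, Cmod_R, Rabs_pos_eq in Hs by apply pos_INR.
    pose proof (Cmod_triangle (Y (Z.of_nat n) - Y 0%Z + Y 2%Z) (- Y (2 - Z.of_nat n)%Z)) as T1.
    pose proof (Cmod_triangle (Y (Z.of_nat n) - Y 0%Z) (Y 2%Z)) as T2.
    pose proof (Cmod_triangle (Y (Z.of_nat n)) (- Y 0%Z)) as T3.
    rewrite Cmod_opp in T1, T3. unfold Cminus in *.
    pose proof (HB (Z.of_nat n)). pose proof (HB 0%Z). pose proof (HB 2%Z).
    pose proof (HB (2 - Z.of_nat n)%Z). lra. }
  assert (E : X 1%Z - X 0%Z = 0) by (rewrite <- H0; apply (HX 0%Z)).
  assert (D : 2 * X 1%Z = 0).
  { replace (2 * X 1%Z) with (X 1%Z - X 0%Z + (X 0%Z + X 1%Z)) by ring. rewrite E.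
    fold c. rewrite Zc. ring. }
  replace (X 1%Z) with (/ 2 * (2 * X 1%Z)) by field. rewrite D. ring.
Qed.

(** A principal character is induced from modulus 1, so primitivity forces N = 1. *)
Lemma primitive_principal (N : Z) (chi : Z -> C) :
  primitive_character N chi -> principal chi -> forall n, chi n = 1.
Proof.
  intros [Hd Hp] Hpr.
  assert (HN : (0 < N)%Z) by apply Hd.
  assert (E : N = 1%Z).
  { destruct (Z.eq_dec N 1); auto. exfalso. apply (Hp 1%Z); [lia | apply Z.divide_1_l |].
    exists (fun _ => 1). split.
    - repeat split; try lia; intros; try ring.
      + apply Z.gcd_1_r.
      + apply RtoC_neq_0; lra.
    - intros m Hm. apply Hpr. now apply Hd. }
  intros n. apply Hpr. apply Hd. rewrite E. apply Z.gcd_1_r.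
Qed.

(** Multiplication by some b with chi b different from 0 and 1 permutes the residues, so the sum S
    satisfies chi b S = S. *)
Lemma nonprincipal_sum_zero (N : Z) (chi : Z -> C) :
  dirichlet_character N chi -> ~ principal chi ->
  csum (fun i => chi (Z.of_nat i)) (Z.to_nat N) = 0.
Proof.
  intros Hd Hnp. pose proof Hd as [HN [Hp [Hm Hz]]].
  assert (Hb : exists b, chi b <> 0 /\ chi b <> 1).
  { apply NNPP. intros Nx. apply Hnp. intros n Hn. apply NNPP. intros N1.
    apply Nx. exists n; auto. }
  destruct Hb as [b [Hb0 Hb1]].
  apply Hz in Hb0.
  rewrite csum_fold_right. set (l := map Z.of_nat (seq 0 (Z.to_nat N))).
  set (S := fold_right Cplus 0 (map chi l)).
  assert (Hl : forall a, In a l -> (0 <= a < N)%Z).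
  { intros a Ha. apply in_map_iff in Ha. destruct Ha as [i [<- Hi]].
    apply in_seq in Hi. lia. }
  assert (Hl' : forall a, (0 <= a < N)%Z -> In a l).
  { intros a Ha. apply in_map_iff. exists (Z.to_nat a). split. lia. apply in_seq. lia. }
  assert (Nl : NoDup l).
  { apply Injective_map_NoDup. intros i j. lia. apply seq_NoDup. }
  assert (P : Permutation (map (fun a => (a * b) mod N)%Z l) l).
  { apply NoDup_Permutation_bis.
    - apply Injective_map_NoDup_in; auto. intros x y Hx Hy E.
      apply Hl in Hx. apply Hl in Hy.
      assert (D : (N | (x - y) * b)%Z).
      { apply Z.mod_divide. lia. rewrite Z.mul_sub_distr_r, Zminus_mod, E, Z.sub_diag.
        apply Z.mod_0_l. lia. }
      rewrite Z.mul_comm in D. apply Z.gauss in D.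
      + destruct D as [q Hq]. assert (q = 0)%Z by nia. subst q. lia.
      + rewrite Z.gcd_comm; auto.
    - rewrite length_map. lia.
    - intros a Ha. apply in_map_iff in Ha. destruct Ha as [x [<- Hx]]. apply Hl'.
      now apply Z.mod_pos_bound. }
  assert (E : chi b * S = S).
  { unfold S at 2. rewrite <- (fold_right_Permutation _ _ (Permutation_map chi P)).
    rewrite map_map. unfold S. clear -HN Hp Hm. induction l; simpl. ring.
    rewrite periodic_mod, Hm, <- IHl by auto. ring. }
  assert (Hb1' : chi b - 1 <> 0).
  { intros Z. apply Hb1. replace (chi b) with (chi b - 1 + 1) by ring. rewrite Z; ring. }
  replace S with ((chi b * S - S) * / (chi b - 1)) by (field; auto).
  rewrite E. ring.
Qed.

Lemma nonprincipal_0 (N : Z) (chi : Z -> C) :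
  dirichlet_character N chi -> ~ principal chi -> chi 0%Z = 0.
Proof.
  intros Hd Hnp. apply NNPP. intros Z. apply Hnp. intros n _.
  pose proof (dirichlet_character_1 N chi Hd) as H1.
  destruct Hd as [HN [Hp [_ Hz]]]. apply Hz in Z.
  assert (E : N = 1%Z) by (rewrite Z.gcd_0_l in Z; lia). subst N.
  rewrite <- H1, <- (periodic_mod 1 chi n), <- (periodic_mod 1 chi 1%Z) by auto.
  now rewrite !Z.mod_1_r.
Qed.

(** * Continuations and special values *)

Lemma nonprincipal_continuation (N : Z) (chi : Z -> C) :
  dirichlet_character N chi -> ~ principal chi ->
  exists f, L_continuation chi (-1) f
    /\ (forall s, (0 < Re s)%R ->
          Csum (fun n => chi (Z.of_nat (S n)) * Rcpower (INR (S n)) (- s)) (f s))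
    /\ (chi (-1)%Z = 1 -> f 0 = 0).
Proof.
  intros Hd Hnp. pose proof Hd as [HN [Hp _]].
  destruct (balanced_antiderivatives N chi HN Hp (nonprincipal_sum_zero N chi Hd Hnp))
    as [X [Y [HX [HY [bX bY]]]]].
  exists (balanced_L X Y). repeat split.
  - intros s Hs. apply Csum_is_series. apply balanced_L_series; auto; lra.
  - intros s Hs _. now apply balanced_L_analytic.
  - intros s Hs. now apply balanced_L_series.
  - intros He. rewrite balanced_L_0 by auto. rewrite (even_antiderivative chi X Y); auto.
    + ring.
    + intros n. rewrite (dirichlet_character_opp N chi n Hd), He. ring.
    + now apply (nonprincipal_0 N).
Qed.

Lemma zeta_continuation (chi : Z -> C) :
  (forall n, chi n = 1) ->
  L_continuation chi (-1) (fun s => zeta_numerator s / (s - 1)).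
Proof.
  intros H1. split.
  - intros s Hs. apply Csum_is_series.
    apply Csum_ext with (fun n => Rcpower (INR (S n)) (- s)).
    + intros n. rewrite H1. ring.
    + now apply zeta_series.
  - intros s Hs Hp. apply analytic_at_power_series.
    destruct (zeta_numerator_analytic s Hs) as [r [Hr H]].
    apply (power_series_on_div _ s 1 r); auto.
    apply Hp. intros n _. apply H1.
Qed.

(** The condition at j = 1 keeps the trivial character away from its pole; the nonprincipal
    continuation is given by the series on all of Re s > 0. *)
Lemma dirichlet_L_series (N : Z) (chi : Z -> C) (j : nat) :
  primitive_character N chi -> (1 <= j)%nat -> (j = 1%nat -> chi (-1)%Z <> 1) ->
  Csum (fun n => chi (Z.of_nat (S n)) / RtoC (INR (S n)) ^ j) (dirichlet_L chi (RtoC (INR j))).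
Proof.
  intros Hc Hj H1.
  apply Csum_ext with (fun n => chi (Z.of_nat (S n)) * Rcpower (INR (S n)) (- RtoC (INR j))).
  { intros n. rewrite Rcpower_opp_nat by (apply lt_0_INR; lia). reflexivity. }
  assert (Hj' : (1 <= INR j)%R) by (apply (le_INR 1); auto).
  destruct (classic (principal chi)) as [P|P].
  - pose proof (primitive_principal N chi Hc P) as T.
    assert (j2 : (2 <= j)%nat).
    { destruct (Nat.eq_dec j 1); [|lia]. exfalso. apply H1; auto. }
    assert (Hj2 : (2 <= INR j)%R) by (apply (le_INR 2); auto).
    rewrite (dirichlet_L_eq chi (-1) (INR j) _ (zeta_continuation chi T)); try lra.
    apply Csum_ext with (fun n => Rcpower (INR (S n)) (- RtoC (INR j))).
    { intros n. rewrite T. ring. }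
    apply (zeta_series (RtoC (INR j))). simpl. lra.
  - destruct Hc as [Hd _].
    destruct (nonprincipal_continuation N chi Hd P) as [f [Hf [Hs _]]].
    rewrite (dirichlet_L_eq chi (-1) (INR j) f Hf); try lra; try tauto.
    apply Hs. simpl. lra.
Qed.

(** One formula for both cases, as chi(0) is 1 for the trivial character and 0 for the others. In
    the second case the value is the boundary term of [balanced_L_0], which evenness annihilates. *)
Lemma dirichlet_L_even_0 (N : Z) (chi : Z -> C) :
  primitive_character N chi -> chi (-1)%Z = 1 -> dirichlet_L chi 0 = - / 2 * chi 0%Z.
Proof.
  intros Hc He. destruct (classic (principal chi)) as [P|P].
  - pose proof (primitive_principal N chi Hc P) as T.
    rewrite (dirichlet_L_eq chi (-1) 0 _ (zeta_continuation chi T)); try lra.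
    rewrite zeta_numerator_0, T. field.
  - destruct Hc as [Hd _].
    destruct (nonprincipal_continuation N chi Hd P) as [f [Hf [_ H0]]].
    rewrite (dirichlet_L_eq chi (-1) 0 f Hf); try lra; try tauto.
    rewrite H0, (nonprincipal_0 N chi Hd P) by auto. ring.
Qed.

(** Splits a character into its mean, which is [epsilon_char], and a bounded difference. In this
    form trivial and nontrivial characters are treated alike in the sums over shifted integers. *)
Lemma epsilon_char_spec (N : Z) (chi : Z -> C) :
  primitive_character N chi ->
  chi 0%Z = epsilon_char chi
  /\ exists Psi, Z_bounded Psi /\ forall n, chi n = epsilon_char chi + (Psi (n + 1)%Z - Psi n).
Proof.
  intros Hc. unfold epsilon_char.
  destruct (excluded_middle_informative (forall n, chi n = 1)) as [T|T].
  - split; auto. exists (fun _ => 0). split.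
    + exists 0%R. intros _. rewrite Cmod_0. lra.
    + intros n. rewrite T. ring.
  - assert (P : ~ principal chi) by (intros P; apply T; now apply (primitive_principal N)).
    destruct Hc as [Hd _]. split. now apply (nonprincipal_0 N).
    pose proof Hd as [HN [Hp _]].
    destruct (balanced_antiderivatives N chi HN Hp (nonprincipal_sum_zero N chi Hd P))
      as [X [Y [HX [_ [bX _]]]]].
    exists X. split; auto. intros n. rewrite (HX n). ring.
Qed.

(** * Sums over shifted integers *)

(* Sums over Z are taken symmetrically: [csum (zpair f) N] is the sum of [f n]
   over [|n| < N]. *)
Definition zpair (f : Z -> C) (i : nat) : C :=
  match i with O => f 0%Z | S _ => f (Z.of_nat i) + f (- Z.of_nat i)%Z end.

Definition rpair (f : Z -> R) (i : nat) : R :=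
  match i with O => f 0%Z | S _ => (f (Z.of_nat i) + f (- Z.of_nat i)%Z)%R end.

Lemma zpair_ext (f g : Z -> C) (i : nat) : (forall n, f n = g n) -> zpair f i = zpair g i.
Proof. intros H. destruct i; simpl; now rewrite !H. Qed.

Lemma zpair_plus (f g : Z -> C) (i : nat) :
  zpair (fun n => f n + g n) i = zpair f i + zpair g i.
Proof. destruct i; simpl; ring. Qed.

Lemma zpair_scal (c : C) (f : Z -> C) (i : nat) :
  zpair (fun n => c * f n) i = c * zpair f i.
Proof. destruct i; simpl; ring. Qed.

Lemma zpair_norm (f : Z -> C) (u : Z -> R) (i : nat) :
  (forall n, Cmod (f n) <= u n)%R -> (Cmod (zpair f i) <= rpair u i)%R.
Proof.
  intros H. destruct i; simpl; auto.
  eapply Rle_trans; [apply Cmod_triangle|]. apply Rplus_le_compat; auto.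
Qed.

Lemma rpair_le (f g : Z -> R) (i : nat) :
  (forall n, f n <= g n)%R -> (rpair f i <= rpair g i)%R.
Proof. intros H. destruct i; simpl; auto. apply Rplus_le_compat; auto. Qed.

Lemma rpair_scal (c : R) (f : Z -> R) (i : nat) :
  rpair (fun n => c * f n)%R i = (c * rpair f i)%R.
Proof. destruct i; simpl; ring. Qed.

Lemma zsum_telescope (G : Z -> C) (N : nat) :
  csum (zpair (fun n => G n - G (n - 1)%Z)) (S N) = G (Z.of_nat N) - G (- Z.of_nat N - 1)%Z.
Proof.
  induction N. simpl. ring.
  change (csum (zpair (fun n => G n - G (n - 1)%Z)) (S (S N)))
    with (csum (zpair (fun n => G n - G (n - 1)%Z)) (S N)
          + (G (Z.of_nat (S N)) - G (Z.of_nat (S N) - 1)%Z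
             + (G (- Z.of_nat (S N))%Z - G (- Z.of_nat (S N) - 1)%Z))).
  rewrite IHN. replace (Z.of_nat (S N) - 1)%Z with (Z.of_nat N) by lia.
  replace (- Z.of_nat (S N))%Z with (- Z.of_nat N - 1)%Z by lia. ring.
Qed.

Lemma rsum_zpair_telescope (G : Z -> R) (N : nat) :
  rsum (rpair (fun n => G n - G (n - 1)%Z)%R) (S N)
  = (G (Z.of_nat N) - G (- Z.of_nat N - 1)%Z)%R.
Proof.
  induction N. simpl. ring.
  change (rsum (rpair (fun n => G n - G (n - 1)%Z)%R) (S (S N)))
    with (rsum (rpair (fun n => G n - G (n - 1)%Z)%R) (S N)
          + (G (Z.of_nat (S N)) - G (Z.of_nat (S N) - 1)%Z
             + (G (- Z.of_nat (S N))%Z - G (- Z.of_nat (S N) - 1)%Z)))%R.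
  rewrite IHN. replace (Z.of_nat (S N) - 1)%Z with (Z.of_nat N) by lia.
  replace (- Z.of_nat (S N))%Z with (- Z.of_nat N - 1)%Z by lia. ring.
Qed.

Lemma im_le_Cmod (z : C) : (Im z <= Cmod z)%R.
Proof.
  apply Rle_trans with (Rmax (Rabs (fst z)) (Rabs (snd z))); [|apply Rmax_Cmod].
  apply Rle_trans with (2 := Rmax_r _ _). apply Rle_abs.
Qed.

Lemma lattice_lower_bound (z : C) (y B m n : R) :
  (0 < y <= Im z)%R -> (Cmod z <= B)%R ->
  ((Rabs m + Rabs n) * y <= Cmod (RtoC m * z + RtoC n) * (1 + y + B))%R.
Proof.
  intros Hy HB. set (w := RtoC m * z + RtoC n).
  assert (H1 : (Rabs m * y <= Cmod w)%R).
  { apply Rle_trans with (Rabs (Im w)).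
    - unfold w; simpl. replace (m * snd z + 0 * fst z + 0)%R with (m * Im z)%R by (unfold Im; ring).
      rewrite Rabs_mult. apply Rmult_le_compat_l. apply Rabs_pos.
      rewrite Rabs_pos_eq; lra.
    - apply Rle_trans with (2 := Rmax_Cmod w). apply Rmax_r. }
  assert (H2 : (Rabs n <= Cmod w + Rabs m * B)%R).
  { rewrite <- Cmod_R. replace (RtoC n) with (w + - (RtoC m * z)) by (unfold w; ring).
    eapply Rle_trans; [apply Cmod_triangle|]. rewrite Cmod_opp, Cmod_mult, Cmod_R.
    pose proof (Rabs_pos m). nra. }
  pose proof (Rabs_pos m). pose proof (Cmod_ge_0 z). nra.
Qed.

Lemma upper_half_neq_0 (z : C) (n : R) : (0 < Im z)%R -> z + RtoC n <> 0.
Proof. intros Hz E. apply (f_equal Im) in E. simpl in E. unfold Im in *. lra. Qed.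

Lemma upper_half_Cmod_pos (z : C) (n : R) : (0 < Im z)%R -> (Im z <= Cmod (z + RtoC n))%R.
Proof.
  intros Hz. replace (Im z) with (Im (z + RtoC n)) by (simpl; unfold Im; ring).
  apply im_le_Cmod.
Qed.

(** Since Cmod (z + t) >= y0, a real shift by at most 1 costs at most Cmod (z + t) / y0. *)
Lemma Cmod_nearby (z : C) (y0 s t : R) :
  (0 < y0 <= Im z)%R -> (Rabs (t - s) <= 1)%R ->
  (Cmod (z + RtoC s) <= (1 + / y0) * Cmod (z + RtoC t))%R.
Proof.
  intros Hy Hst. replace (z + RtoC s) with (z + RtoC t + - RtoC (t - s))
    by (rewrite RtoC_minus; ring).
  eapply Rle_trans; [apply Cmod_triangle|]. rewrite Cmod_opp, Cmod_R.
  pose proof (upper_half_Cmod_pos z t ltac:(lra)).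
  assert (1 <= / y0 * Cmod (z + RtoC t))%R.
  { apply Rmult_le_reg_l with y0; [lra|].
    replace (y0 * (/ y0 * Cmod (z + RtoC t)))%R with (Cmod (z + RtoC t)) by (field; lra). lra. }
  lra.
Qed.

(** Comparison with the integral of 1/|z + t|^2 over the real line, which is PI / Im z by the
    arctangent [h]; the factor (1 + / y0)^2 pays for moving t to a neighbouring integer. What
    matters is the decay in Im z. *)
Lemma inv_square_sum (z : C) (y0 : R) (N : nat) :
  (0 < y0 <= Im z)%R ->
  (rsum (rpair (fun n => / Cmod (z + RtoC (IZR n)) ^ 2)%R) N
   <= (1 + / y0) ^ 2 * PI / Im z)%R.
Proof.
  intros Hy. set (q := (1 + / y0)%R).
  assert (Hq : (1 < q)%R) by (unfold q; pose proof (Rinv_0_lt_compat y0 ltac:(lra)); lra).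
  assert (Hpos : forall n, (0 < Cmod (z + RtoC n))%R).
  { intros n. pose proof (upper_half_Cmod_pos z n ltac:(lra)). lra. }
  set (h := fun n : Z => atan ((Re z + IZR n) / Im z)).
  assert (K : forall n, (/ Cmod (z + RtoC (IZR n)) ^ 2 <= q ^ 2 / Im z * (h n - h (n - 1)%Z))%R).
  { intros n. unfold h. rewrite minus_IZR.
    destruct (MVT_gen (fun t => atan ((Re z + t) / Im z)) (IZR n - 1) (IZR n)
               (fun t => (Im z / Cmod (z + RtoC t) ^ 2)%R)) as [c [Hc E]].
    - intros x _. auto_derive. lra. rewrite Cmod2_alt. simpl. unfold Re, Im in *. unfold Rsqr. field.

      assert (0 < snd z * snd z)%R by nra. pose proof (Rle_0_sqr (fst z + x)) as Hs. unfold Rsqr in Hs.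
      split; lra.
    - intros x _. apply continuity_pt_filterlim.
      apply (ex_derive_continuous (fun t => atan ((Re z + t) / Im z))). auto_derive. lra.
    - rewrite Rmin_left, Rmax_right in Hc by lra. rewrite E.
      replace (q ^ 2 / Im z * (Im z / Cmod (z + RtoC c) ^ 2 * (IZR n - (IZR n - 1))))%R
        with (q ^ 2 * / Cmod (z + RtoC c) ^ 2)%R.
      2:{ field. split. pose proof (Hpos c); lra. lra. }
      assert (Hn : (Cmod (z + RtoC c) <= q * Cmod (z + RtoC (IZR n)))%R).
      { apply Cmod_nearby; auto. apply Rabs_le. lra. }
      assert (Hn' : (Cmod (z + RtoC c) ^ 2 <= q ^ 2 * Cmod (z + RtoC (IZR n)) ^ 2)%R).
      { rewrite <- Rpow_mult_distr. apply pow_incr. pose proof (Hpos c). lra. }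
      pose proof (pow_lt _ 2 (Hpos c)) as P1. pose proof (pow_lt _ 2 (Hpos (IZR n))) as P2.
      apply Rmult_le_reg_r with (Cmod (z + RtoC c) ^ 2)%R; auto.
      apply Rmult_le_reg_l with (Cmod (z + RtoC (IZR n)) ^ 2)%R; auto.
      rewrite <- Rmult_assoc, Rinv_r, Rmult_1_l by lra.
      rewrite (Rmult_assoc (q ^ 2)), Rinv_l, Rmult_1_r by lra. lra. }
  assert (H0 : forall n : Z, (0 <= / Cmod (z + RtoC (IZR n)) ^ 2)%R).
  { intros n. left. apply Rinv_0_lt_compat, pow_lt, Hpos. }
  apply Rle_trans with (rsum (rpair (fun n => / Cmod (z + RtoC (IZR n)) ^ 2)%R) (S N)).
  { apply rsum_mono; auto. intros [|i]; cbn [rpair]; auto. apply Rplus_le_le_0_compat; apply H0. }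
  apply Rle_trans with (rsum (fun i => q ^ 2 / Im z * rpair (fun n => h n - h (n - 1)%Z)%R i)%R (S N)).
  { apply rsum_le. intros i _. rewrite <- rpair_scal. now apply rpair_le. }
  rewrite rsum_scal, rsum_zpair_telescope.
  assert (A1 : (h (Z.of_nat N) - h (- Z.of_nat N - 1)%Z <= PI)%R).
  { unfold h. pose proof (atan_bound ((Re z + IZR (Z.of_nat N)) / Im z)).
    pose proof (atan_bound ((Re z + IZR (- Z.of_nat N - 1)) / Im z)). lra. }
  replace (q ^ 2 * PI / Im z)%R with (q ^ 2 / Im z * PI)%R by (field; lra).
  apply Rmult_le_compat_l; auto. apply Rmult_le_pos. apply pow_le; lra.
  left; apply Rinv_0_lt_compat; lra.
Qed.

Lemma inv_INR_lim : is_lim_seq (fun n => / INR (S n))%R 0%R.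
Proof.
  apply is_lim_seq_ext with (fun n => Rpower (INR (S n)) (- (1))).
  - intros n. rewrite Rpower_Ropp, Rpower_1; auto. apply lt_0_INR; lia.
  - apply Rpower_lim_0. lra.
Qed.

Lemma INR_le_Rabs_of_nat (N : nat) : (INR N <= Rabs (IZR (Z.of_nat N)))%R.
Proof. rewrite <- INR_IZR_INZ. apply Rle_abs. Qed.

Lemma INR_le_Rabs_opp (N : nat) : (INR N <= Rabs (IZR (- Z.of_nat N - 1)))%R.
Proof. rewrite <- abs_IZR, INR_IZR_INZ. apply IZR_le. lia. Qed.

(** The index i is only a lower bound for |n|, so that one statement serves both ends N and -N-1 of
    a symmetric sum. *)
Lemma inv_lattice_bound (z : C) :
  (0 < Im z)%R -> exists K, (0 < K)%R /\ forall (n : Z) (i : nat),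
    (INR i <= Rabs (IZR n))%R -> (/ Cmod (z + RtoC (IZR n)) <= K * / INR (S i))%R.
Proof.
  intros Hz. pose proof (Cmod_ge_0 z).
  exists ((1 + Im z + Cmod z) / Im z)%R. split. apply Rdiv_lt_0_compat; lra.
  intros n i Hi.
  pose proof (lattice_lower_bound z (Im z) (Cmod z) 1 (IZR n) ltac:(lra) ltac:(lra)) as L.
  replace (RtoC 1 * z) with z in L by ring. rewrite Rabs_R1 in L.
  pose proof (upper_half_Cmod_pos z (IZR n) Hz) as P.
  assert (P1 : (0 < INR (S i))%R) by (apply lt_0_INR; lia).
  rewrite S_INR in *.
  apply Rmult_le_reg_r with (Cmod (z + RtoC (IZR n))); [lra|].
  rewrite Rinv_l by lra.
  replace ((1 + Im z + Cmod z) / Im z * / (INR i + 1) * Cmod (z + RtoC (IZR n)))%R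
    with ((Cmod (z + RtoC (IZR n)) * (1 + Im z + Cmod z)) / (Im z * (INR i + 1)))%R
    by (field; lra).
  apply Rmult_le_reg_r with (Im z * (INR i + 1))%R. nra.
  unfold Rdiv. rewrite Rmult_assoc, Rinv_l by nra. nra.
Qed.

Lemma inv_pow_lattice_bound (z : C) (j : nat) :
  (0 < Im z)%R -> exists K, (0 < K)%R /\ forall (n : Z) (i : nat),
    (INR i <= Rabs (IZR n))%R ->
    (Cmod (/ (z + RtoC (IZR n)) ^ S j) <= K * / INR (S i))%R.
Proof.
  intros Hz. destruct (inv_lattice_bound z Hz) as [K [HK LK]].
  assert (Pj : (0 < / Im z ^ j)%R) by (apply Rinv_0_lt_compat, pow_lt; auto).
  exists (/ Im z ^ j * K)%R. split. now apply Rmult_lt_0_compat.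
  intros n i Hi. pose proof (upper_half_Cmod_pos z (IZR n) Hz).
  rewrite Cmod_inv, Cmod_pow by (apply Cpow_nz, upper_half_neq_0; auto).
  simpl pow. rewrite Rinv_mult, Rmult_comm, Rmult_assoc. apply Rmult_le_compat.
  - left; apply Rinv_0_lt_compat, pow_lt; lra.
  - left; apply Rinv_0_lt_compat; lra.
  - apply Rinv_le_contravar. now apply pow_lt. apply pow_incr; lra.
  - now apply LK.
Qed.

Lemma Cder_inv_pow (z : C) (j : nat) (t : R) :
  (0 < Im z)%R ->
  Cder (fun t => / (z + RtoC t) ^ S j) t
    (- RtoC (INR (S j)) / (z + RtoC t) ^ S (S j)).
Proof.
  intros Hz. pose proof (upper_half_neq_0 z t Hz) as N.
  apply Cder_eq with (- (RtoC (INR (S j)) * (0 + 1) * (z + RtoC t) ^ j)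
                      / ((z + RtoC t) ^ S j * (z + RtoC t) ^ S j)).
  - apply (Cder_inv (fun t => (z + RtoC t) ^ S j)). now apply Cpow_nz.
    apply (Cder_pow (fun t => z + RtoC t)). apply Cder_plus. apply Cder_const. apply Cder_id.
  - simpl. field. split; auto. now apply Cpow_nz.
Qed.

(* [F] is an antiderivative of [t -> 1 / (z + t)^j] on the real line; [F] gives
   the mean part of [psi] by comparing the sum with the integral, [Psi] gives the
   oscillating part by summation by parts. *)
Lemma zsum_inv_pow (psi Psi : Z -> C) (mu z L : C) (B y0 : R) (j : nat) (F : R -> C) :
  (0 < y0 <= Im z)%R ->
  (forall n, psi n = mu + (Psi (n + 1)%Z - Psi n)) ->
  (forall n, Cmod (Psi n) <= B)%R ->
  (forall t, Cder F t (/ (z + RtoC t) ^ S j)) ->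
  Clim (fun N => F (IZR (Z.of_nat N)) - F (IZR (- Z.of_nat N - 1))) L ->
  exists S, Csum (zpair (fun n => psi n / (z + RtoC (IZR n)) ^ Datatypes.S j)) S
    /\ (Cmod (S - mu * L)
        <= (Cmod mu + B) * (INR (Datatypes.S j) * (1 + / y0) ^ Datatypes.S (Datatypes.S j)
             * ((1 + / y0) ^ 2 * PI)) / Im z ^ Datatypes.S j)%R.
Proof.
  intros Hy Hpsi HB HF HL.
  assert (Hz : (0 < Im z)%R) by lra.
  set (q := (1 + / y0)%R).
  assert (Hq : (1 < q)%R) by (unfold q; pose proof (Rinv_0_lt_compat y0 ltac:(lra)); lra).
  assert (Hpos : forall n, (0 < Cmod (z + RtoC n))%R).
  { intros n. pose proof (upper_half_Cmod_pos z n Hz). lra. }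
  set (f := fun t => / (z + RtoC t) ^ S j).
  set (f1 := fun t => - RtoC (INR (S j)) / (z + RtoC t) ^ S (S j)).
  (* Of the j + 2 powers in the denominator of [f1], j are estimated by Im z and two are left for
     [inv_square_sum]; the power of q moves t to n. *)
  set (c0 := (INR (S j) * q ^ S (S j) / Im z ^ j)%R).
  assert (Hc0 : (0 <= c0)%R).
  { unfold c0. apply Rmult_le_pos. apply Rmult_le_pos. apply pos_INR. apply pow_le; lra.
    left; apply Rinv_0_lt_compat, pow_lt; auto. }
  set (K := fun n : Z => (c0 * / Cmod (z + RtoC (IZR n)) ^ 2)%R).
  assert (HK : forall n t, (IZR n - 1 <= t <= IZR n)%R -> (Cmod (f1 t) <= K n)%R).
  { intros n t Ht. unfold f1, K, c0. unfold Cdiv.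
    rewrite Cmod_mult, Cmod_opp, Cmod_R, Rabs_pos_eq, Cmod_inv, Cmod_pow
      by (auto using pos_INR; apply Cpow_nz, upper_half_neq_0; auto).
    assert (N1 : (Cmod (z + RtoC (IZR n)) <= q * Cmod (z + RtoC t))%R).
    { apply Cmod_nearby; auto. apply Rabs_le. lra. }
    pose proof (upper_half_Cmod_pos z (IZR n) Hz) as N2.
    unfold Rdiv. rewrite !Rmult_assoc. apply Rmult_le_compat_l. apply pos_INR.
    set (a := Cmod (z + RtoC (IZR n))) in *. set (b := Cmod (z + RtoC t)) in *.
    assert (Hb : (0 < b)%R) by apply Hpos. assert (Ha : (0 < a)%R) by apply Hpos.
    assert (N3 : (Im z ^ j * a ^ 2 <= q ^ S (S j) * b ^ S (S j))%R).
    { rewrite <- Rpow_mult_distr. apply Rle_trans with (a ^ S (S j))%R.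
      - replace (a ^ S (S j))%R with (a ^ j * a ^ 2)%R by (simpl; ring).
        apply Rmult_le_compat_r. apply pow_le; lra. apply pow_incr; lra.
      - apply pow_incr. lra. }
    pose proof (pow_lt _ (S (S j)) Hb). pose proof (pow_lt _ 2 Ha). pose proof (pow_lt _ j Hz).
    rewrite <- Rinv_mult.
    apply Rmult_le_reg_r with (b ^ S (S j))%R; auto. rewrite Rinv_l by lra.
    apply Rmult_le_reg_r with (Im z ^ j * a ^ 2)%R. now apply Rmult_lt_0_compat.
    rewrite Rmult_1_l.
    replace (q ^ S (S j) * / (Im z ^ j * a ^ 2) * b ^ S (S j) * (Im z ^ j * a ^ 2))%R
      with (q ^ S (S j) * b ^ S (S j))%R by (field; split; lra). lra. }
  assert (Df : forall t, Cder f t (f1 t)) by (intros t; now apply Cder_inv_pow).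
  set (d := fun n : Z => f (IZR n) - f (IZR n - 1)%R).
  set (e := fun n : Z => F (IZR n) - F (IZR n - 1)%R - f (IZR n)).
  assert (Hd : forall n, (Cmod (d n) <= K n)%R).
  { intros n. replace (K n) with (K n * (IZR n - (IZR n - 1)))%R by ring.
    apply (Cder_diff_le f f1); auto; lra. }
  assert (He : forall n, (Cmod (e n) <= K n)%R).
  { intros n. replace (K n) with (K n * (IZR n - (IZR n - 1)) ^ 2)%R by ring.
    unfold e. replace (f (IZR n)) with (RtoC (IZR n - (IZR n - 1)) * f (IZR n)).
    - apply (Cder_taylor_end F f f1); auto; lra.
    - replace (IZR n - (IZR n - 1))%R with 1%R by ring. ring. }
  set (r := fun n : Z => - (mu * e n + Psi n * d n)).
  assert (B0 : (0 <= B)%R) by (apply Rle_trans with (2 := HB 0%Z); apply Cmod_ge_0).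
  assert (Hr : forall n, (Cmod (r n) <= (Cmod mu + B) * K n)%R).
  { intros n. unfold r. rewrite Cmod_opp. eapply Rle_trans; [apply Cmod_triangle|].
    rewrite !Cmod_mult. pose proof (Hd n). pose proof (He n). pose proof (HB n).
    pose proof (Cmod_ge_0 mu). pose proof (Cmod_ge_0 (d n)). pose proof (Cmod_ge_0 (e n)).
    pose proof (Cmod_ge_0 (Psi n)). nra. }
  set (u := rpair (fun n => (Cmod mu + B) * K n)%R).
  assert (Hu0 : forall i, (0 <= u i)%R).
  { assert (P : forall n, (0 <= (Cmod mu + B) * K n)%R).
    { intros n. apply Rle_trans with (2 := Hr n). apply Cmod_ge_0. }
    intros [|i]; simpl; auto. apply Rplus_le_le_0_compat; auto. }
  assert (Hu : forall N, (rsum u N <= (Cmod mu + B) * (INR (S j) * q ^ S (S j) * (q ^ 2 * PI))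
                          / Im z ^ S j)%R).
  { intros N. apply Rle_trans with
      (rsum (fun i => (Cmod mu + B) * c0 * rpair (fun n => / Cmod (z + RtoC (IZR n)) ^ 2)%R i)%R N).
    - apply rsum_le. intros i _. unfold u. rewrite <- rpair_scal. apply rpair_le.
      intros n. unfold K. rewrite Rmult_assoc. lra.
    - rewrite rsum_scal. pose proof (inv_square_sum z y0 N Hy) as S2. fold q in S2.
      replace ((Cmod mu + B) * (INR (S j) * q ^ S (S j) * (q ^ 2 * PI)) / Im z ^ S j)%R
        with ((Cmod mu + B) * c0 * (q ^ 2 * PI / Im z))%R.
      + apply Rmult_le_compat_l; auto. pose proof (Cmod_ge_0 mu).
        apply Rmult_le_pos; auto. lra.
      + unfold c0. simpl. field. split. apply pow_nonzero; lra. lra. }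
  pose proof (rsum_bounded_ex_series u _ Hu0 Hu) as Eu.
  destruct (Csum_exists (zpair r) u) as [S HS]; auto.
  { intros i. now apply zpair_norm. }
  exists (mu * L + S). split.
  - set (W := fun n : Z => mu * F (IZR n) + Psi (n + 1)%Z * f (IZR n)).
    apply Csum_ext with (fun i => zpair (fun n => W n - W (n - 1)%Z) i + zpair r i).
    { intros i. rewrite <- zpair_plus. apply zpair_ext. intros n.
      unfold W, r, e, d. rewrite Hpsi, minus_IZR. replace (n - 1 + 1)%Z with n by lia.
      unfold Cdiv. fold (f (IZR n)). ring. }
    apply Csum_plus; auto.
    unfold Csum. apply Clim_incr_1.
    apply Clim_ext with (fun N => W (Z.of_nat N) - W (- Z.of_nat N - 1)%Z).
    { intros N. now rewrite zsum_telescope. }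
    destruct (inv_pow_lattice_bound z j Hz) as [K1 [HK1 Lf]].
    apply Clim_close with
      (fun N => mu * (F (IZR (Z.of_nat N)) - F (IZR (- Z.of_nat N - 1))))
      (fun N => B * K1 * 2 * / INR (Datatypes.S N))%R.
    + now apply Clim_scal.
    + intros N. unfold W.
      match goal with |- (Cmod ?x <= _)%R => replace x with
        (Psi (Z.of_nat N + 1)%Z * f (IZR (Z.of_nat N))
         + - (Psi (- Z.of_nat N - 1 + 1)%Z * f (IZR (- Z.of_nat N - 1)))) by ring end.
      eapply Rle_trans; [apply Cmod_triangle|]. rewrite Cmod_opp, !Cmod_mult.
      pose proof (Lf _ _ (INR_le_Rabs_of_nat N)) as L1.
      pose proof (Lf _ _ (INR_le_Rabs_opp N)) as L2.
      set (M := (K1 * / INR (Datatypes.S N))%R) in *.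
      replace (B * K1 * 2 * / INR (Datatypes.S N))%R with (B * M + B * M)%R
        by (unfold M; ring).
      apply Rplus_le_compat; apply Rmult_le_compat; auto using Cmod_ge_0.
    + replace (Finite 0) with (Rbar_mult (B * K1 * 2)%R 0%R)
        by (simpl; f_equal; ring).
      apply is_lim_seq_scal_l. apply inv_INR_lim.
  - replace (mu * L + S - mu * L) with S by ring. fold q.
    apply Rle_trans with (Series u).
    + apply Csum_norm_le with (zpair r); auto. intros i. now apply zpair_norm.
    + now apply Series_le_bound.
Qed.

Lemma atan_lim (x y : R) :
  (0 < y)%R -> is_lim_seq (fun N => atan ((x + INR N) / y)) (PI / 2)%R.
Proof.
  intros Hy.
  assert (I : is_lim_seq (fun N => y * / (x + INR N))%R 0%R).
  { replace (Finite 0) with (Rbar_mult y (Rbar_inv p_infty)) by (simpl; f_equal; ring).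
    apply is_lim_seq_scal_l. apply is_lim_seq_inv; [|discriminate].
    apply is_lim_seq_plus with x p_infty. apply is_lim_seq_const. apply is_lim_seq_INR.
    reflexivity. }
  destruct (INR_unbounded (- x)) as [N0 HN0].
  apply is_lim_seq_ext_loc with (fun N => PI / 2 - atan (y * / (x + INR N)))%R.
  - exists N0. intros n Hn. apply le_INR in Hn. rewrite <- atan_inv.
    + f_equal. field. lra.
    + apply Rmult_lt_0_compat; auto. apply Rinv_0_lt_compat. lra.
  - replace (Finite (PI / 2)) with (Finite (PI / 2 - 0)) by (f_equal; ring).
    apply is_lim_seq_minus'. apply is_lim_seq_const.
    rewrite <- atan_0. apply is_lim_seq_continuous; auto.
    apply continuity_pt_filterlim. apply (ex_derive_continuous atan). auto_derive. auto.
Qed.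

Lemma ln_diff_le (u v : R) : (0 < u)%R -> (0 < v)%R -> (ln u - ln v <= (u - v) / v)%R.
Proof.
  intros Hu Hv. rewrite <- ln_div by auto.
  pose proof (exp_ineq1_le (ln (u / v))) as H.
  rewrite exp_ln in H by now apply Rdiv_lt_0_compat.
  replace ((u - v) / v)%R with (u / v - 1)%R by (field; lra). lra.
Qed.

(** The antiderivative is log (z + t) up to a constant: ln |z + t| - i atan ((Re z + t) / Im z).
    Between -N-1 and N the logarithms of the moduli cancel in the limit while the arctangent grows
    by PI, whence -PI i. *)
Lemma zsum_inv (psi Psi : Z -> C) (mu z : C) (B y0 : R) :
  (0 < y0 <= Im z)%R ->
  (forall n, psi n = mu + (Psi (n + 1)%Z - Psi n)) ->
  (forall n, Cmod (Psi n) <= B)%R ->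
  exists S, Csum (zpair (fun n => psi n / (z + RtoC (IZR n)) ^ 1)) S
    /\ (Cmod (S - mu * (- (RtoC PI * Ci)))
        <= (Cmod mu + B) * (INR 1 * (1 + / y0) ^ 2 * ((1 + / y0) ^ 2 * PI)) / Im z ^ 1)%R.
Proof.
  intros Hy Hpsi HB. assert (Hz : (0 < Im z)%R) by lra.
  set (l := fun t => (/ 2 * ln ((Re z + t) ^ 2 + Im z ^ 2))%R).
  set (h := fun t => atan ((Re z + t) / Im z)).
  assert (Pq : forall t, (0 < (Re z + t) ^ 2 + Im z ^ 2)%R).
  { intros t. pose proof (pow2_ge_0 (Re z + t)). pose proof (pow_lt _ 2 Hz). lra. }
  apply (zsum_inv_pow psi Psi mu z _ B y0 0 (fun t => (l t, (- h t)%R))); auto.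
  - intros t.
    pose proof (Pq t) as P.
    split; simpl; unfold l, h; auto_derive; unfold Re, Im in *; simpl in *;
      try lra; unfold Rsqr; field; repeat split; nra.
  - destruct (inv_lattice_bound z Hz) as [K [HK LK]].
    (* The squared moduli u and v at the two ends differ by (2 Re z - 1) (2 N + 1) only, while each
       is at least (N+1)^2 / K^2; [c] collects these factors. *)
    set (c := (Rabs (2 * Re z - 1) * 2 * K ^ 2)%R).
    apply Clim_bound with (fun N => c * / INR (S N)
       + (Rabs (PI / 2 - h (INR N)) + Rabs (PI / 2 - atan ((- Re z + INR (S N)) / Im z))))%R.
    + intros N.
      assert (E2 : h (IZR (- Z.of_nat N - 1)) = (- atan ((- Re z + INR (S N)) / Im z))%R).
      { unfold h. rewrite <- atan_opp. f_equal.
        rewrite S_INR, INR_IZR_INZ, minus_IZR, opp_IZR. field. lra. }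
      rewrite <- INR_IZR_INZ.
      replace (_ - _ - - (RtoC PI * Ci))
        with (RtoC (l (INR N) - l (IZR (- Z.of_nat N - 1)))
              + Ci * RtoC (PI / 2 - h (INR N) + (PI / 2 - atan ((- Re z + INR (S N)) / Im z)))).
      2:{ rewrite E2. apply injective_projections; simpl; field. }
      eapply Rle_trans; [apply Cmod_triangle|].
      rewrite Cmod_mult, Cmod_Ci, Rmult_1_l, !Cmod_R.
      apply Rplus_le_compat; [|apply Rabs_triang].
      set (u := ((Re z + INR N) ^ 2 + Im z ^ 2)%R).
      set (v := ((Re z + IZR (- Z.of_nat N - 1)) ^ 2 + Im z ^ 2)%R).
      assert (Eu : u = (Cmod (z + RtoC (IZR (Z.of_nat N))) ^ 2)%R).
      { rewrite Cmod2_alt, <- INR_IZR_INZ. unfold u; simpl; unfold Re, Im; ring. }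
      assert (Ev : v = (Cmod (z + RtoC (IZR (- Z.of_nat N - 1))) ^ 2)%R).
      { rewrite Cmod2_alt. unfold v; simpl; unfold Re, Im; ring. }
      pose proof (LK _ _ (INR_le_Rabs_of_nat N)) as L1.
      pose proof (LK _ _ (INR_le_Rabs_opp N)) as L2.
      assert (Pu : (0 < u)%R) by apply Pq. assert (Pv : (0 < v)%R) by apply Pq.
      assert (Q : forall a, (0 < Cmod a)%R -> (/ Cmod a <= K * / INR (S N))%R ->
                   (/ (Cmod a ^ 2) <= K ^ 2 * / INR (S N) ^ 2)%R).
      { intros a Pa Ha. rewrite <- !pow_inv, <- Rpow_mult_distr. apply pow_incr.
        split; auto. left; now apply Rinv_0_lt_compat. }
      assert (Iu : (/ u <= K ^ 2 * / INR (S N) ^ 2)%R).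
      { rewrite Eu. apply Q; auto. pose proof (upper_half_Cmod_pos z (IZR (Z.of_nat N)) Hz). lra. }
      assert (Iv : (/ v <= K ^ 2 * / INR (S N) ^ 2)%R).
      { rewrite Ev. apply Q; auto.
        pose proof (upper_half_Cmod_pos z (IZR (- Z.of_nat N - 1)) Hz). lra. }
      assert (PN : (0 < INR (S N))%R) by (apply lt_0_INR; lia).
      assert (Duv : (Rabs (u - v) <= Rabs (2 * Re z - 1) * (2 * INR (S N)))%R).
      { replace (u - v)%R with ((2 * Re z - 1) * (2 * INR N + 1))%R.
        - rewrite Rabs_mult. apply Rmult_le_compat_l. apply Rabs_pos.
          rewrite Rabs_pos_eq. rewrite S_INR; lra. pose proof (pos_INR N); lra.
        - unfold u, v. rewrite minus_IZR, opp_IZR, <- INR_IZR_INZ. ring. }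
      unfold l. fold u v.
      replace (/ 2 * ln u - / 2 * ln v)%R with (/ 2 * (ln u - ln v))%R by ring.
      rewrite Rabs_mult, (Rabs_pos_eq (/ 2)) by lra.
      assert (D : (Rabs (ln u - ln v) <= c * / INR (S N))%R).
      { assert (T : forall w, (0 < w)%R -> (/ w <= K ^ 2 * / INR (S N) ^ 2)%R ->
                  (Rabs (u - v) / w <= c * / INR (S N))%R).
        { intros w Pw Iw. unfold Rdiv, c.
          apply Rle_trans with
            (Rabs (2 * Re z - 1) * (2 * INR (S N)) * (K ^ 2 * / INR (S N) ^ 2))%R.
          - apply Rmult_le_compat; auto. apply Rabs_pos. left; now apply Rinv_0_lt_compat.
          - right. field. lra. }
        pose proof (ln_diff_le u v Pu Pv). pose proof (ln_diff_le v u Pv Pu).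
        pose proof (T u Pu Iu). pose proof (T v Pv Iv).
        assert (forall w, (0 < w)%R -> ((u - v) / w <= Rabs (u - v) / w)%R).
        { intros w Pw. apply Rmult_le_compat_r. left; now apply Rinv_0_lt_compat. apply Rle_abs. }
        assert (forall w, (0 < w)%R -> ((v - u) / w <= Rabs (u - v) / w)%R).
        { intros w Pw. apply Rmult_le_compat_r. left; now apply Rinv_0_lt_compat.
          rewrite Rabs_minus_sym. apply Rle_abs. }
        pose proof (H3 v Pv). pose proof (H4 u Pu). apply Rabs_le. lra. }
      pose proof (Rabs_pos (ln u - ln v)). lra.
    + replace (Finite 0) with (Finite (c * 0 + (0 + 0))) by (f_equal; ring).
      apply is_lim_seq_plus'.
      * apply (is_lim_seq_scal_l _ c (Finite 0)). apply inv_INR_lim.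
      * assert (T : forall w, is_lim_seq w (PI / 2)%R ->
                    is_lim_seq (fun N => Rabs (PI / 2 - w N)) 0%R).
        { intros w Hw. rewrite <- Rabs_R0.
          replace (Rabs 0) with (Rabs (PI / 2 - PI / 2)) by (f_equal; ring).
          apply (is_lim_seq_abs _ (Finite (PI / 2 - PI / 2))).
          apply is_lim_seq_minus'; auto. apply is_lim_seq_const. }
        apply is_lim_seq_plus'; apply T.
        -- apply atan_lim; auto.
        -- apply (is_lim_seq_incr_1 (fun N => atan ((- Re z + INR N) / Im z))).
           apply atan_lim; auto.
Qed.

(** For exponents from 2 on the antiderivative is a negative power and vanishes at both ends, so the
    mean contributes nothing; [mu * 0] keeps the shape of [zsum_inv_pow]. *)
Lemma zsum_inv_pow_SS (psi Psi : Z -> C) (mu z : C) (B y0 : R) (j : nat) :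
  (0 < y0 <= Im z)%R ->
  (forall n, psi n = mu + (Psi (n + 1)%Z - Psi n)) ->
  (forall n, Cmod (Psi n) <= B)%R ->
  exists S, Csum (zpair (fun n => psi n / (z + RtoC (IZR n)) ^ Datatypes.S (Datatypes.S j))) S
    /\ (Cmod (S - mu * 0)
        <= (Cmod mu + B) * (INR (Datatypes.S (Datatypes.S j))
             * (1 + / y0) ^ Datatypes.S (Datatypes.S (Datatypes.S j))
             * ((1 + / y0) ^ 2 * PI)) / Im z ^ Datatypes.S (Datatypes.S j))%R.
Proof.
  intros Hy Hpsi HB. assert (Hz : (0 < Im z)%R) by lra.
  assert (Zj : RtoC (INR (S j)) <> 0) by (apply RtoC_neq_0, not_0_INR; lia).
  set (F := fun t => - / RtoC (INR (S j)) * / (z + RtoC t) ^ S j).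
  apply (zsum_inv_pow psi Psi mu z 0 B y0 (S j) F); auto.
  - intros t.
    apply Cder_eq with (- / RtoC (INR (S j)) * (- RtoC (INR (S j)) / (z + RtoC t) ^ S (S j))).
    + apply Cder_scal. now apply Cder_inv_pow.
    + field. split; auto. apply Cpow_nz. now apply upper_half_neq_0.
  - destruct (inv_pow_lattice_bound z j Hz) as [K [HK LK]].
    set (c := (Cmod (/ RtoC (INR (S j))) * K)%R).
    assert (LF : forall (n : Z) (i : nat), (INR i <= Rabs (IZR n))%R ->
                 (Cmod (F (IZR n)) <= c * / INR (S i))%R).
    { intros n i Hi. unfold F, c. rewrite Cmod_mult, Cmod_opp, Rmult_assoc.
      apply Rmult_le_compat_l. apply Cmod_ge_0. now apply LK. }
    apply Clim_bound with (fun N => 2 * c * / INR (S N))%R.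
    + intros N. replace (F (IZR (Z.of_nat N)) - F (IZR (- Z.of_nat N - 1)) - 0)
        with (F (IZR (Z.of_nat N)) + - F (IZR (- Z.of_nat N - 1))) by ring.
      eapply Rle_trans; [apply Cmod_triangle|]. rewrite Cmod_opp.
      pose proof (LF _ _ (INR_le_Rabs_of_nat N)) as L1.
      pose proof (LF _ _ (INR_le_Rabs_opp N)) as L2. lra.
    + replace (Finite 0) with (Rbar_mult (2 * c)%R 0%R) by (simpl; f_equal; ring).
      apply is_lim_seq_scal_l. apply inv_INR_lim.
Qed.

Definition lattice_sum (psi : Z -> C) (j : nat) (z : C) : C :=
  epsilon (inhabits (RtoC 0))
    (fun S => Csum (zpair (fun n => psi n / (z + RtoC (IZR n)) ^ j)) S).

(** The limit of [lattice_sum] for Im z tending to infinity when psi has mean mu. *)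
Definition lattice_limit (mu : C) (j : nat) : C :=
  match j with 1%nat => - (RtoC PI * Ci * mu) | _ => 0 end.

(** K is chosen before z: the rate is uniform on the half-plane Im z >= y0, hence along all
    multiples m z. *)
Lemma lattice_sum_spec (psi Psi : Z -> C) (mu : C) (y0 : R) (j : nat) :
  Z_bounded Psi -> (forall n, psi n = mu + (Psi (n + 1)%Z - Psi n)) ->
  (0 < y0)%R -> (1 <= j)%nat ->
  exists K, (0 <= K)%R /\ forall z, (y0 <= Im z)%R ->
    Csum (zpair (fun n => psi n / (z + RtoC (IZR n)) ^ j)) (lattice_sum psi j z)
    /\ (Cmod (lattice_sum psi j z - lattice_limit mu j) <= K / Im z ^ j)%R.
Proof.
  intros [B HB] Hpsi Hy Hj.
  exists ((Cmod mu + B) * (INR j * (1 + / y0) ^ S j * ((1 + / y0) ^ 2 * PI)))%R. split.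
  - assert (0 < / y0)%R by now apply Rinv_0_lt_compat.
    assert (0 <= B)%R by (apply Rle_trans with (2 := HB 0%Z); apply Cmod_ge_0).
    pose proof (Cmod_ge_0 mu). pose proof PI_RGT_0.
    assert (P : forall n, (0 <= (1 + / y0) ^ n)%R) by (intros; apply pow_le; lra).
    apply Rmult_le_pos; [lra|]. apply Rmult_le_pos; apply Rmult_le_pos; auto using pos_INR; lra.
  - intros z Hz.
    assert (H : exists S, Csum (zpair (fun n => psi n / (z + RtoC (IZR n)) ^ j)) S
      /\ (Cmod (S - lattice_limit mu j)
          <= (Cmod mu + B) * (INR j * (1 + / y0) ^ Datatypes.S j * ((1 + / y0) ^ 2 * PI))
             / Im z ^ j)%R).
    { destruct j as [|[|j]]; [lia| |].
      - destruct (zsum_inv psi Psi mu z B y0 (conj Hy Hz) Hpsi HB) as [S [HS HS']].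
        exists S. split; auto. simpl lattice_limit.
        replace (- (RtoC PI * Ci * mu)) with (mu * - (RtoC PI * Ci)) by ring. exact HS'.
      - destruct (zsum_inv_pow_SS psi Psi mu z B y0 j (conj Hy Hz) Hpsi HB) as [S [HS HS']].
        exists S. split; auto. simpl lattice_limit.
        replace (RtoC 0) with (mu * 0) by ring. exact HS'. }
    destruct H as [S [HS HS']].
    assert (HL : Csum (zpair (fun n => psi n / (z + RtoC (IZR n)) ^ j)) (lattice_sum psi j z)).
    { unfold lattice_sum. apply epsilon_spec. now exists S. }
    split; auto. now rewrite (Csum_unique _ _ _ HL HS).
Qed.

(** * Eisenstein series *)

(** The exponent 3/2 exceeds 1, so weights are summable, and a product of two weights still
    dominates terms of total degree 3 in the lattice. *)
Definition weight (i : nat) : R := Rpower (INR (S i)) (- (3 / 2)).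

Definition zweight (n : Z) : R := Rpower (1 + Rabs (IZR n)) (- (3 / 2)).

Lemma weight_pos (i : nat) : (0 <= weight i)%R.
Proof. left; apply exp_pos. Qed.

Lemma zweight_pos (n : Z) : (0 <= zweight n)%R.
Proof. left; apply exp_pos. Qed.

Lemma ex_series_weight : ex_series weight.
Proof. apply ex_series_Rpower. lra. Qed.

Lemma zweight_of_nat (i : nat) : zweight (Z.of_nat i) = weight i.
Proof.
  unfold zweight, weight. rewrite <- INR_IZR_INZ, Rabs_pos_eq, S_INR by apply pos_INR.
  f_equal; ring.
Qed.

Lemma zweight_opp (n : Z) : zweight (- n) = zweight n.
Proof. unfold zweight. now rewrite opp_IZR, Rabs_Ropp. Qed.

Lemma rpair_zweight (i : nat) : (rpair zweight i <= 2 * weight i)%R.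
Proof.
  pose proof (weight_pos i). destruct i; cbn [rpair].
  - rewrite <- (zweight_of_nat 0). simpl Z.of_nat. pose proof (zweight_pos 0). lra.
  - rewrite zweight_opp, zweight_of_nat. lra.
Qed.

(** The last two hypotheses multiply to (1 + a) (1 + b) / 4 <= (a + b)^2; raising this to the power
    -3/2 gives the claim. *)
Lemma inv_cube_le_weights (a b : R) :
  (0 <= a)%R -> (0 <= b)%R -> (1 + a <= 2 * (a + b))%R -> (1 + b <= 2 * (a + b))%R ->
  (/ (a + b) ^ 3
   <= Rpower (/ 4) (- (3 / 2)) * (Rpower (1 + a) (- (3 / 2)) * Rpower (1 + b) (- (3 / 2))))%R.
Proof.
  intros Ha Hb H1 H2. assert (P : (0 < a + b)%R) by lra.
  rewrite !Rpower_mult_distr by nra.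
  apply Rle_trans with (Rpower ((a + b) ^ 2) (- (3 / 2))).
  - right. rewrite <- (Rpower_pow 2), Rpower_mult by auto.
    replace (INR 2 * - (3 / 2))%R with (- INR 3)%R by (simpl; lra).
    now rewrite Rpower_Ropp, Rpower_pow.
  - apply Rpower_le_base; [|lra]. split; nra.
Qed.

Lemma lattice_term_bound (k : nat) (y B : R) :
  (3 <= k)%nat -> (0 < y)%R -> (0 <= B)%R ->
  exists K, (0 <= K)%R /\ forall (z : C) (m n : Z), (y <= Im z)%R -> (Cmod z <= B)%R ->
    (Cmod (/ (RtoC (IZR m) * z + RtoC (IZR n)) ^ k) <= K * (zweight m * zweight n))%R.
Proof.
  (* By [lattice_lower_bound] the modulus of m z + n is at least c (|m| + |n|). *)
  intros Hk Hy HB. set (c := (y / (1 + y + B))%R).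
  assert (Hc : (0 < c)%R) by (apply Rdiv_lt_0_compat; lra).
  assert (Hc' : (0 < c ^ k)%R) by now apply pow_lt.
  exists (/ c ^ k * Rpower (/ 4) (- (3 / 2)))%R. split.
  { apply Rmult_le_pos; left. now apply Rinv_0_lt_compat. apply exp_pos. }
  intros z m n Hz Hzb.
  destruct (classic (m = 0%Z /\ n = 0%Z)) as [[-> ->]|N].
  (* Inversion is total with / 0 = 0, so the pair (0, 0) contributes 0 and may stay in the boxes. *)
  - replace (RtoC 0 * z + RtoC 0) with (RtoC 0) by ring.
    destruct k as [|k]; [lia|]. rewrite Cpow_S.
    replace (0 * 0 ^ k) with (RtoC 0) by ring.
    replace (/ RtoC 0) with (RtoC 0).
    2:{ apply injective_projections; simpl; unfold Rdiv; ring. }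
    rewrite Cmod_0. apply Rmult_le_pos; [|apply Rmult_le_pos; apply zweight_pos].
    apply Rmult_le_pos; left. now apply Rinv_0_lt_compat. apply exp_pos.
  - set (a := Rabs (IZR m)). set (b := Rabs (IZR n)).
    assert (Ha : (0 <= a)%R) by apply Rabs_pos. assert (Hb : (0 <= b)%R) by apply Rabs_pos.
    assert (Hab : (1 + a <= 2 * (a + b))%R /\ (1 + b <= 2 * (a + b))%R /\ (1 <= a + b)%R).
    { assert (Z1 : forall p : Z, p = 0%Z \/ (1 <= Rabs (IZR p))%R).
      { intros p. destruct (Z.eq_dec p 0); auto. right. rewrite <- abs_IZR. apply IZR_le. lia. }
      destruct (Z1 m) as [E|E]; destruct (Z1 n) as [E'|E'].
      - tauto.
      - unfold a, b in *; rewrite E, Rabs_R0; lra.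
      - unfold a, b in *; rewrite E', Rabs_R0; lra.
      - unfold a, b in *; lra. }
    destruct Hab as [H1 [H2 H3]].
    pose proof (lattice_lower_bound z y B (IZR m) (IZR n) ltac:(lra) Hzb) as L.
    fold a b in L. set (w := RtoC (IZR m) * z + RtoC (IZR n)) in *.
    assert (Lw : (c * (a + b) <= Cmod w)%R).
    { unfold c. apply Rmult_le_reg_r with (1 + y + B)%R; [lra|].
      replace (y / (1 + y + B) * (a + b) * (1 + y + B))%R with ((a + b) * y)%R by (field; lra).
      lra. }
    assert (P1 : (0 < c * (a + b))%R) by nra.
    assert (Zw : w <> 0) by (apply Cmod_gt_0; lra).
    rewrite Cmod_inv, Cmod_pow by now apply Cpow_nz.
    apply Rle_trans with (/ (c * (a + b)) ^ k)%R.
    { apply Rinv_le_contravar. now apply pow_lt. apply pow_incr. lra. }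
    rewrite Rpow_mult_distr, Rinv_mult, Rmult_assoc.
    apply Rmult_le_compat_l. left; now apply Rinv_0_lt_compat.
    apply Rle_trans with (/ (a + b) ^ 3)%R.
    { apply Rinv_le_contravar. apply pow_lt; lra. apply Rle_pow; auto. }
    now apply inv_cube_le_weights.
Qed.

Definition box_sum (f : Z * Z -> C) (N : nat) : C :=
  csum (zpair (fun m => csum (zpair (fun n => f (m, n))) N)) N.

Fixpoint zlist (N : nat) : list Z :=
  match N with
  | O => nil
  | S i => match i with O => (0 :: nil)%Z | S _ => (Z.of_nat i :: - Z.of_nat i :: zlist i)%Z end
  end.

Lemma zlist_In (N : nat) (n : Z) : In n (zlist N) <-> (Z.abs n < Z.of_nat N)%Z.
Proof.
  induction N as [|[|i] IH].
  - simpl. lia.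
  - simpl. lia.
  - change (zlist (S (S i))) with (Z.of_nat (S i) :: (- Z.of_nat (S i))%Z :: zlist (S i)).
    change (In n (Z.of_nat (S i) :: (- Z.of_nat (S i))%Z :: zlist (S i)))
      with (Z.of_nat (S i) = n \/ (- Z.of_nat (S i))%Z = n \/ In n (zlist (S i))).
    rewrite IH. lia.
Qed.

Lemma zlist_NoDup (N : nat) : NoDup (zlist N).
Proof.
  induction N as [|[|i] IH].
  - constructor.
  - repeat constructor. auto.
  - change (zlist (S (S i))) with (Z.of_nat (S i) :: (- Z.of_nat (S i))%Z :: zlist (S i)).
    constructor; [|constructor; auto].
    + intros [H|H]. lia. apply zlist_In in H. lia.
    + intros H. apply zlist_In in H. lia.
Qed.

Definition lsum {T : Type} (f : T -> C) (l : list T) : C := fold_right Cplus 0 (map f l).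

Definition rlsum {T : Type} (f : T -> R) (l : list T) : R := fold_right Rplus 0%R (map f l).

Lemma lsum_app {T : Type} (f : T -> C) (l l' : list T) :
  lsum f (l ++ l') = lsum f l + lsum f l'.
Proof. unfold lsum. induction l; simpl; [|rewrite IHl]; ring. Qed.

Lemma rlsum_app {T : Type} (f : T -> R) (l l' : list T) :
  rlsum f (l ++ l') = (rlsum f l + rlsum f l')%R.
Proof. unfold rlsum. induction l; simpl; [|rewrite IHl]; ring. Qed.

Lemma lsum_Permutation {T : Type} (f : T -> C) (l l' : list T) :
  Permutation l l' -> lsum f l = lsum f l'.
Proof. intros H. apply fold_right_Permutation. now apply Permutation_map. Qed.

Lemma rlsum_Permutation {T : Type} (f : T -> R) (l l' : list T) :
  Permutation l l' -> rlsum f l = rlsum f l'.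
Proof. unfold rlsum. induction 1; simpl; try congruence; ring. Qed.

Lemma lsum_norm {T : Type} (f : T -> C) (g : T -> R) (l : list T) :
  (forall x, Cmod (f x) <= g x)%R -> (Cmod (lsum f l) <= rlsum g l)%R.
Proof.
  intros H. unfold lsum, rlsum. induction l; simpl. rewrite Cmod_0; lra.
  eapply Rle_trans; [apply Cmod_triangle|]. apply Rplus_le_compat; auto.
Qed.

Lemma rlsum_nonneg {T : Type} (g : T -> R) (l : list T) :
  (forall x, 0 <= g x)%R -> (0 <= rlsum g l)%R.
Proof. intros H. unfold rlsum. induction l; simpl. lra. specialize (H a); lra. Qed.

Lemma rlsum_scal {T : Type} (c : R) (g : T -> R) (l : list T) :
  rlsum (fun x => c * g x)%R l = (c * rlsum g l)%R.
Proof. unfold rlsum. induction l; simpl; [|rewrite IHl]; ring. Qed.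

Lemma lsum_zlist (f : Z -> C) (N : nat) : lsum f (zlist N) = csum (zpair f) N.
Proof.
  induction N as [|[|i] IH]; [reflexivity | unfold lsum; simpl; ring |].
  change (csum (zpair f) (S (S i)))
    with (csum (zpair f) (S i) + (f (Z.of_nat (S i)) + f (- Z.of_nat (S i))%Z)).
  rewrite <- IH.
  change (lsum f (zlist (S (S i))))
    with (f (Z.of_nat (S i)) + (f (- Z.of_nat (S i))%Z + lsum f (zlist (S i)))). ring.
Qed.

Lemma rlsum_zlist (f : Z -> R) (N : nat) : rlsum f (zlist N) = rsum (rpair f) N.
Proof.
  induction N as [|[|i] IH]; [reflexivity | unfold rlsum; simpl; ring |].
  change (rsum (rpair f) (S (S i)))
    with (rsum (rpair f) (S i) + (f (Z.of_nat (S i)) + f (- Z.of_nat (S i))%Z))%R.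
  rewrite <- IH.
  change (rlsum f (zlist (S (S i))))
    with (f (Z.of_nat (S i)) + (f (- Z.of_nat (S i))%Z + rlsum f (zlist (S i))))%R. ring.
Qed.

Definition box_list (N : nat) : list (Z * Z) := list_prod (zlist N) (zlist N).

Lemma lsum_box_list (f : Z * Z -> C) (N : nat) : lsum f (box_list N) = box_sum f N.
Proof.
  unfold box_sum, box_list. rewrite <- lsum_zlist. generalize (zlist N) at 1 3. intros l.
  induction l as [|m l IH]; [reflexivity|].
  change (list_prod (m :: l) (zlist N))
    with (map (fun n => (m, n)) (zlist N) ++ list_prod l (zlist N)).
  rewrite lsum_app, IH. unfold lsum at 1. rewrite map_map.
  change (fold_right Cplus 0 (map (fun n => f (m, n)) (zlist N)))
    with (lsum (fun n => f (m, n)) (zlist N)).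
  rewrite lsum_zlist. reflexivity.
Qed.

Lemma rlsum_box_list (g : Z -> R) (N : nat) :
  rlsum (fun p : Z * Z => g (fst p) * g (snd p))%R (box_list N) = (rsum (rpair g) N ^ 2)%R.
Proof.
  rewrite <- rlsum_zlist. unfold box_list. simpl. rewrite Rmult_1_r.
  generalize (zlist N) at 1 3. intros l.
  induction l as [|m l IH].
  - unfold rlsum; simpl. ring.
  - change (list_prod (m :: l) (zlist N))
      with (map (fun n => (m, n)) (zlist N) ++ list_prod l (zlist N)).
    rewrite rlsum_app, IH. unfold rlsum at 1. rewrite map_map.
    change (fold_right Rplus 0%R (map (fun n => g (fst (m, n)) * g (snd (m, n)))%R (zlist N)))
      with (rlsum (fun n => g m * g n)%R (zlist N)).
    rewrite rlsum_scal. change (rlsum g (m :: l)) with (g m + rlsum g l)%R. ring.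
Qed.

Lemma box_list_In (N : nat) (p : Z * Z) :
  In p (box_list N) <-> (Z.abs (fst p) < Z.of_nat N /\ Z.abs (snd p) < Z.of_nat N)%Z.
Proof. destruct p. unfold box_list. rewrite in_prod_iff, !zlist_In. reflexivity. Qed.

Lemma box_list_NoDup (N : nat) : NoDup (box_list N).
Proof.
  unfold box_list. pose proof (zlist_NoDup N) as H. revert H. generalize (zlist N) at 1 2.
  induction 1 as [|m l Hm Hl IH]; [constructor|].
  change (list_prod (m :: l) (zlist N))
    with (map (fun n => (m, n)) (zlist N) ++ list_prod l (zlist N)).
  apply NoDup_app; auto.
  - apply Injective_map_NoDup; [|apply zlist_NoDup]. intros x y E. congruence.
  - intros p Hp Hp'. apply in_map_iff in Hp. destruct Hp as [n [<- _]].
    apply in_prod_iff in Hp'. tauto.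
Qed.

Lemma NoDup_incl_split {T : Type} (l l' : list T) :
  NoDup l -> NoDup l' -> incl l l' -> exists r, Permutation l' (l ++ r).
Proof.
  intros Hl. revert l'. induction Hl as [|x l Hx Hl IH]; intros l' Hl' Hi.
  - now exists l'.
  - destruct (in_split x l') as [l1 [l2 ->]]. apply Hi; now left.
    assert (Hm : Permutation (l1 ++ x :: l2) (x :: l1 ++ l2)) by (symmetry; apply Permutation_middle).
    destruct (IH (l1 ++ l2)) as [r Hr].
    + now apply NoDup_remove_1 in Hl'.
    + intros y Hy. assert (In y (x :: l1 ++ l2)).
      { apply (Permutation_in _ Hm). apply Hi. now right. }
      destruct H as [->|]; auto. contradiction.
    + exists r. rewrite Hm. simpl. now constructor.
Qed.

Instance finite_subsets_filter {T : Type} (D : T -> Prop) : Filter (finite_subsets D).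
Proof.
  constructor.
  - exists nil. split; auto. intros x [].
  - intros P Q [S [HS HP]] [S' [HS' HQ]]. exists (S ++ S'). split.
    + intros x Hx. apply in_app_or in Hx. destruct Hx; auto.
    + intros R HR HD Hi. split; [apply HP | apply HQ]; auto; intros x Hx; apply Hi;
        apply in_or_app; auto.
  - intros P Q H [S [HS HP]]. exists S. auto.
Qed.

Instance finite_subsets_proper {T : Type} (D : T -> Prop) : ProperFilter' (finite_subsets D).
Proof.
  constructor; [|apply finite_subsets_filter].
  intros [S [HS H]].
  set (dec := fun x y : T => excluded_middle_informative (x = y)).
  apply (H (nodup dec S)).
  - apply NoDup_nodup.
  - intros x Hx. apply HS. now apply nodup_In in Hx.
  - intros x Hx. now apply nodup_In.
Qed.

(** A finite set containing the box of size N is that box plus a rest [r]. Enclosing everything in a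
    larger box bounds the weights of [r] by U^2 minus those of the box, which tends to 0. *)
Lemma is_sum_box (f : Z * Z -> C) (K : R) (l : C) :
  (0 <= K)%R -> f (0, 0)%Z = 0 ->
  (forall m n, Cmod (f (m, n)) <= K * (zweight m * zweight n))%R ->
  Clim (box_sum f) l -> is_sum (fun p : Z * Z => p <> (0, 0)%Z) f l.
Proof.
  intros HK f0 Hf Hl. unfold is_sum. apply filterlim_C. apply finite_subsets_filter.
  intros e He.
  set (u := rpair zweight).
  assert (Hu : forall i, (0 <= u i)%R).
  { intros [|i]; unfold u; cbn [rpair]; pose proof zweight_pos.
    auto. apply Rplus_le_le_0_compat; auto. }
  assert (Eu : ex_series u).
  { apply rsum_bounded_ex_series with (Series (fun i => 2 * weight i)%R); auto.
    intros n. apply Rle_trans with (rsum (fun i => 2 * weight i)%R n).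
    - apply rsum_le. intros; apply rpair_zweight.
    - apply rsum_le_Series. intros; pose proof (weight_pos i); lra.
      apply ex_series_Rscal, ex_series_weight. }
  set (U := Series u).
  assert (HT : exists N, (Cmod (box_sum f N - l) < e / 2)%R
                         /\ (K * (U ^ 2 - rsum u N ^ 2) < e / 2)%R).
  { apply Clim_eps with (e := (e / 2)%R) in Hl; [|lra]. destruct Hl as [N1 HN1].
    assert (HL : is_lim_seq (fun N => K * (U * U - rsum u N * rsum u N))%R 0%R).
    { replace (Finite 0) with (Rbar_mult K (U * U - U * U)%R) by (simpl; f_equal; ring).
      apply is_lim_seq_scal_l. apply is_lim_seq_minus'. apply is_lim_seq_const.
      apply is_lim_seq_mult'; now apply rsum_lim. }
    apply is_lim_seq_spec in HL. destruct (HL (mkposreal (e / 2) ltac:(lra))) as [N2 HN2].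
    exists (Nat.max N1 N2). split. apply HN1; lia.
    specialize (HN2 (Nat.max N1 N2) ltac:(lia)). simpl in HN2.
    rewrite Rminus_0_r in HN2. apply Rabs_def2 in HN2. simpl. lra. }
  destruct HT as [N [HN1 HN2]].
  set (dec := fun x y : Z * Z => excluded_middle_informative (x = y)).
  exists (remove dec (0, 0)%Z (box_list N)). split.
  { intros x Hx. apply in_remove in Hx. tauto. }
  intros S ND HD Hi.
  change (Cmod (lsum f S - l) < e)%R.
  (* The origin lies in every nonempty box but not in the domain of summation; adding it is harmless
     as f vanishes there. *)
  set (S' := (0, 0)%Z :: S).
  assert (ND' : NoDup S').
  { constructor; auto. intros H. now apply (HD _ H). }
  assert (Hi' : incl (box_list N) S').
  { intros x Hx. destruct (dec x (0, 0)%Z) as [->|Nx]. now left.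
    right. apply Hi. now apply in_in_remove. }
  assert (ES : lsum f S = lsum f S').
  { unfold S'. change (lsum f ((0, 0)%Z :: S)) with (f (0, 0)%Z + lsum f S). rewrite f0. ring. }
  destruct (NoDup_incl_split _ _ (box_list_NoDup N) ND' Hi') as [r Hr].
  assert (HN' : exists N', incl S' (box_list N')).
  { clear. induction S' as [|p S' [N' IH]].
    - exists O. intros x [].
    - exists (Nat.max N' (Datatypes.S (Z.to_nat (Z.max (Z.abs (fst p)) (Z.abs (snd p)))))).
      intros x [<-|Hx].
      + apply box_list_In. lia.
      + apply IH in Hx. apply box_list_In in Hx. apply box_list_In. lia. }
  destruct HN' as [N' HN'].
  destruct (NoDup_incl_split _ _ ND' (box_list_NoDup N') HN') as [r' Hr'].
  set (g := fun p : Z * Z => (zweight (fst p) * zweight (snd p))%R).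
  assert (Hg : forall p, (0 <= g p)%R) by (intros; apply Rmult_le_pos; apply zweight_pos).
  assert (G1 : (rlsum g r <= U ^ 2 - rsum u N ^ 2)%R).
  { pose proof (rlsum_Permutation g _ _ Hr') as E1.
    pose proof (rlsum_Permutation g _ _ Hr) as E2.
    rewrite rlsum_app in E1, E2. rewrite E2 in E1.
    pose proof (rlsum_box_list zweight N) as B1. pose proof (rlsum_box_list zweight N') as B2.
    fold g u in B1, B2. rewrite B1 in E1. rewrite B2 in E1.
    pose proof (rlsum_nonneg g r' Hg).
    assert (rsum u N' ^ 2 <= U ^ 2)%R.
    { apply pow_incr. split. now apply rsum_nonneg. now apply rsum_le_Series. }
    lra. }
  assert (G2 : (Cmod (lsum f r) <= K * rlsum g r)%R).
  { rewrite <- rlsum_scal. apply lsum_norm. intros [m n]. apply Hf. }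
  rewrite ES, (lsum_Permutation f _ _ Hr), lsum_app, lsum_box_list.
  replace (box_sum f N + lsum f r - l) with (box_sum f N - l + lsum f r) by ring.
  eapply Rle_lt_trans; [apply Cmod_triangle|]. nra.
Qed.

Lemma zpair_csum (f : nat -> Z -> C) (N i : nat) :
  zpair (fun m => csum (fun j => f j m) N) i = csum (fun j => zpair (f j) i) N.
Proof. destruct i; simpl; [|rewrite <- csum_plus]; reflexivity. Qed.

Lemma zpair_opp_arg (f : Z -> C) (i : nat) : zpair (fun n => f (- n)%Z) i = zpair f i.
Proof. destruct i; cbn [zpair]; [reflexivity|]. rewrite Z.opp_involutive. ring. Qed.

Lemma box_sum_ext (f g : Z * Z -> C) (N : nat) :
  (forall m n, f (m, n) = g (m, n)) -> box_sum f N = box_sum g N.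
Proof.
  intros H. unfold box_sum. apply csum_ext. intros i _. apply zpair_ext. intros m.
  apply csum_ext. intros j _. apply zpair_ext. auto.
Qed.

Lemma box_sum_scal (c : C) (f : Z * Z -> C) (N : nat) :
  box_sum (fun p => c * f p) N = c * box_sum f N.
Proof.
  rewrite <- !lsum_box_list. unfold lsum.
  induction (box_list N); simpl; [|rewrite IHl]; ring.
Qed.

Lemma box_sum_pairs (f : Z * Z -> C) (N : nat) :
  box_sum f N = csum (fun i => csum (fun j => zpair (fun m => zpair (fun n => f (m, n)) j) i) N) N.
Proof.
  unfold box_sum. apply csum_ext. intros i _.
  apply (zpair_csum (fun j m => zpair (fun n => f (m, n)) j)).
Qed.

Lemma zpair_swap (f : Z -> Z -> C) (i j : nat) :
  zpair (fun m => zpair (fun n => f m n) j) i = zpair (fun n => zpair (fun m => f m n) i) j.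
Proof. destruct i, j; cbn [zpair]; ring. Qed.

(** The map (m, n) -> (-n, m) preserves square boxes; it is the action of S on the lattice. *)
Lemma box_sum_rotate (f : Z * Z -> C) (N : nat) :
  box_sum f N = box_sum (fun p => f (- snd p, fst p)%Z) N.
Proof.
  rewrite !box_sum_pairs, csum_swap. apply csum_ext. intros i _. apply csum_ext. intros j _.
  cbn [fst snd]. rewrite zpair_swap. apply zpair_ext. intros n.
  symmetry. apply (zpair_opp_arg (fun m => f (m, n))).
Qed.

Lemma pow_opp (z : C) (k : nat) : (- z) ^ k = (- (1)) ^ k * z ^ k.
Proof. rewrite <- Cpow_mult_l. f_equal. ring. Qed.

Lemma pow_m1_square (k : nat) : (- (1)) ^ k * (- (1)) ^ k = 1.
Proof. rewrite <- Cpow_mult_l. replace (- (1) * - (1)) with (RtoC 1) by ring. apply Cpow_1_l. Qed.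

Lemma pow_m1_neq_0 (k : nat) : (- (1)) ^ k <> 0.
Proof. apply Cpow_nz. intros E. apply (f_equal Re) in E. simpl in E. lra. Qed.

Lemma Cinv_0 : / RtoC 0 = 0.
Proof. apply injective_projections; simpl; unfold Rdiv; ring. Qed.

(** Valid for zero factors as well, which spares treating the origin separately when terms of the
    Eisenstein series are rearranged. *)
Lemma Cinv_mult_total (a b : C) : / (a * b) = / a * / b.
Proof.
  destruct (Ceq_dec a 0) as [->|Ha].
  - replace (0 * b) with (RtoC 0) by ring. rewrite Cinv_0. ring.
  - destruct (Ceq_dec b 0) as [->|Hb].
    + replace (a * 0) with (RtoC 0) by ring. rewrite Cinv_0. ring.
    + field. auto.
Qed.

Section Eisenstein.

Variables (k : nat) (L M : Z) (chi psi : Z -> C).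
Hypothesis k_ge_3 : (3 <= k)%nat.
Hypothesis chi_primitive : primitive_character L chi.
Hypothesis psi_primitive : primitive_character M psi.
Hypothesis parity : chi (-1)%Z * psi (-1)%Z = (- (1)) ^ k.

Let term (z : C) (p : Z * Z) : C :=
  chi (fst p) * psi (snd p) / (RtoC (IZR (fst p)) * z + RtoC (IZR (snd p))) ^ k.

Lemma primitive_bounded (N : Z) (f : Z -> C) :
  primitive_character N f -> exists B, (0 <= B)%R /\ forall n, (Cmod (f n) <= B)%R.
Proof.
  intros [[HN [Hp _]] _]. destruct (periodic_bounded N f HN Hp) as [B HB].
  exists B. split; auto. apply Rle_trans with (2 := HB 0%Z). apply Cmod_ge_0.
Qed.

Lemma eisenstein_term_bound (y B : R) :
  (0 < y)%R -> (0 <= B)%R ->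
  exists K, (0 <= K)%R /\ forall z m n, (y <= Im z)%R -> (Cmod z <= B)%R ->
    (Cmod (term z (m, n)) <= K * (zweight m * zweight n))%R.
Proof.
  intros Hy HB.
  destruct (lattice_term_bound k y B k_ge_3 Hy HB) as [K [HK HK']].
  destruct (primitive_bounded L chi chi_primitive) as [B1 [HB1 HB1']].
  destruct (primitive_bounded M psi psi_primitive) as [B2 [HB2 HB2']].
  exists (B1 * B2 * K)%R. split. repeat apply Rmult_le_pos; auto.
  intros z m n Hz Hzb. unfold term, Cdiv. cbn [fst snd].
  rewrite !Cmod_mult, (Rmult_assoc (B1 * B2)). apply Rmult_le_compat.
  - apply Rmult_le_pos; apply Cmod_ge_0.
  - apply Cmod_ge_0.
  - apply Rmult_le_compat; auto using Cmod_ge_0.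
  - auto.
Qed.

Lemma zpair2_bound (f : Z * Z -> C) (K : R) (i j : nat) :
  (forall m n, Cmod (f (m, n)) <= K * (zweight m * zweight n))%R ->
  (0 <= K)%R ->
  (Cmod (zpair (fun m => zpair (fun n => f (m, n)) j) i) <= 4 * K * weight i * weight j)%R.
Proof.
  intros Hf HK.
  apply Rle_trans with (rpair (fun m => (K * rpair zweight j) * zweight m)%R i).
  - apply zpair_norm. intros m.
    apply Rle_trans with (rpair (fun n => (K * zweight m) * zweight n)%R j).
    + apply zpair_norm. intros n. rewrite Rmult_assoc. auto.
    + rewrite rpair_scal. lra.
  - rewrite rpair_scal. pose proof (rpair_zweight i). pose proof (rpair_zweight j).
    assert (P : forall i, (0 <= rpair zweight i)%R).
    { intros [|i0]; cbn [rpair]; pose proof zweight_pos.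
      auto. apply Rplus_le_le_0_compat; auto. }
    replace (4 * K * weight i * weight j)%R with (K * (2 * weight j) * (2 * weight i))%R by ring.
    apply Rmult_le_compat; auto. apply Rmult_le_pos; auto. apply Rmult_le_compat_l; auto.
Qed.

Lemma eisenstein_term_0 (z : C) : term z (0, 0)%Z = 0.
Proof.
  unfold term. cbn [fst snd]. replace (RtoC 0 * z + RtoC 0) with (RtoC 0) by ring.
  replace k with (S (k - 1)) by (clear - k_ge_3; lia). rewrite Cpow_S.
  replace (0 * 0 ^ (k - 1)) with (RtoC 0) by ring. unfold Cdiv. rewrite Cinv_0. ring.
Qed.

(** The box limit is a sum over finite subsets, and such sums are unique because the filter is
    proper; so the description [eisenstein] takes this value. The second clause gives it row by
    row. *)
Lemma eisenstein_box_exists (z : C) :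
  (0 < Im z)%R ->
  Clim (box_sum (term z)) (eisenstein k chi psi z)
  /\ exists r, (forall i, Csum (fun j => zpair (fun m => zpair (fun n => term z (m, n)) j) i) (r i))
               /\ Csum r (eisenstein k chi psi z).
Proof.
  intros Hz.
  destruct (eisenstein_term_bound (Im z) (Cmod z) Hz (Cmod_ge_0 z)) as [K [HK HT]].
  assert (HT' : forall m n, (Cmod (term z (m, n)) <= K * (zweight m * zweight n))%R)
    by (intros; apply HT; lra).
  set (a := fun i j => zpair (fun m => zpair (fun n => term z (m, n)) j) i).
  destruct (dominated_fubini a (fun i => 4 * K * weight i)%R weight)
    as [r [c [l [Hr [_ [Hl [_ Hb]]]]]]].
  - intros; pose proof (weight_pos m); nra.
  - apply weight_pos.
  - intros i j. now apply zpair2_bound.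
  - apply ex_series_Rscal, ex_series_weight.
  - apply ex_series_weight.
  - assert (HB : Clim (box_sum (term z)) l).
    { apply Clim_ext with (2 := Hb). intros N. symmetry. apply box_sum_pairs. }
    assert (E : eisenstein k chi psi z = l).
    { apply the_unique.
      - exact (is_sum_box (term z) K l HK (eisenstein_term_0 z) HT' HB).
      - intros w Hw. unfold is_sum in Hw.
        apply (filterlim_locally_unique (V := C_NormedModule)
                 (F := finite_subsets (fun p : Z * Z => p <> (0, 0)%Z))) with (1 := Hw).
        exact (is_sum_box (term z) K l HK (eisenstein_term_0 z) HT' HB). }
    rewrite E. split; auto. exists r. auto.
Qed.

Lemma lattice_sum_correct (z : C) (j : nat) :
  (0 < Im z)%R -> (1 <= j)%nat ->
  Csum (zpair (fun n => psi n / (z + RtoC (IZR n)) ^ j)) (lattice_sum psi j z).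
Proof.
  intros Hz Hj. destruct (epsilon_char_spec M psi psi_primitive) as [_ [Psi [HPsi Hpsi]]].
  destruct (lattice_sum_spec psi Psi (epsilon_char psi) (Im z) j HPsi Hpsi Hz Hj) as [K [_ H]].
  apply H. lra.
Qed.

(** The row m = 0, which turns out to be the constant term; its term with n = 0 is zero because / 0
    = 0. *)
Definition eisenstein_constant : C :=
  chi 0%Z * epsilon (inhabits (RtoC 0)) (fun l => Csum (zpair (fun n => psi n / RtoC (IZR n) ^ k)) l).

(** The rows m and -m agree after n -> -n, by the parity hypothesis, whence the factor 2 and the
    restriction to m > 0. *)
Lemma eisenstein_expansion (z : C) :
  (0 < Im z)%R ->
  Csum (fun i => 2 * chi (Z.of_nat (S i)) * lattice_sum psi k (RtoC (INR (S i)) * z))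
    (eisenstein k chi psi z - eisenstein_constant).
Proof.
  intros Hz. destruct (eisenstein_box_exists z Hz) as [_ [r [Hr HE]]].
  assert (R0 : r O = eisenstein_constant).
  { specialize (Hr O). cbn [zpair] in Hr. unfold eisenstein_constant.
    destruct (Ceq_dec (chi 0%Z) 0) as [Z|Z].
    - rewrite Z. apply Csum_unique with (1 := Hr). apply Csum_ext with (fun _ => 0).
      + intros j. rewrite (zpair_ext _ (fun _ => 0 * 0)).
        * rewrite zpair_scal. ring.
        * intros n. unfold term. cbn [fst snd]. rewrite Z. unfold Cdiv. ring.
      + replace (0 * _) with (RtoC 0) by ring. apply Csum_zero.
    - assert (Hc : Csum (zpair (fun n => psi n / RtoC (IZR n) ^ k)) (/ chi 0%Z * r O)).
      { apply Csum_ext with (2 := Csum_scal (/ chi 0%Z) _ _ Hr). intros j.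
        rewrite <- zpair_scal. apply zpair_ext. intros n. unfold term. cbn [fst snd].
        replace (RtoC 0 * z + RtoC (IZR n)) with (RtoC (IZR n)) by ring.
        replace (psi n / RtoC (IZR n) ^ k)
          with (/ chi 0%Z * chi 0%Z * (psi n / RtoC (IZR n) ^ k)) by (rewrite Cinv_l by auto; ring).
        unfold Cdiv. ring. }
      set (e := epsilon _ _).
      assert (He : Csum (zpair (fun n => psi n / RtoC (IZR n) ^ k)) e)
        by (apply epsilon_spec; eexists; exact Hc).
      rewrite (Csum_unique _ _ _ He Hc). field. auto. }
  assert (RS : forall i, r (S i)
     = 2 * chi (Z.of_nat (S i)) * lattice_sum psi k (RtoC (INR (S i)) * z)).
  { intros i. set (m := Z.of_nat (S i)).
    assert (Em : RtoC (INR (S i)) = RtoC (IZR m)) by (unfold m; now rewrite INR_IZR_INZ).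
    apply Csum_unique with (1 := Hr (S i)).
    apply Csum_ext with (fun j => 2 * chi m
       * zpair (fun n => psi n / (RtoC (INR (S i)) * z + RtoC (IZR n)) ^ k) j).
    - intros j. cbn [zpair]. fold m. rewrite <- zpair_scal.
      rewrite <- (zpair_opp_arg (fun n => term z ((- m)%Z, n))), <- zpair_plus.
      apply zpair_ext. intros n. unfold term. cbn [fst snd].
      rewrite (dirichlet_character_opp L chi m (proj1 chi_primitive)).
      rewrite (dirichlet_character_opp M psi n (proj1 psi_primitive)).
      rewrite !opp_IZR, !RtoC_opp, Em.
      replace (- RtoC (IZR m) * z + - RtoC (IZR n)) with (- (RtoC (IZR m) * z + RtoC (IZR n)))
        by ring.
      rewrite pow_opp. unfold Cdiv. rewrite Cinv_mult_total.
      replace (chi (-1)%Z * chi m * (psi (-1)%Z * psi n)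
               * (/ (- (1)) ^ k * / (RtoC (IZR m) * z + RtoC (IZR n)) ^ k))
        with (chi (-1)%Z * psi (-1)%Z * / (- (1)) ^ k
              * (chi m * psi n * / (RtoC (IZR m) * z + RtoC (IZR n)) ^ k)) by ring.
      rewrite parity. replace ((- (1)) ^ k * / (- (1)) ^ k) with (RtoC 1)
        by (field; apply pow_m1_neq_0). ring.
    - apply Csum_scal. apply lattice_sum_correct; [|lia].
      simpl Im. replace (_ + _)%R with (INR (S i) * Im z)%R by (unfold Im; simpl; ring).
      apply Rmult_lt_0_compat; auto. apply lt_0_INR; lia. }
  apply Csum_ext with (fun i => r (S i)); auto.
  apply Csum_shift. rewrite R0.
  replace (eisenstein_constant + (eisenstein k chi psi z - eisenstein_constant))
    with (eisenstein k chi psi z) by ring. exact HE.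
Qed.

End Eisenstein.

(** Multiplying the base of the term (-n, m) at -1/z by -z gives -(m z + n), so the rotated box sum
    is that of the exchanged characters. The sign chi(-1) (-1)^k equals psi(-1) by parity. *)
Lemma eisenstein_slash (k : nat) (L M : Z) (chi psi : Z -> C) (z : C) :
  (3 <= k)%nat -> primitive_character L chi -> primitive_character M psi ->
  chi (-1)%Z * psi (-1)%Z = (- (1)) ^ k -> (0 < Im z)%R ->
  slash k (eisenstein k chi psi) (SL2Z_inv SL2Z_S) z = psi (-1)%Z * eisenstein k psi chi z.
Proof.
  intros Hk Hc Hp Hpar Hz.
  assert (Zz : z <> 0) by (intros E; rewrite E in Hz; simpl in Hz; lra).
  unfold slash. simpl sl_a. simpl sl_b. simpl sl_c. simpl sl_d.
  replace (RtoC (-1) * z + RtoC 0) with (- z) by (apply injective_projections; simpl; ring).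
  replace ((RtoC 0 * z + RtoC 1) / - z) with (- / z) by (field; auto).
  assert (Hw : (0 < Im (- / z))%R).
  { destruct z as [x y]. simpl in *.
    assert (P : (0 < x * (x * 1) + y * (y * 1))%R) by nra.
    replace (- (- y / (x * (x * 1) + y * (y * 1))))%R
      with (y / (x * (x * 1) + y * (y * 1)))%R by (field; lra).
    now apply Rdiv_lt_0_compat. }
  destruct (eisenstein_box_exists k L M chi psi Hk Hc Hp _ Hw) as [H1 _].
  destruct (eisenstein_box_exists k M L psi chi Hk Hp Hc _ Hz) as [H2 _].
  apply (Clim_scal (/ (- z) ^ k)) in H1. apply (Clim_scal (psi (-1)%Z)) in H2.
  apply Clim_unique with (1 := H1). apply Clim_ext with (2 := H2). intros N.
  rewrite <- !box_sum_scal, (box_sum_rotate (fun p => / (- z) ^ k * _)).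
  apply box_sum_ext. intros m n. cbn [fst snd].
  rewrite (dirichlet_character_opp L chi n (proj1 Hc)).
  unfold Cdiv.
  replace (/ (- z) ^ k * (chi (-1)%Z * chi n * psi m
            * / (RtoC (IZR (- n)) * - / z + RtoC (IZR m)) ^ k))
    with (chi (-1)%Z * (psi m * chi n)
          * (/ (- z) ^ k * / (RtoC (IZR (- n)) * - / z + RtoC (IZR m)) ^ k)) by ring.
  rewrite <- Cinv_mult_total, <- Cpow_mult_l.
  replace (- z * (RtoC (IZR (- n)) * - / z + RtoC (IZR m)))
    with (- (RtoC (IZR m) * z + RtoC (IZR n))) by (rewrite opp_IZR, RtoC_opp; field; auto).
  rewrite pow_opp, Cinv_mult_total.
  assert (E : psi (-1)%Z = chi (-1)%Z * / (- (1)) ^ k).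
  { pose proof (pow_m1_neq_0 k).
    replace (/ (- (1)) ^ k) with ((- (1)) ^ k).
    - rewrite <- Hpar.
      destruct (dirichlet_character_parity L chi (proj1 Hc)) as [-> | ->]; ring.
    - replace ((- (1)) ^ k) with ((- (1)) ^ k * (- (1)) ^ k * / (- (1)) ^ k) at 1 by (field; auto).
      rewrite pow_m1_square. ring. }
  rewrite E. ring.
Qed.

(** * The Eichler integral *)

Lemma Cder_csum (f : nat -> R -> C) (l : nat -> C) (t : R) (n : nat) :
  (forall i, Cder (f i) t (l i)) -> Cder (fun t => csum (fun i => f i t) n) t (csum l n).
Proof.
  intros H. induction n; simpl. apply Cder_const. apply Cder_plus; auto.
Qed.

Lemma Cder_zpair (f : Z -> R -> C) (l : Z -> C) (t : R) (i : nat) :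
  (forall n, Cder (f n) t (l n)) -> Cder (fun t => zpair (fun n => f n t) i) t (zpair l i).
Proof. intros H. destruct i; cbn [zpair]; auto. apply Cder_plus; auto. Qed.

(** The second derivative serves to make [f'] continuous, as the fundamental theorem of calculus
    requires. *)
Lemma Cder_is_RInt (f f' f'' : R -> C) (a b : R) :
  (a <= b)%R ->
  (forall t, (a <= t <= b)%R -> Cder f t (f' t)) ->
  (forall t, (a <= t <= b)%R -> Cder f' t (f'' t)) ->
  is_RInt (V := C_R_NormedModule) f' a b (f b - f a).
Proof.
  intros Hab H1 H2.
  assert (E : f b - f a = (Re (f b) - Re (f a), Im (f b) - Im (f a))%R)
    by (apply injective_projections; simpl; unfold Re, Im; ring).
  rewrite E.
  apply (is_RInt_fct_extend_pair (U := R_NormedModule) (V := R_NormedModule)).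
  - apply (is_RInt_derive (V := R_CompleteNormedModule) (fun t => Re (f t)) (fun t => Re (f' t))).
    + intros t Ht. rewrite Rmin_left, Rmax_right in Ht by auto. now apply H1.
    + intros t Ht. rewrite Rmin_left, Rmax_right in Ht by auto.
      apply (ex_derive_continuous (fun t => Re (f' t))). exists (Re (f'' t)). now apply H2.
  - apply (is_RInt_derive (V := R_CompleteNormedModule) (fun t => Im (f t)) (fun t => Im (f' t))).
    + intros t Ht. rewrite Rmin_left, Rmax_right in Ht by auto. now apply H1.
    + intros t Ht. rewrite Rmin_left, Rmax_right in Ht by auto.
      apply (ex_derive_continuous (fun t => Im (f' t))). exists (Im (f'' t)). now apply H2.
Qed.

Lemma is_RInt_uniform_limit (f : nat -> R -> C) (g : R -> C) (I : nat -> C)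
  (a b : R) (e : nat -> R) (l : C) :
  (a <= b)%R ->
  (forall N, is_RInt (V := C_R_NormedModule) (f N) a b (I N)) ->
  (forall N t, (a <= t <= b)%R -> (Cmod (f N t - g t) <= e N)%R) ->
  is_lim_seq e 0%R -> Clim I l ->
  is_RInt (V := C_R_NormedModule) g a b l.
Proof.
  intros Hab HI He He0 Hl.
  (* [filterlim_RInt] asks for uniform convergence on the whole line, so the argument is clamped to
     [a, b]. *)
  set (cl := fun t => Rmax a (Rmin b t)).
  assert (Hcl : forall t, (a <= cl t <= b)%R).
  { intros t. unfold cl. split. apply Rmax_l. apply Rmax_lub; auto. apply Rmin_l. }
  assert (Hid : forall t, (Rmin a b < t < Rmax a b)%R -> cl t = t).
  { intros t Ht. rewrite Rmin_left, Rmax_right in Ht by auto. unfold cl.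
    rewrite Rmin_right, Rmax_right; lra. }
  destruct (filterlim_RInt (V := C_R_CompleteNormedModule) (fun N t => f N (cl t)) a b
              eventually _ (fun t => g (cl t)) I) as [l' [Hl' Hi]].
  - intros N. apply (is_RInt_ext (V := C_R_NormedModule) (f N)); auto.
    intros t Ht. now rewrite Hid.
  - apply filterlim_locally. intros eps.
    apply is_lim_seq_spec in He0. destruct (He0 eps) as [N HN]. exists N.
    intros n Hn t. apply C_NormedModule_mixin_compat1.
    apply Rle_lt_trans with (e n). now apply He.
    specialize (HN n Hn). rewrite Rminus_0_r in HN. apply Rabs_def2 in HN. lra.
  - assert (E : l' = l).
    { apply Clim_unique with I; auto. now apply Clim_filterlim. }
    rewrite E in Hi.
    apply (is_RInt_ext (V := C_R_NormedModule) (fun t => g (cl t))); auto.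
    intros t Ht. now rewrite Hid.
Qed.

Instance im_infty_filter : Filter im_infty.
Proof.
  constructor.
  - now exists 0%R.
  - intros P Q [Y HP] [Y' HQ]. exists (Rmax Y Y'). intros z Hz.
    pose proof (Rmax_l Y Y'). pose proof (Rmax_r Y Y'). split; [apply HP | apply HQ]; lra.
  - intros P Q H [Y HP]. exists Y. auto.
Qed.

Instance im_infty_proper : ProperFilter' im_infty.
Proof.
  constructor; [|apply im_infty_filter].
  intros [Y H]. apply (H (0, Y + 1)%R). simpl. lra.
Qed.

Lemma partial_fractions (A c : C) (n : nat) :
  A <> 0 -> A + c <> 0 ->
  c ^ n / (A * (A + c) ^ n) = 1 / A - csum (fun j => c ^ j / (A + c) ^ S j) n.
Proof.
  intros HA HB. induction n.
  - simpl. field. auto.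
  - transitivity (c ^ n / (A * (A + c) ^ n) - c ^ n / (A + c) ^ S n).
    + rewrite !Cpow_S. field. repeat split; auto. now apply Cpow_nz.
    + rewrite IHn. change (csum (fun j => c ^ j / (A + c) ^ S j) (S n))
        with (csum (fun j => c ^ j / (A + c) ^ S j) n + c ^ n / (A + c) ^ S n). ring.
Qed.

Lemma weight_ge_inv_square (i : nat) : (/ INR (S i) ^ 2 <= weight i)%R.
Proof.
  assert (P : (0 < INR (S i))%R) by (apply lt_0_INR; lia).
  unfold weight. rewrite <- Rpower_pow, <- Rpower_Ropp by auto.
  apply Rpower_le_exponent. apply INR_S_ge_1. simpl. lra.
Qed.

Lemma weight_S_le (i : nat) : (weight (S i) <= weight i)%R.
Proof.
  unfold weight. apply Rpower_le_base; [|lra].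
  rewrite (S_INR (S i)). pose proof (INR_S_ge_1 i). lra.
Qed.

Lemma lattice_sum_bounds (M : Z) (psi : Z -> C) (y0 : R) (J : nat) :
  primitive_character M psi -> (0 < y0)%R ->
  exists K, (0 <= K)%R /\ forall j z, (1 <= j <= J)%nat -> (y0 <= Im z)%R ->
    (Cmod (lattice_sum psi j z - lattice_limit (epsilon_char psi) j) <= K / Im z ^ j)%R.
Proof.
  intros Hp Hy. destruct (epsilon_char_spec M psi Hp) as [_ [Psi [HPsi Hpsi]]].
  induction J as [|J [K [HK IH]]].
  - exists 0%R. split. lra. intros; lia.
  - destruct (lattice_sum_spec psi Psi (epsilon_char psi) y0 (S J) HPsi Hpsi Hy ltac:(lia))
      as [K' [HK' H']].
    exists (K + K')%R. split. lra. intros j z Hj Hz.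
    assert (P : (0 < / Im z ^ j)%R) by (apply Rinv_0_lt_compat, pow_lt; lra).
    destruct (Nat.eq_dec j (S J)) as [->|Nj].
    + apply Rle_trans with (1 := proj2 (H' z Hz)). unfold Rdiv. nra.
    + apply Rle_trans with (1 := IH j z ltac:(lia) Hz). unfold Rdiv. nra.
Qed.

Lemma Im_nat_mult (i : nat) (z : C) : Im (RtoC (INR i) * z) = (INR i * Im z)%R.
Proof. simpl. unfold Im. ring. Qed.

Lemma Im_ray (z : C) (t : R) : Im (z + Ci * RtoC t) = (Im z + t)%R.
Proof. simpl. unfold Im. ring. Qed.

Section Tilde.

Variables (k : nat) (L M : Z) (chi psi : Z -> C).
Hypothesis k_ge_3 : (3 <= k)%nat.
Hypothesis chi_primitive : primitive_character L chi.
Hypothesis psi_primitive : primitive_character M psi.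
Hypothesis parity : chi (-1)%Z * psi (-1)%Z = (- (1)) ^ k.
(** Only the values of F on the upper half-plane are prescribed, up to a factor. Thus the section
    covers both E, with c = 1, and its transform under S^-1, with c = psi(-1) and the characters
    exchanged. *)
Variables (F : C -> C) (c : C).
Hypothesis F_spec : forall z, (0 < Im z)%R -> F z = c * eisenstein k chi psi z.

(** The rows m > 0 are at most a multiple of (m Im z)^-k, hence of 1/(m^2 Im z) once Im z >= 1;
    their sum is O(1/Im z). *)
Lemma a0_eisenstein : a0 F = c * eisenstein_constant k chi psi.
Proof.
  assert (H : filterlim F im_infty (locally (c * eisenstein_constant k chi psi))).
  { apply filterlim_C. apply im_infty_filter. intros e He.
    destruct (lattice_sum_bounds M psi 1 k psi_primitive Rlt_0_1) as [K [HK HB]].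
    destruct (primitive_bounded L chi chi_primitive) as [B1 [HB1 HB1']].
    set (W := (Cmod c * (2 * B1 * K * Series weight))%R).
    exists (Rmax 1 (W / e)). intros z Hz.
    pose proof (Rmax_l 1 (W / e)) as M1. pose proof (Rmax_r 1 (W / e)) as M2.
    assert (Hz0 : (0 < Im z)%R) by lra.
    rewrite (F_spec z Hz0).
    replace (c * eisenstein k chi psi z - c * eisenstein_constant k chi psi)
      with (c * (eisenstein k chi psi z - eisenstein_constant k chi psi)) by ring.
    rewrite Cmod_mult.
    pose proof (eisenstein_expansion k L M chi psi k_ge_3 chi_primitive psi_primitive parity
                  z Hz0) as HE.
    assert (B : (Cmod (eisenstein k chi psi z - eisenstein_constant k chi psi)
                 <= 2 * B1 * K * Series weight / Im z)%R).
    { replace (2 * B1 * K * Series weight / Im z)%R with ((2 * B1 * K / Im z) * Series weight)%R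
        by (field; lra).
      rewrite <- Series_scal_l.
      apply Csum_norm_le with (2 := ex_series_Rscal _ _ ex_series_weight) (3 := HE).
      intros i. pose proof (INR_S_ge_1 i) as Hi.
      rewrite !Cmod_mult, Cmod_R, Rabs_pos_eq by lra.
      assert (Hm : (1 <= Im (RtoC (INR (S i)) * z))%R) by (rewrite Im_nat_mult; nra).
      specialize (HB k (RtoC (INR (S i)) * z) ltac:(lia) Hm).
      assert (L0 : lattice_limit (epsilon_char psi) k = 0) by (destruct k as [|[|]]; [lia|lia|auto]).
      rewrite L0 in HB.
      replace (lattice_sum psi k (RtoC (INR (S i)) * z) - 0)
        with (lattice_sum psi k (RtoC (INR (S i)) * z)) in HB by ring.
      assert (HB' : (K / Im (RtoC (INR (S i)) * z) ^ k <= K * (/ Im z * weight i))%R).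
      { apply Rmult_le_compat_l; auto.
        apply Rle_trans with (/ (Im z * INR (S i) ^ 2))%R.
        - apply Rinv_le_contravar. apply Rmult_lt_0_compat; auto. apply pow_lt; lra.
          apply Rle_trans with (Im (RtoC (INR (S i)) * z) ^ 2)%R.
          + rewrite Im_nat_mult. set (x := INR (S i)) in *.
            replace ((x * Im z) ^ 2)%R with (x * x * (Im z * Im z))%R by ring.
            replace (Im z * x ^ 2)%R with (x * x * Im z)%R by ring.
            apply Rmult_le_compat_l; nra.
          + apply Rle_pow; auto. lia.
        - rewrite Rinv_mult. apply Rmult_le_compat_l. left; now apply Rinv_0_lt_compat.
          apply weight_ge_inv_square. }
      replace (2 * B1 * K / Im z * weight i)%R with (2 * B1 * (K * (/ Im z * weight i)))%R
        by (field; lra).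
      apply Rmult_le_compat.
      - apply Rmult_le_pos. lra. apply Cmod_ge_0.
      - apply Cmod_ge_0.
      - apply Rmult_le_compat_l; auto. lra.
      - lra. }
    apply Rle_lt_trans with (W / Im z)%R.
    - unfold W, Rdiv. rewrite (Rmult_assoc (Cmod c)). apply Rmult_le_compat_l; auto.
      apply Cmod_ge_0.
    - apply Rmult_lt_reg_r with (Im z); auto.
      replace (W / Im z * Im z)%R with W by (field; lra).
      apply Rmult_lt_reg_r with (/ e)%R. now apply Rinv_0_lt_compat.
      replace (e * Im z * / e)%R with (Im z) by (field; lra). unfold Rdiv in *. lra. }
  apply the_unique; auto.
  intros w Hw.
  apply (filterlim_locally_unique (V := C_NormedModule) (F := im_infty)) with (1 := Hw).
  exact H.
Qed.

Variable tau : C.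
Hypothesis tau_upper : (0 < Im tau)%R.

Let m_of (i : nat) : C := RtoC (INR (S i)).

Lemma ray_neq_0 (i : nat) (t : R) (n : Z) :
  (0 <= t)%R -> m_of i * (tau + Ci * RtoC t) + RtoC (IZR n) <> 0.
Proof.
  intros Ht. apply upper_half_neq_0. unfold m_of. rewrite Im_nat_mult, Im_ray.
  pose proof (INR_S_ge_1 i). nra.
Qed.

(* Since [w = (z - tau) / (m z + n)] has derivative [(m tau + n) / (m z + n)^2],
   the integrand [(z - tau)^(k-2) / (m z + n)^k] is
   [w^(k-2) w' / (m tau + n)]. *)
Lemma Cder_primitive (i : nat) (n : Z) (t : R) :
  (0 <= t)%R ->
  Cder (fun t => / RtoC (INR (k - 1)) * ((Ci * RtoC t) ^ (k - 1)
          / ((m_of i * tau + RtoC (IZR n)) * (m_of i * (tau + Ci * RtoC t) + RtoC (IZR n)) ^ (k - 1))))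
    t ((Ci * RtoC t) ^ (k - 2) * Ci / (m_of i * (tau + Ci * RtoC t) + RtoC (IZR n)) ^ k).
Proof.
  intros Ht. pose proof (ray_neq_0 i t n Ht) as ND.
  pose proof (ray_neq_0 i 0 n (Rle_refl 0)) as NA.
  replace (tau + Ci * 0) with tau in NA by ring.
  set (A := m_of i * tau + RtoC (IZR n)) in *.
  set (D := fun t => m_of i * (tau + Ci * RtoC t) + RtoC (IZR n)) in *.
  assert (HD : forall t, D t = A + m_of i * (Ci * RtoC t)) by (intros; unfold D, A; ring).
  replace k with (S (S (k - 2))) by (clear - k_ge_3; lia).
  set (p := (k - 2)%nat). replace (S (S p) - 1)%nat with (S p) by lia.
  replace (S (S p) - 2)%nat with p by lia.
  assert (Zp : RtoC (INR (S p)) <> 0) by (apply RtoC_neq_0, not_0_INR; lia).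
  change (D t <> 0) in ND.
  assert (DD : Cder D t (m_of i * Ci)).
  { apply Cder_eq with (0 * (tau + Ci * RtoC t) + m_of i * (0 + (0 * RtoC t + Ci * 1)) + 0); [|ring].
    unfold D. apply (Cder_plus (fun t => m_of i * (tau + Ci * RtoC t)) (fun _ => RtoC (IZR n)));
      [|apply Cder_const].
    apply (Cder_mult (fun _ => m_of i) (fun t => tau + Ci * RtoC t)). apply Cder_const.
    apply (Cder_plus (fun _ => tau) (fun t => Ci * RtoC t)). apply Cder_const.
    apply (Cder_mult (fun _ => Ci) (fun t => RtoC t)). apply Cder_const. apply Cder_id. }
  assert (DX : Cder (fun t => Ci * RtoC t) t Ci).
  { apply Cder_eq with (Ci * 1); [|ring]. apply Cder_scal, Cder_id. }
  assert (DQ : Cder (fun t => Ci * RtoC t * / D t) t (Ci * A / (D t * D t))).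
  { apply Cder_eq with (Ci * / D t + Ci * RtoC t * (- (m_of i * Ci) / (D t * D t))).
    - apply (Cder_mult (fun t => Ci * RtoC t) (fun t => / D t)); auto. now apply Cder_inv.
    - replace A with (D t - m_of i * (Ci * RtoC t)) by (rewrite HD; ring). field. auto. }
  apply Cder_eq with (/ RtoC (INR (S p)) * (/ A *
      (RtoC (INR (S p)) * (Ci * A / (D t * D t)) * (Ci * RtoC t * / D t) ^ p))).
  - assert (DP : Cder (fun t => / RtoC (INR (S p)) * (/ A * (Ci * RtoC t * / D t) ^ S p)) t
      (/ RtoC (INR (S p)) * (/ A *
      (RtoC (INR (S p)) * (Ci * A / (D t * D t)) * (Ci * RtoC t * / D t) ^ p)))).
    { apply Cder_scal, Cder_scal. apply (Cder_pow (fun t => Ci * RtoC t * / D t)). exact DQ. }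
    destruct DP as [P1 P2].
    (* Distributing the power over the quotient needs D s nonzero. A neighbourhood of t = 0 contains
       negative s, so the radius Im tau / 2 keeps the ray in the upper half-plane. *)
    assert (EX : locally t (fun s => / RtoC (INR (S p)) * (/ A * (Ci * RtoC s * / D s) ^ S p)
       = / RtoC (INR (S p)) * ((Ci * RtoC s) ^ S p / (A * D s ^ S p)))).
    { assert (Ht' : (0 < Im tau / 2)%R) by lra.
      exists (mkposreal _ Ht'). intros s Hs.
      change (Rabs (s - t) < Im tau / 2)%R in Hs. apply Rabs_def2 in Hs.
      assert (Ns : D s <> 0).
      { unfold D. apply upper_half_neq_0. unfold m_of. rewrite Im_nat_mult, Im_ray.
        pose proof (INR_S_ge_1 i). nra. }
      rewrite Cpow_mult_l, Cpow_inv by auto. field. repeat split; auto.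
      now apply Cpow_nz. }
    split.
    + apply is_derive_ext_loc with (2 := P1).
      revert EX. apply filter_imp. intros s Es. now rewrite Es.
    + apply is_derive_ext_loc with (2 := P2).
      revert EX. apply filter_imp. intros s Es. now rewrite Es.
  - rewrite Cpow_mult_l, Cpow_inv by auto. fold (D t). rewrite !Cpow_S. field.
    repeat split; auto. now apply Cpow_nz.
Qed.

(** Contribution of m = i + 1 and n = j, -j to the integral from tau to tau + i t, with the factor 2
    for the rows -m. In [integrand] below, the factor (z - tau)^(k-2) dz is left out. *)
Let prim (i j : nat) (t : R) : C :=
  2 * chi (Z.of_nat (S i))
  * zpair (fun n => psi n * (/ RtoC (INR (k - 1)) * ((Ci * RtoC t) ^ (k - 1)
      / ((m_of i * tau + RtoC (IZR n))
         * (m_of i * (tau + Ci * RtoC t) + RtoC (IZR n)) ^ (k - 1))))) j.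

Let integrand (i j : nat) (t : R) : C :=
  2 * chi (Z.of_nat (S i))
  * zpair (fun n => psi n / (m_of i * (tau + Ci * RtoC t) + RtoC (IZR n)) ^ k) j.

Lemma Cder_primitive_pair (i j : nat) (t : R) :
  (0 <= t)%R -> Cder (prim i j) t (integrand i j t * ((Ci * RtoC t) ^ (k - 2) * Ci)).
Proof.
  intros Ht. apply Cder_eq with (2 * chi (Z.of_nat (S i))
    * zpair (fun n => psi n * ((Ci * RtoC t) ^ (k - 2) * Ci
               / (m_of i * (tau + Ci * RtoC t) + RtoC (IZR n)) ^ k)) j).
  - unfold prim. apply Cder_scal. apply (Cder_zpair (fun n t => psi n * _)).
    intros n. apply Cder_scal. now apply Cder_primitive.
  - unfold integrand.
    rewrite (zpair_ext _ (fun n => (Ci * RtoC t) ^ (k - 2) * Ci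
               * (psi n / (m_of i * (tau + Ci * RtoC t) + RtoC (IZR n)) ^ k)))
      by (intros; unfold Cdiv; ring).
    rewrite zpair_scal. ring.
Qed.

(** Mere differentiability suffices: it provides the continuity behind [Cder_is_RInt]. *)
Lemma ex_Cder_integrand (i j : nat) (t : R) :
  (0 <= t)%R -> exists l, Cder (fun t => integrand i j t * ((Ci * RtoC t) ^ (k - 2) * Ci)) t l.
Proof.
  intros Ht.
  assert (HX : Cder (fun t => Ci * RtoC t) t Ci).
  { apply Cder_eq with (Ci * 1); [|ring]. apply Cder_scal, Cder_id. }
  assert (HD : forall n, exists l, Cder (fun t => psi n / (m_of i * (tau + Ci * RtoC t) + RtoC (IZR n)) ^ k) t l).
  { intros n.
    assert (HP : exists l, Cder (fun t => (m_of i * (tau + Ci * RtoC t) + RtoC (IZR n)) ^ k) t l).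
    { replace k with (S (k - 1)) by (clear - k_ge_3; lia). eexists.
      apply (Cder_pow (fun t => m_of i * (tau + Ci * RtoC t) + RtoC (IZR n))).
      apply (Cder_plus (fun t => m_of i * (tau + Ci * RtoC t)) (fun _ => RtoC (IZR n)));
        [|apply Cder_const].
      apply Cder_scal. apply (Cder_plus (fun _ => tau) (fun t => Ci * RtoC t)); [|exact HX].
      apply Cder_const. }
    destruct HP as [l HP]. eexists. unfold Cdiv. apply Cder_scal.
    apply (Cder_inv (fun t => (m_of i * (tau + Ci * RtoC t) + RtoC (IZR n)) ^ k)); [|exact HP].
    apply Cpow_nz. now apply ray_neq_0. }
  assert (HP : exists l, Cder (fun t => (Ci * RtoC t) ^ (k - 2) * Ci) t l).
  { replace (k - 2)%nat with (S (k - 3)) by (clear - k_ge_3; lia). eexists.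
    apply (Cder_mult (fun t => (Ci * RtoC t) ^ S (k - 3)) (fun _ => Ci)); [|apply Cder_const].
    apply (Cder_pow (fun t => Ci * RtoC t)). exact HX. }
  destruct HP as [l' HP].
  apply choice in HD. destruct HD as [l Hl].
  eexists. apply (Cder_mult (integrand i j) (fun t => (Ci * RtoC t) ^ (k - 2) * Ci)).
  - unfold integrand. apply Cder_scal.
    apply (Cder_zpair (fun n t => psi n / (m_of i * (tau + Ci * RtoC t) + RtoC (IZR n)) ^ k) l).
    exact Hl.
  - exact HP.
Qed.

Lemma integrand_bound (T : R) :
  exists K, (0 <= K)%R /\ forall i j t, (0 <= t <= T)%R ->
    (Cmod (integrand i j t) <= K * weight i * weight j)%R.
Proof.
  destruct (Rle_lt_dec 0 T) as [HT|HT].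
  2:{ exists 0%R. split. lra. intros; lra. }
  destruct (eisenstein_term_bound k L M chi psi k_ge_3 chi_primitive psi_primitive
              (Im tau) (Cmod tau + T) tau_upper) as [K [HK HB]].
  { pose proof (Cmod_ge_0 tau). lra. }
  exists (4 * K)%R. split. lra. intros i j t Ht.
  assert (Hz : (Im tau <= Im (tau + Ci * RtoC t))%R) by (rewrite Im_ray; lra).
  assert (Hz' : (Cmod (tau + Ci * RtoC t) <= Cmod tau + T)%R).
  { eapply Rle_trans; [apply Cmod_triangle|].
    rewrite Cmod_mult, Cmod_Ci, Cmod_R, Rabs_pos_eq by lra. lra. }
  unfold integrand. rewrite <- Cmult_assoc, Cmod_mult, <- zpair_scal, Cmod_R, Rabs_pos_eq by lra.
  assert (HZ : (Cmod (zpair (fun n => chi (Z.of_nat (S i))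
                 * (psi n / (m_of i * (tau + Ci * RtoC t) + RtoC (IZR n)) ^ k))%C j)
               <= rpair (fun n => K * zweight (Z.of_nat (S i)) * zweight n)%R j)%R).
  { apply zpair_norm. intros n. rewrite Rmult_assoc.
    specialize (HB _ (Z.of_nat (S i)) n Hz Hz'). cbn [fst snd] in HB.
    rewrite <- INR_IZR_INZ in HB. unfold Cdiv in *. rewrite Cmult_assoc. exact HB. }
  rewrite rpair_scal, zweight_of_nat in HZ.
  pose proof (rpair_zweight j). pose proof (weight_S_le i).
  pose proof (weight_pos (S i)). pose proof (weight_pos j).
  assert (K * weight (S i) * rpair zweight j <= K * weight i * (2 * weight j))%R.
  { apply Rle_trans with (K * weight (S i) * (2 * weight j))%R.
    - apply Rmult_le_compat_l; auto. apply Rmult_le_pos; auto.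
    - apply Rmult_le_compat_r. lra. apply Rmult_le_compat_l; auto. }
  lra.
Qed.

Lemma primitive_integral_0 (i j : nat) : prim i j 0 = 0.
Proof.
  unfold prim. replace (k - 1)%nat with (S (k - 2)) by (clear - k_ge_3; lia).
  rewrite (zpair_ext _ (fun _ => 0 * 0)).
  - rewrite zpair_scal. ring.
  - intros n. replace (Ci * 0) with (RtoC 0) by ring. rewrite Cpow_S. unfold Cdiv. ring.
Qed.

Lemma primitive_integral_bound (T : R) :
  (0 <= T)%R ->
  exists K, (0 <= K)%R /\ forall i j, (Cmod (prim i j T) <= K * weight i * weight j)%R.
Proof.
  intros HT. destruct (integrand_bound T) as [K [HK HB]].
  exists (K * T ^ (k - 2) * T)%R. split.
  { apply Rmult_le_pos; auto. apply Rmult_le_pos; auto. now apply pow_le. }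
  intros i j.
  replace (prim i j T) with (prim i j T - prim i j 0) by (rewrite primitive_integral_0; ring).
  replace (K * T ^ (k - 2) * T * weight i * weight j)%R
    with (K * weight i * weight j * T ^ (k - 2) * (T - 0))%R by ring.
  apply (Cder_diff_le (prim i j) (fun t => integrand i j t * ((Ci * RtoC t) ^ (k - 2) * Ci))); auto.
  - intros t Ht. apply Cder_primitive_pair. lra.
  - intros t Ht. rewrite !Cmod_mult, Cmod_pow, Cmod_mult, Cmod_Ci, Cmod_R, Rabs_pos_eq by lra.
    rewrite Rmult_1_l, Rmult_1_r. apply Rmult_le_compat; auto using Cmod_ge_0.
    apply pow_le; lra. apply pow_incr. lra.
Qed.

(* [row i T] is the sum over n of the terms with [m = i + 1] of the integral from
   [tau] to [tau + i T], evaluated with [partial_fractions]. *)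
Let tail_sum (i : nat) (T : R) : C :=
  csum (fun j => (m_of i * (Ci * RtoC T)) ^ j
                 * lattice_sum psi (S j) (m_of i * (tau + Ci * RtoC T))) (k - 1).

Let row (i : nat) (T : R) : C :=
  2 / RtoC (INR (k - 1)) * (chi (Z.of_nat (S i)) / m_of i ^ (k - 1))
  * (lattice_sum psi 1 (m_of i * tau) - tail_sum i T).

Lemma m_of_neq_0 (i : nat) : m_of i <> 0.
Proof. apply RtoC_neq_0, not_0_INR. lia. Qed.

(** Each term is split by [partial_fractions] with A = m tau + n and x = m i T. As x^(k-1) contains
    m^(k-1), this factor reappears in the denominator of [row]. *)
Lemma primitive_integral_row (i : nat) (T : R) :
  (0 <= T)%R -> Csum (fun j => prim i j T) (row i T).
Proof.
  intros HT. pose proof (m_of_neq_0 i) as Zm.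
  assert (Zk : RtoC (INR (k - 1)) <> 0) by (apply RtoC_neq_0, not_0_INR; lia).
  set (x := m_of i * (Ci * RtoC T)).
  assert (Hi : (0 < INR (S i))%R) by (apply lt_0_INR; lia).
  assert (H1 : Csum (zpair (fun n => psi n / (m_of i * tau + RtoC (IZR n)) ^ 1))
                 (lattice_sum psi 1 (m_of i * tau))).
  { apply (lattice_sum_correct M); auto. unfold m_of. rewrite Im_nat_mult. nra. }
  assert (H2 : Csum (fun l => csum (fun j => x ^ j
             * zpair (fun n => psi n / (m_of i * (tau + Ci * RtoC T) + RtoC (IZR n)) ^ S j) l) (k - 1))
            (tail_sum i T)).
  { unfold tail_sum. fold x.
    apply (Csum_csum (fun j l => x ^ j
      * zpair (fun n => psi n / (m_of i * (tau + Ci * RtoC T) + RtoC (IZR n)) ^ S j) l)).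
    intros j Hj. apply Csum_scal. apply (lattice_sum_correct M); auto; [|lia].
    unfold m_of. rewrite Im_nat_mult, Im_ray. nra. }
  unfold row.
  apply Csum_ext with (2 := Csum_scal (2 / RtoC (INR (k - 1))
      * (chi (Z.of_nat (S i)) / m_of i ^ (k - 1))) _ _ (Csum_minus _ _ _ _ H1 H2)).
  intros l. unfold prim.
  rewrite (csum_ext _ (fun j => zpair (fun n => x ^ j
     * (psi n / (m_of i * (tau + Ci * RtoC T) + RtoC (IZR n)) ^ S j)) l))
    by (intros; now rewrite zpair_scal).
  rewrite <- (zpair_csum (fun j n => x ^ j
     * (psi n / (m_of i * (tau + Ci * RtoC T) + RtoC (IZR n)) ^ S j))).
  replace (zpair (fun n => psi n / (m_of i * tau + RtoC (IZR n)) ^ 1) l - _)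
    with (zpair (fun n => psi n / (m_of i * tau + RtoC (IZR n)) ^ 1 + - (1) *
      csum (fun j => x ^ j * (psi n / (m_of i * (tau + Ci * RtoC T) + RtoC (IZR n)) ^ S j)) (k - 1)) l)
    by (rewrite zpair_plus, zpair_scal; ring).
  rewrite <- !zpair_scal. apply zpair_ext. intros n.
  pose proof (ray_neq_0 i T n HT) as ND.
  pose proof (ray_neq_0 i 0 n (Rle_refl 0)) as NA.
  replace (tau + Ci * 0) with tau in NA by ring.
  set (A := m_of i * tau + RtoC (IZR n)) in *.
  assert (ED : m_of i * (tau + Ci * RtoC T) + RtoC (IZR n) = A + x) by (unfold A, x; ring).
  rewrite ED in *.
  rewrite (csum_ext _ (fun j => psi n * (x ^ j / (A + x) ^ S j)))
    by (intros; unfold Cdiv; ring).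
  rewrite csum_scal. pose proof (partial_fractions A x (k - 1) NA ND) as PF.
  replace (psi n / A ^ 1 + - (1) * (psi n * csum (fun j => x ^ j / (A + x) ^ S j) (k - 1)))
    with (psi n * (1 / A - csum (fun j => x ^ j / (A + x) ^ S j) (k - 1)))
    by (rewrite Cpow_1_r; unfold Cdiv; ring).
  assert (Ex : x ^ (k - 1) = m_of i ^ (k - 1) * (Ci * RtoC T) ^ (k - 1)) by apply Cpow_mult_l.
  rewrite <- PF, Ex. field.
  repeat split; auto; now apply Cpow_nz.
Qed.

(** Only j = 0 has a nonzero limit. The factor (m T)^j absorbs all but one power of the rate (Im
    w)^(-j-1), which leaves K / (m T) for every j; being uniform in m, it permits T -> oo under the
    sum over m. *)
Lemma tail_sum_limit :
  exists K, (0 <= K)%R /\ forall i T, (0 < T)%R ->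
    (Cmod (tail_sum i T + RtoC PI * Ci * epsilon_char psi) <= K / (INR (S i) * T))%R.
Proof.
  destruct (lattice_sum_bounds M psi (Im tau) k psi_primitive tau_upper) as [K [HK HB]].
  exists (INR (k - 1) * K)%R. split. apply Rmult_le_pos; auto. apply pos_INR.
  intros i T HT. pose proof (INR_S_ge_1 i) as Hi.
  set (w := m_of i * (tau + Ci * RtoC T)).
  assert (Ew : Im w = (INR (S i) * (Im tau + T))%R).
  { unfold w, m_of. now rewrite Im_nat_mult, Im_ray. }
  assert (Hw : (Im tau <= Im w)%R) by (rewrite Ew; nra).
  assert (Hw' : (INR (S i) * T <= Im w)%R) by (rewrite Ew; nra).
  assert (PT : (0 < INR (S i) * T)%R) by nra.
  assert (EL : csum (fun j => (m_of i * (Ci * RtoC T)) ^ j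
                 * lattice_limit (epsilon_char psi) (S j)) (k - 1)
               = - (RtoC PI * Ci * epsilon_char psi)).
  { rewrite (csum_single _ 0); [simpl; ring|lia|].
    intros [|j] _ Nj; [lia|]. simpl lattice_limit. ring. }
  replace (tail_sum i T + RtoC PI * Ci * epsilon_char psi)
    with (csum (fun j => (m_of i * (Ci * RtoC T)) ^ j
            * (lattice_sum psi (S j) w - lattice_limit (epsilon_char psi) (S j))) (k - 1)).
  2:{ unfold tail_sum. fold w.
      rewrite (csum_ext _ (fun j => (m_of i * (Ci * RtoC T)) ^ j * lattice_sum psi (S j) w
         + - (1) * ((m_of i * (Ci * RtoC T)) ^ j * lattice_limit (epsilon_char psi) (S j))))
        by (intros; ring).
      rewrite csum_plus, csum_scal, EL. ring. }
  replace (INR (k - 1) * K / (INR (S i) * T))%R with (INR (k - 1) * (K / (INR (S i) * T)))%R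
    by (unfold Rdiv; ring).
  rewrite <- rsum_const. apply csum_norm_le. intros j Hj.
  rewrite Cmod_mult, Cmod_pow. unfold m_of. rewrite !Cmod_mult, Cmod_Ci, !Cmod_R.
  rewrite (Rabs_pos_eq (INR (S i))), (Rabs_pos_eq T), Rmult_1_l by lra.
  specialize (HB (S j) w ltac:(lia) Hw).
  apply Rle_trans with (Im w ^ j * (K / Im w ^ S j))%R.
  - apply Rmult_le_compat; auto using Cmod_ge_0. apply pow_le; lra. apply pow_incr; lra.
  - assert (0 < Im w)%R by lra.
    replace (Im w ^ j * (K / Im w ^ S j))%R with (K * / Im w)%R.
    + apply Rmult_le_compat_l; auto. now apply Rinv_le_contravar.
    + change (Im w ^ S j)%R with (Im w * Im w ^ j)%R. field. split; [apply pow_nonzero|]; lra.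
Qed.

(** Box partial sums are integrated exactly by their primitives. On [0, T] they converge uniformly,
    by [dominated_box_rate] with a majorant independent of t, so the limit may be taken under the
    integral. *)
Lemma integral_finite (T : R) :
  (0 <= T)%R ->
  exists J, Csum (fun i => row i T) J
    /\ is_RInt (V := C_R_NormedModule)
         (fun t => (F (tau + Ci * RtoC t) - a0 F) * (Ci * RtoC t) ^ (k - 2) * Ci) 0 T (c * J).
Proof.
  intros HT.
  destruct (primitive_integral_bound T HT) as [K [HK HP]].
  destruct (dominated_fubini (fun i j => prim i j T) (fun i => K * weight i)%R weight)
    as [r [_ [J [Hr [_ [HJ [_ HB]]]]]]]; auto using weight_pos, ex_series_weight.
  { intros; apply Rmult_le_pos; auto using weight_pos. }
  { apply ex_series_Rscal, ex_series_weight. }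
  exists J. split.
  { apply Csum_ext with (2 := HJ). intros i. apply Csum_unique with (1 := Hr i).
    now apply primitive_integral_row. }
  destruct (integrand_bound T) as [K' [HK' HI]].
  set (h := fun N t => c * csum (fun i => csum (fun j => integrand i j t
                          * ((Ci * RtoC t) ^ (k - 2) * Ci)) N) N).
  set (H := fun N t => c * csum (fun i => csum (fun j => prim i j t) N) N).
  set (U := Series (fun i => K' * weight i)%R). set (V := Series weight).
  apply is_RInt_uniform_limit with (f := h) (I := fun N => H N T - H N 0%R)
    (e := fun N => (Cmod c * T ^ (k - 2) * (U * (V - rsum weight N)
                      + V * (U - rsum (fun i => K' * weight i) N)))%R); auto.
  - intros N.
    (* The condition on t is placed under the quantifier, so that a derivative can be chosen as a
       function of all i, j and t. *)
    assert (HE : forall i j t, exists l, (0 <= t)%R ->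
       Cder (fun t => integrand i j t * ((Ci * RtoC t) ^ (k - 2) * Ci)) t l).
    { intros i j t. destruct (Rle_lt_dec 0 t) as [Ht|Ht].
      - destruct (ex_Cder_integrand i j t Ht) as [l Hl]. now exists l.
      - exists 0. lra. }
    set (e := fun i j t => proj1_sig (constructive_indefinite_description _ (HE i j t))).
    assert (He : forall i j t, (0 <= t)%R ->
       Cder (fun t => integrand i j t * ((Ci * RtoC t) ^ (k - 2) * Ci)) t (e i j t)).
    { intros i j t. unfold e.
      destruct (constructive_indefinite_description _ (HE i j t)); auto. }
    apply (Cder_is_RInt (H N) (h N) (fun t => c * csum (fun i => csum (fun j => e i j t) N) N)); auto.
    + intros t Ht. unfold H, h. apply Cder_scal.
      apply (Cder_csum (fun i t => csum (fun j => prim i j t) N)). intros i.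
      apply (Cder_csum (fun j t => prim i j t)). intros j. apply Cder_primitive_pair. lra.
    + intros t Ht. unfold h. apply Cder_scal.
      apply (Cder_csum (fun i t => csum (fun j => integrand i j t * _) N)). intros i.
      apply (Cder_csum (fun j t => integrand i j t * _)). intros j. apply He. lra.
  - intros N t Ht.
    assert (Hz : (0 < Im (tau + Ci * RtoC t))%R) by (rewrite Im_ray; lra).
    rewrite (F_spec _ Hz), a0_eisenstein.
    set (X := (Ci * RtoC t) ^ (k - 2) * Ci).
    assert (Eh : h N t = c * X * csum (fun i => csum (fun j => integrand i j t) N) N).
    { unfold h. fold X. rewrite <- Cmult_assoc. f_equal. rewrite <- csum_scal.
      apply csum_ext. intros i _. rewrite <- csum_scal. apply csum_ext. intros j _. ring. }
    rewrite Eh.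
    set (S := csum (fun i => csum (fun j => integrand i j t) N) N).
    set (E := eisenstein k chi psi (tau + Ci * RtoC t)).
    replace (c * X * S - (c * E - c * eisenstein_constant k chi psi) * (Ci * RtoC t) ^ (k - 2) * Ci)
      with (c * X * (S - (E - eisenstein_constant k chi psi))) by (unfold X; ring).
    rewrite !Cmod_mult.
    apply Rmult_le_compat; try apply Rmult_le_pos; try apply Cmod_ge_0.
    + apply Rmult_le_compat_l. apply Cmod_ge_0. unfold X.
      rewrite Cmod_mult, Cmod_pow, Cmod_mult, Cmod_Ci, Cmod_R, Rabs_pos_eq by lra.
      rewrite Rmult_1_l, Rmult_1_r. apply pow_incr. lra.
    + unfold S. apply dominated_box_rate with
        (fun i => 2 * chi (Z.of_nat (Datatypes.S i))
                  * lattice_sum psi k (m_of i * (tau + Ci * RtoC t))); auto using weight_pos, ex_series_weight.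
      * intros; apply Rmult_le_pos; auto using weight_pos.
      * apply ex_series_Rscal, ex_series_weight.
      * intros i. unfold integrand. apply Csum_scal. apply (lattice_sum_correct M); auto; [|lia].
        unfold m_of. rewrite Im_nat_mult. apply Rmult_lt_0_compat; auto. apply lt_0_INR; lia.
      * unfold E. now apply (eisenstein_expansion k L M).
  - replace (Finite 0) with (Rbar_mult (Cmod c * T ^ (k - 2))%R (U * 0 + V * 0)%R)
      by (simpl; f_equal; ring).
    apply is_lim_seq_scal_l. apply is_lim_seq_plus'.
    + apply (is_lim_seq_scal_l _ U (Finite 0)). apply rsum_tail, ex_series_weight.
    + apply (is_lim_seq_scal_l _ V (Finite 0)). apply rsum_tail.
      apply ex_series_Rscal, ex_series_weight.
  - apply Clim_ext with (fun N => c * csum (fun i => csum (fun j => prim i j T) N) N).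
    + intros N. unfold H.
      rewrite (csum_ext (fun i => csum (fun j => prim i j 0) N) (fun _ => 0)), csum_zero.
      * ring.
      * intros i _. rewrite (csum_ext _ (fun _ => 0)), csum_zero; auto.
        intros j _. apply primitive_integral_0.
    + now apply Clim_scal.
Qed.

Lemma pow_INR_S_bound (i : nat) : (/ INR (S i) ^ (k - 1) <= / INR (S i))%R.
Proof.
  apply Rinv_le_contravar. apply lt_0_INR; lia.
  rewrite <- (pow_1 (INR (S i))) at 1. apply Rle_pow. apply INR_S_ge_1. lia.
Qed.

(** By [tail_sum_limit] the integral up to T differs from the claimed value by at most D / T. The
    added constant cancels the limit of [lattice_sum psi 1] at i oo, so the bracket decays like
    1/m. *)
Lemma tilde_eisenstein :
  exists S,
    Csum (fun i => chi (Z.of_nat (Datatypes.S i)) / RtoC (INR (Datatypes.S i)) ^ (k - 1)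
            * (lattice_sum psi 1 (RtoC (INR (Datatypes.S i)) * tau)
               + RtoC PI * Ci * epsilon_char psi)) S
    /\ tilde k F tau = c * (2 / RtoC (INR (k - 1)) * S).
Proof.
  destruct (primitive_bounded L chi chi_primitive) as [B1 [HB1 HB1']].
  destruct (lattice_sum_bounds M psi (Im tau) 1 psi_primitive tau_upper) as [K1 [HK1 HL1]].
  set (a := fun i => chi (Z.of_nat (S i)) / m_of i ^ (k - 1)).
  assert (Ha : forall i, (Cmod (a i) <= B1 * / INR (S i))%R).
  { intros i. unfold a, Cdiv. rewrite Cmod_mult, Cmod_inv, Cmod_pow
      by (apply Cpow_nz, m_of_neq_0).
    unfold m_of. rewrite Cmod_R, Rabs_pos_eq by apply pos_INR.
    apply Rmult_le_compat; auto using Cmod_ge_0. left; apply Rinv_0_lt_compat, pow_lt, lt_0_INR; lia.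
    apply pow_INR_S_bound. }
  assert (Hterm : forall i x K, (Cmod x <= K / INR (S i))%R -> (0 <= K)%R ->
             (Cmod (a i * x)%C <= B1 * K * weight i)%R).
  { intros i x K Hx HK. rewrite Cmod_mult.
    assert (P : (0 < / INR (S i))%R) by (apply Rinv_0_lt_compat, lt_0_INR; lia).
    apply Rle_trans with ((B1 * / INR (S i)) * (K / INR (S i)))%R.
    - apply Rmult_le_compat; auto using Cmod_ge_0.
    - replace (B1 * / INR (S i) * (K / INR (S i)))%R with (B1 * K * / INR (S i) ^ 2)%R
        by (field; apply not_0_INR; lia).
      apply Rmult_le_compat_l. now apply Rmult_le_pos. apply weight_ge_inv_square. }
  destruct (Csum_exists (fun i => a i * (lattice_sum psi 1 (m_of i * tau)
                + RtoC PI * Ci * epsilon_char psi)) (fun i => B1 * (K1 / Im tau) * weight i)%R)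
    as [S HS].
  { intros i. pose proof (INR_S_ge_1 i) as Hi. apply Hterm.
    - specialize (HL1 1%nat (m_of i * tau) ltac:(lia)). unfold m_of in HL1 at 1.
      rewrite Im_nat_mult in HL1. specialize (HL1 ltac:(nra)).
      simpl lattice_limit in HL1. rewrite pow_1 in HL1. unfold m_of in HL1 at 2.
      rewrite Im_nat_mult in HL1.
      replace (lattice_sum psi 1 (m_of i * tau) + RtoC PI * Ci * epsilon_char psi)
        with (lattice_sum psi 1 (m_of i * tau) - - (RtoC PI * Ci * epsilon_char psi)) by ring.
      replace (K1 / Im tau / INR (Datatypes.S i))%R with (K1 / (INR (Datatypes.S i) * Im tau))%R
        by (field; split; lra).
      exact HL1.
    - apply Rmult_le_pos; auto. left; now apply Rinv_0_lt_compat. }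
  { apply ex_series_Rscal, ex_series_weight. }
  exists S. split; auto.
  destruct tail_sum_limit as [K2 [HK2 HT2]].
  set (D := (Cmod c * Cmod (2 / RtoC (INR (k - 1))) * (B1 * K2 * Series weight))%R).
  assert (HJ : forall T J, (0 < T)%R -> Csum (fun i => row i T) J ->
            (Cmod (c * J - c * (2 / RtoC (INR (k - 1)) * S)) <= D / T)%R).
  { intros T J HT HJ.
    assert (HD : Csum (fun i => 2 / RtoC (INR (k - 1))
               * (a i * (- (tail_sum i T + RtoC PI * Ci * epsilon_char psi))))
               (J - 2 / RtoC (INR (k - 1)) * S)).
    { apply Csum_ext with (2 := Csum_minus _ _ _ _ HJ (Csum_scal _ _ _ HS)).
      intros i. unfold row. fold (a i). ring. }
    replace (c * J - c * (2 / RtoC (INR (k - 1)) * S))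
      with (c * (J - 2 / RtoC (INR (k - 1)) * S)) by ring.
    rewrite Cmod_mult. unfold D, Rdiv. rewrite !Rmult_assoc.
    apply Rmult_le_compat_l. apply Cmod_ge_0.
    replace (Cmod (2 / RtoC (INR (k - 1))) * (B1 * (K2 * (Series weight * / T))))%R
      with ((Cmod (2 / RtoC (INR (k - 1))) * (B1 * (K2 / T))) * Series weight)%R
      by (field; lra).
    rewrite <- Series_scal_l.
    apply Csum_norm_le with (2 := ex_series_Rscal _ _ ex_series_weight) (3 := HD).
    intros i. rewrite Cmod_mult, Rmult_assoc. apply Rmult_le_compat_l. apply Cmod_ge_0.
    apply Hterm.
    - rewrite Cmod_opp. specialize (HT2 i T HT).
      replace (K2 / T / INR (Datatypes.S i))%R with (K2 / (INR (Datatypes.S i) * T))%R; auto.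
      field. split. lra. apply not_0_INR; lia.
    - apply Rmult_le_pos; auto. left; now apply Rinv_0_lt_compat. }
  unfold tilde.
  apply (is_RInt_gen_unique (V := C_R_CompleteNormedModule)).
  intros P HP0. destruct (proj1 (locally_Cmod _ P) HP0) as [e [He HP]].
  assert (HD0 : (0 <= D)%R).
  { unfold D. repeat apply Rmult_le_pos; auto using Cmod_ge_0.
    apply Rle_trans with (rsum weight 0). simpl; lra.
    apply rsum_le_Series; auto using weight_pos, ex_series_weight. }
  apply (Filter_prod _ _ _ (fun x => x = 0%R) (fun T => (D / e < T)%R)).
  - reflexivity.
  - now exists (D / e)%R.
  - intros x T -> HT. simpl fst. simpl snd.
    assert (HT0 : (0 < T)%R).
    { apply Rle_lt_trans with (2 := HT). apply Rmult_le_pos; auto.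
      left; now apply Rinv_0_lt_compat. }
    destruct (integral_finite T ltac:(lra)) as [J [HJ1 HJ2]].
    exists (c * J). split; auto. apply HP.
    apply Rle_lt_trans with (1 := HJ T J HT0 HJ1).
    apply Rmult_lt_reg_r with T; auto. replace (D / T * T)%R with D by (field; lra).
    apply Rmult_lt_reg_r with (/ e)%R. now apply Rinv_0_lt_compat.
    replace (e * T * / e)%R with T by (field; lra). exact HT.
Qed.

End Tilde.

(** * The double series *)

Lemma Clim_mult (u v : nat -> C) (a b : C) :
  Clim u a -> Clim v b -> Clim (fun n => u n * v n) (a * b).
Proof.
  intros Hu Hv.
  apply Clim_bound with (fun n => Cmod (u n - a) * Cmod (v n - b)
     + (Cmod a * Cmod (v n - b) + Cmod b * Cmod (u n - a)))%R.
  - intros n. replace (u n * v n - a * b)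
      with ((u n - a) * (v n - b) + (a * (v n - b) + b * (u n - a))) by ring.
    eapply Rle_trans; [apply Cmod_triangle|]. rewrite Cmod_mult. apply Rplus_le_compat_l.
    eapply Rle_trans; [apply Cmod_triangle|]. rewrite !Cmod_mult. lra.
  - replace (Finite 0) with (Finite (0 * 0 + (Cmod a * 0 + Cmod b * 0))) by (f_equal; ring).
    apply is_lim_seq_plus'. now apply is_lim_seq_mult'.
    apply is_lim_seq_plus'.
    + now apply (is_lim_seq_scal_l _ (Cmod a) (Finite 0)).
    + now apply (is_lim_seq_scal_l _ (Cmod b) (Finite 0)).
Qed.

Lemma Clim_csum (u : nat -> nat -> C) (l : nat -> C) (n : nat) :
  (forall i, (i < n)%nat -> Clim (u i) (l i)) ->
  Clim (fun N => csum (fun i => u i N) n) (csum l n).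
Proof.
  induction n; simpl; intros H. apply Clim_const. apply Clim_plus; auto.
Qed.

Lemma zpair_S (f : Z -> C) (j : nat) :
  zpair f (S j) = f (Z.of_nat (S j)) + f (- Z.of_nat (S j))%Z.
Proof. reflexivity. Qed.

Lemma IZR_of_nat_C (n : nat) : RtoC (IZR (Z.of_nat n)) = RtoC (INR n).
Proof. now rewrite INR_IZR_INZ. Qed.

Lemma IZR_opp_of_nat_C (n : nat) : RtoC (IZR (- Z.of_nat n)) = - RtoC (INR n).
Proof. now rewrite opp_IZR, RtoC_opp, IZR_of_nat_C. Qed.

(** The subtracted terms cancel one power: the left side equals -1/(u^(q+1) v (u+v)) + (-1)^q/(u
    v^(q+1) (u+v)). Passing from q to q + 1 multiplies by -1/v and adds one monomial. As i < q, both
    exponents on the right are at least 2, so the resulting L-series converge absolutely. *)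
Lemma kernel_identity (u v : C) (q : nat) :
  u <> 0 -> v <> 0 -> u + v <> 0 ->
  / u ^ (q + 2) * (/ (u + v) - / v) + (- (1)) ^ (q + 3) * / v ^ (q + 2) * (/ (u + v) - / u)
  = csum (fun i => (- (1)) ^ (q - i) / (u ^ (i + 2) * v ^ (q - i + 1))) q.
Proof.
  intros Hu Hv Huv.
  assert (P : forall q, / u ^ (q + 2) * (/ (u + v) - / v)
     + (- (1)) ^ (q + 3) * / v ^ (q + 2) * (/ (u + v) - / u)
     = - / (u ^ S q * v * (u + v)) + (- (1)) ^ q / (u * v ^ S q * (u + v))).
  { intros p. replace (p + 2)%nat with (S (S p)) by lia. replace (p + 3)%nat with (S (S (S p))) by lia.
    rewrite !Cpow_S. field. repeat split; auto; now apply Cpow_nz. }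
  rewrite P. clear P. induction q.
  - simpl. field. auto.
  - change (csum (fun i => (- (1)) ^ (S q - i) / (u ^ (i + 2) * v ^ (S q - i + 1))) (S q))
      with (csum (fun i => (- (1)) ^ (S q - i) / (u ^ (i + 2) * v ^ (S q - i + 1))) q
            + (- (1)) ^ (S q - q) / (u ^ (q + 2) * v ^ (S q - q + 1))).
    rewrite (csum_ext _ (fun i => - / v * ((- (1)) ^ (q - i) / (u ^ (i + 2) * v ^ (q - i + 1))))).
    2:{ intros i Hi. replace (S q - i)%nat with (S (q - i)) by lia.
        replace (S (q - i) + 1)%nat with (S (q - i + 1)) by lia. rewrite !Cpow_S. field.
        repeat split; auto; now apply Cpow_nz. }
    rewrite csum_scal, <- IHq.
    replace (S q - q)%nat with 1%nat by lia. replace (q + 2)%nat with (S (S q)) by lia.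
    replace (v ^ (1 + 1)) with (v * v) by (simpl; ring). rewrite Cpow_1_r, !Cpow_S. field.
    repeat split; auto; now apply Cpow_nz.
Qed.

(** Amounts to sqrt (m n) <= m + n. *)
Lemma inv_product_le_weights (i j : nat) :
  (/ (INR (S i) * INR (S j) * (INR (S i) + INR (S j))) <= weight i * weight j)%R.
Proof.
  pose proof (INR_S_ge_1 i) as Hi. pose proof (INR_S_ge_1 j) as Hj.
  set (m := INR (S i)) in *. set (n := INR (S j)) in *.
  assert (P : (0 < m * n)%R) by nra.
  unfold weight. fold m n. rewrite Rpower_mult_distr, Rpower_Ropp by lra.
  apply Rinv_le_contravar. apply exp_pos.
  replace (3 / 2)%R with (1 + / 2)%R by lra. rewrite Rpower_plus, Rpower_1, Rpower_sqrt by auto.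
  apply Rmult_le_compat_l; [lra|].
  rewrite <- (sqrt_pow2 (m + n)) by lra. apply sqrt_le_1_alt. nra.
Qed.

Lemma Cpowz_of_nat (X : C) (n : nat) : Cpowz X (Z.of_nat n) = X ^ n.
Proof.
  destruct n; [reflexivity|]. simpl Z.of_nat. unfold Cpowz. now rewrite SuccNat2Pos.id_succ.
Qed.

Lemma Im_opp_inv_pos (X : C) : (0 < Im X)%R -> (0 < Im (- (1) / X))%R.
Proof.
  destruct X as [x y]. intros Hy. change (0 < y)%R in Hy.
  assert (P : (0 < x ^ 2 + y ^ 2)%R) by nra.
  replace (Im (- (1) / (x, y))) with (y / (x ^ 2 + y ^ 2))%R.
  - now apply Rdiv_lt_0_compat.
  - simpl. simpl in P. field. lra.
Qed.

Section Combination.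

(** With k = q + 3 the exponents k - 1, k - 2 and k - 3 are written without truncated
    subtraction. *)
Variables (q : nat) (L M : Z) (chi psi : Z -> C) (X : C).
Let k := (q + 3)%nat.
Hypothesis chi_primitive : primitive_character L chi.
Hypothesis psi_primitive : primitive_character M psi.
Hypothesis parity : chi (-1)%Z * psi (-1)%Z = (- (1)) ^ k.
Hypothesis X_upper : (0 < Im X)%R.

Let Lchi (j : nat) : C := dirichlet_L chi (RtoC (INR j)).
Let Lpsi (j : nat) : C := dirichlet_L psi (RtoC (INR j)).
Let mC (i : nat) : C := RtoC (INR (S i)).
Let chi_ (i : nat) : C := chi (Z.of_nat (S i)).
Let psi_ (i : nat) : C := psi (Z.of_nat (S i)).

Lemma mC_neq_0 (i : nat) : mC i <> 0.
Proof. apply RtoC_neq_0, not_0_INR. lia. Qed.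

Lemma X_neq_0 : X <> 0.
Proof. intros E. rewrite E in X_upper. simpl in X_upper. lra. Qed.

Lemma mX_plus_neq_0 (i j : nat) : mC i * X + mC j <> 0.
Proof.
  apply upper_half_neq_0. unfold mC. rewrite Im_nat_mult. pose proof (INR_S_ge_1 i). nra.
Qed.

Lemma mX_minus_neq_0 (i j : nat) : mC i * X - mC j <> 0.
Proof.
  unfold Cminus, mC. rewrite <- RtoC_opp.
  apply upper_half_neq_0. rewrite Im_nat_mult. pose proof (INR_S_ge_1 i). nra.
Qed.

(** The factor 1 - f(-1) annihilates even characters, including the trivial one whose series
    diverges; no case distinction on parity is left to the users. *)
Lemma odd_even_L1 (N : Z) (f : Z -> C) :
  primitive_character N f ->
  Csum (fun i => (1 - f (-1)%Z) * (f (Z.of_nat (S i)) / mC i))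
    ((1 - f (-1)%Z) * dirichlet_L f (RtoC (INR 1))).
Proof.
  intros Hf. destruct (dirichlet_character_parity N f (proj1 Hf)) as [E|E]; rewrite E.
  - replace ((1 - 1) * dirichlet_L f (RtoC (INR 1))) with (RtoC 0) by ring.
    apply Csum_ext with (fun _ => 0). intros; ring. apply Csum_zero.
  - apply Csum_scal.
    apply Csum_ext with (fun i => f (Z.of_nat (S i)) / RtoC (INR (S i)) ^ 1).
    { intros i. now rewrite Cpow_1_r. }
    apply (dirichlet_L_series N); auto. intros _. rewrite E. intros E'.
    apply (f_equal Re) in E'. simpl in E'. lra.
Qed.

(* Without the subtracted terms [1/n] and [1/(m X)] these double series would only
   converge conditionally, in different orders of summation. *)
Let D1 (i j : nat) : C :=
  chi_ i / mC i ^ (q + 2)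
  * (psi_ j * ((/ (mC i * X + mC j) - / mC j) + psi (-1)%Z * (/ (mC i * X - mC j) + / mC j))).

Let D2 (i j : nat) : C :=
  - psi (-1)%Z * X ^ (q + 2) * (psi_ j / mC j ^ (q + 2))
  * (chi_ i * ((/ (mC i * X - mC j) - / (mC i * X))
               - chi (-1)%Z * (/ (mC i * X + mC j) - / (mC i * X)))).

(** The terms n and -n form a symmetric lattice sum without its term n = 0, and the subtracted 1/n
    add up to (1 - psi(-1)) L(1, psi). *)
Lemma D1_row (i : nat) :
  Csum (D1 i) (chi_ i / mC i ^ (q + 2)
     * (lattice_sum psi 1 (mC i * X) - psi 0%Z / (mC i * X) - (1 - psi (-1)%Z) * Lpsi 1)).
Proof.
  assert (Hz : (0 < Im (mC i * X))%R).
  { unfold mC. rewrite Im_nat_mult. pose proof (INR_S_ge_1 i). nra. }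
  pose proof (lattice_sum_correct M psi psi_primitive (mC i * X) 1 Hz (le_n 1)) as H.
  apply Csum_scal.
  assert (H1 : Csum (fun j => zpair (fun n => psi n / (mC i * X + RtoC (IZR n)) ^ 1) (S j))
                 (lattice_sum psi 1 (mC i * X) - psi 0%Z / (mC i * X))).
  { apply Csum_shift. cbn [zpair].
    replace (psi 0%Z / (mC i * X + RtoC 0) ^ 1) with (psi 0%Z / (mC i * X))
      by (rewrite Cpow_1_r; f_equal; ring).
    replace (psi 0%Z / (mC i * X) + (lattice_sum psi 1 (mC i * X) - psi 0%Z / (mC i * X)))
      with (lattice_sum psi 1 (mC i * X)) by ring. exact H. }
  apply Csum_ext with (2 := Csum_minus _ _ _ _ H1 (odd_even_L1 M psi psi_primitive)).
  intros j. rewrite zpair_S, !Cpow_1_r.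
  rewrite (dirichlet_character_opp M psi _ (proj1 psi_primitive)).
  rewrite IZR_of_nat_C, IZR_opp_of_nat_C. fold (mC j). fold (psi_ j).
  change (mC i * X + - mC j) with (mC i * X - mC j). unfold Cdiv. ring.
Qed.

(** For fixed n, factoring X out of m X - n leaves n (-1/X) + m: the sum over m is a lattice sum at
    n (-1/X), the argument of the second integral. One power of X is used up. *)
Lemma D2_column (j : nat) :
  Csum (fun i => D2 i j) (- psi (-1)%Z * X ^ (q + 1) * (psi_ j / mC j ^ (q + 2))
     * (lattice_sum chi 1 (mC j * (- (1) / X)) + chi 0%Z * X / mC j
        - (1 - chi (-1)%Z) * Lchi 1)).
Proof.
  pose proof X_neq_0 as ZX. pose proof (mC_neq_0 j) as Zj.
  pose proof (Im_opp_inv_pos X X_upper) as Hw.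
  assert (Hz : (0 < Im (mC j * (- (1) / X)))%R).
  { unfold mC. rewrite Im_nat_mult. pose proof (INR_S_ge_1 j). nra. }
  pose proof (lattice_sum_correct L chi chi_primitive _ 1 Hz (le_n 1)) as H.
  assert (H1 : Csum (fun i => zpair (fun n => chi n / (mC j * (- (1) / X) + RtoC (IZR n)) ^ 1) (S i))
                 (lattice_sum chi 1 (mC j * (- (1) / X)) + chi 0%Z * X / mC j)).
  { apply Csum_shift. cbn [zpair].
    replace (chi 0%Z / (mC j * (- (1) / X) + RtoC 0) ^ 1) with (- (chi 0%Z * X / mC j)).
    2:{ rewrite Cpow_1_r. replace (mC j * (- (1) / X) + RtoC 0) with (mC j * (- (1) / X)) by ring.
        field. split; auto. }
    replace (- (chi 0%Z * X / mC j) + (lattice_sum chi 1 (mC j * (- (1) / X)) + chi 0%Z * X / mC j))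
      with (lattice_sum chi 1 (mC j * (- (1) / X))) by ring. exact H. }
  apply Csum_ext with (2 := Csum_scal (- psi (-1)%Z * X ^ (q + 1) * (psi_ j / mC j ^ (q + 2))) _ _
     (Csum_minus _ _ _ _ H1 (odd_even_L1 L chi chi_primitive))).
  intros i. rewrite zpair_S, !Cpow_1_r.
  rewrite (dirichlet_character_opp L chi _ (proj1 chi_primitive)).
  rewrite IZR_of_nat_C, IZR_opp_of_nat_C. fold (mC i). fold (chi_ i). unfold D2.
  pose proof (mX_plus_neq_0 i j) as N1. pose proof (mX_minus_neq_0 i j) as N2.
  pose proof (mC_neq_0 i) as Zi.
  replace (q + 2)%nat with (S (q + 1)) by lia. rewrite !(Cpow_S X).
  replace (/ (mC i * X - mC j)) with (/ X * / (mC j * (- (1) / X) + mC i)).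
  2:{ rewrite <- Cinv_mult_total. f_equal. field. auto. }
  replace (/ (mC i * X + mC j)) with (- (/ X * / (mC j * (- (1) / X) + - mC i))).
  2:{ rewrite <- Cinv_mult_total. replace (X * (mC j * (- (1) / X) + - mC i)) with (- (mC i * X + mC j))
        by (field; auto). field. auto. }
  rewrite (Cinv_mult_total (mC i) X). unfold Cdiv.
  set (t1 := / (mC j * (- (1) * / X) + mC i)). set (t2 := / (mC j * (- (1) * / X) + - mC i)).
  transitivity (- psi (-1)%Z * (X * / X) * X ^ (q + 1) * (psi_ j * / mC j ^ S (q + 1)) *
    (chi_ i * t1 + chi (-1)%Z * chi_ i * t2 - (1 - chi (-1)%Z) * (chi_ i * / mC i))).
  - rewrite Cinv_r by auto. ring.
  - ring.
Qed.

(** [kernel_identity] with u = m X is applied to v = n and to v = -n. The second, weighted by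
    psi(-1), produces the parity factor of each monomial. *)
Lemma D1_plus_D2 (i j : nat) :
  D1 i j + D2 i j
  = csum (fun s => (1 + psi (-1)%Z * (- (1)) ^ (q - s + 1)) * (- X) ^ (q - s)
                   * ((chi_ i / mC i ^ (s + 2)) * (psi_ j / mC j ^ (q - s + 1)))) q.
Proof.
  pose proof X_neq_0 as ZX. pose proof (mC_neq_0 i) as Zi. pose proof (mC_neq_0 j) as Zj.
  pose proof (mX_plus_neq_0 i j) as N1. pose proof (mX_minus_neq_0 i j) as N2.
  assert (Zu : mC i * X <> 0).
  { intros E. apply Zi. replace (mC i) with (mC i * X * / X) by (field; auto). rewrite E. ring. }
  assert (Zj' : - mC j <> 0).
  { intros E. apply Zj. replace (mC j) with (- - mC j) by ring. rewrite E. ring. }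
  pose proof (kernel_identity (mC i * X) (mC j) q Zu Zj N1) as K1.
  pose proof (kernel_identity (mC i * X) (- mC j) q Zu Zj' N2) as K2.
  transitivity (X ^ (q + 2) * (chi_ i * psi_ j) *
     ((/ (mC i * X) ^ (q + 2) * (/ (mC i * X + mC j) - / mC j)
       + (- (1)) ^ (q + 3) * / mC j ^ (q + 2) * (/ (mC i * X + mC j) - / (mC i * X)))
      + psi (-1)%Z * (/ (mC i * X) ^ (q + 2) * (/ (mC i * X + - mC j) - / - mC j)
       + (- (1)) ^ (q + 3) * / (- mC j) ^ (q + 2) * (/ (mC i * X + - mC j) - / (mC i * X))))).
  - unfold D1, D2. change (mC i * X - mC j) with (mC i * X + - mC j).
    assert (E1 : / - mC j = - / mC j) by (field; auto).
    assert (E2 : X ^ (q + 2) * / (mC i * X) ^ (q + 2) = / mC i ^ (q + 2)).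
    { rewrite Cpow_mult_l. field. split; now apply Cpow_nz. }
    assert (E3 : (- (1)) ^ (q + 3) * / (- mC j) ^ (q + 2) = - / mC j ^ (q + 2)).
    { rewrite (pow_opp (mC j)), Cinv_mult_total. replace (q + 3)%nat with (S (q + 2)) by lia.
      rewrite Cpow_S. field. split. now apply Cpow_nz. apply pow_m1_neq_0. }
    rewrite E3, E1. unfold k in parity. rewrite <- parity.
    unfold Cdiv. rewrite <- E2. ring.
  - rewrite K1, K2, <- csum_scal, <- csum_plus, <- csum_scal. apply csum_ext. intros s Hs.
    rewrite (pow_opp X), (pow_opp (mC j)), Cpow_mult_l.
    replace (q + 2)%nat with ((s + 2) + (q - s))%nat by lia. rewrite (Cpow_add_r X).
    unfold Cdiv. rewrite !Cinv_mult_total.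
    replace (/ (- (1)) ^ (q - s + 1)) with ((- (1)) ^ (q - s + 1)).
    2:{ pose proof (pow_m1_neq_0 (q - s + 1)).
        replace ((- (1)) ^ (q - s + 1)) with
          ((- (1)) ^ (q - s + 1) * (- (1)) ^ (q - s + 1) * / (- (1)) ^ (q - s + 1)) at 1
          by (field; auto).
        rewrite pow_m1_square. ring. }
    transitivity ((X ^ (s + 2) * / X ^ (s + 2)) * (1 + psi (-1)%Z * (- (1)) ^ (q - s + 1))
      * ((- (1)) ^ (q - s) * X ^ (q - s)
      * (chi_ i * / mC i ^ (s + 2) * (psi_ j * / mC j ^ (q - s + 1))))); [ring|].
    rewrite Cinv_r by now apply Cpow_nz. ring.
Qed.

(** Both differences collapse: 1/(m X + n) - 1/n = -m X / (n (m X + n)), and likewise with 1/(m X).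
    Together with the outer powers every term becomes O(1/(m n (m + n))). *)
Lemma combination_bounds :
  exists K, (0 <= K)%R /\
    (forall i j, Cmod (D1 i j) <= K * weight i * weight j)%R /\
    (forall i j, Cmod (D2 i j) <= K * weight i * weight j)%R.
Proof.
  destruct (primitive_bounded L chi chi_primitive) as [B1 [HB1 HB1']].
  destruct (primitive_bounded M psi psi_primitive) as [B2 [HB2 HB2']].
  pose proof X_neq_0 as ZX. assert (PX : (0 < Cmod X)%R) by now apply Cmod_gt_0.
  set (kap := ((1 + Im X + Cmod X) / Im X)%R).
  assert (Hkap : (0 < kap)%R) by (apply Rdiv_lt_0_compat; lra).
  assert (HL : forall i (n : R), (/ Cmod (mC i * X + RtoC n) <= kap * / (INR (S i) + Rabs n))%R).
  { intros i n.
    pose proof (lattice_lower_bound X (Im X) (Cmod X) (INR (S i)) n ltac:(lra) ltac:(lra)) as H.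
    fold (mC i) in H. pose proof (INR_S_ge_1 i) as Hi. rewrite (Rabs_pos_eq (INR (S i))) in H by lra.
    pose proof (Rabs_pos n).
    set (w := Cmod (mC i * X + RtoC n)) in *. set (s := (INR (S i) + Rabs n)%R) in *.
    assert (Hs : (0 < s)%R) by (unfold s; lra).
    assert (Hw : (0 < w)%R).
    { apply Cmod_gt_0. apply upper_half_neq_0. unfold mC. rewrite Im_nat_mult. nra. }
    apply Rmult_le_reg_r with w; auto. rewrite Rinv_l by lra.
    apply Rmult_le_reg_r with (s * Im X)%R. nra.
    replace (kap * / s * w * (s * Im X))%R with (w * (1 + Im X + Cmod X))%R
      by (unfold kap; field; lra). lra. }
  assert (HLp : forall i j, (/ Cmod (mC i * X + mC j) <= kap * / (INR (S i) + INR (S j)))%R).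
  { intros i j. specialize (HL i (INR (S j))). rewrite (Rabs_pos_eq (INR (S j))) in HL by apply pos_INR.
    exact HL. }
  assert (HLm : forall i j, (/ Cmod (mC i * X - mC j) <= kap * / (INR (S i) + INR (S j)))%R).
  { intros i j. specialize (HL i (- INR (S j))%R).
    rewrite Rabs_Ropp, (Rabs_pos_eq (INR (S j))), RtoC_opp in HL by apply pos_INR. exact HL. }
  assert (Hm : forall i, Cmod (mC i) = INR (S i)).
  { intros i. unfold mC. now rewrite Cmod_R, Rabs_pos_eq by apply pos_INR. }
  assert (HP : forall i, (/ INR (S i) ^ (q + 2) * INR (S i) <= / INR (S i))%R).
  { intros i. pose proof (INR_S_ge_1 i) as Hi. replace (q + 2)%nat with (S (q + 1)) by lia.
    change (INR (S i) ^ S (q + 1))%R with (INR (S i) * INR (S i) ^ (q + 1))%R.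
    assert (0 < INR (S i) ^ (q + 1))%R by (apply pow_lt; lra).
    replace (/ (INR (S i) * INR (S i) ^ (q + 1)) * INR (S i))%R with (/ INR (S i) ^ (q + 1))%R
      by (field; split; lra).
    apply Rinv_le_contravar. lra. rewrite <- (pow_1 (INR (S i))) at 1.
    apply Rle_pow; auto. lia. }
  assert (HW : forall i j, (/ INR (S i) * (/ INR (S j) * / (INR (S i) + INR (S j)))
                            <= weight i * weight j)%R).
  { intros i j. rewrite <- !Rinv_mult, <- Rmult_assoc. apply inv_product_le_weights. }
  assert (Ps : forall f N, primitive_character N f -> Cmod (f (-1)%Z) = 1%R).
  { intros f N Hf. destruct (dirichlet_character_parity N f (proj1 Hf)) as [-> | ->].
    apply Cmod_1. apply Cmod_m1. }
  (* The two summands in X are the powers of X that remain in [D1] and in [D2]; 2 [kap] bounds the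
     two kernels with m X + n and m X - n. *)
  exists (B1 * B2 * (2 * kap) * (Cmod X + Cmod X ^ (q + 2) * / Cmod X))%R.
  assert (P1 : (0 <= Cmod X ^ (q + 2) * / Cmod X)%R).
  { apply Rmult_le_pos. apply pow_le; lra. left; now apply Rinv_0_lt_compat. }
  assert (P2 : (0 <= B1 * B2 * (2 * kap))%R).
  { apply Rmult_le_pos. now apply Rmult_le_pos. lra. }
  assert (P3 : forall i j, (0 <= weight i * weight j)%R)
    by (intros; apply Rmult_le_pos; apply weight_pos).
  split; [|split].
  - apply Rmult_le_pos; auto. lra.
  - intros i j. pose proof (INR_S_ge_1 i) as Hi. pose proof (INR_S_ge_1 j) as Hj.
    pose proof (mC_neq_0 i) as Zi. pose proof (mC_neq_0 j) as Zj.
    pose proof (mX_plus_neq_0 i j) as N1. pose proof (mX_minus_neq_0 i j) as N2.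
    assert (E : D1 i j = chi_ i * psi_ j * (/ mC i ^ (q + 2) * mC i * X * / mC j)
        * (- / (mC i * X + mC j) + psi (-1)%Z * / (mC i * X - mC j))).
    { unfold D1. field. repeat split; auto. now apply Cpow_nz. }
    rewrite E, !Cmod_mult, !Cmod_inv, Cmod_pow, !Hm by (auto; now apply Cpow_nz).
    assert (T : (Cmod (- / (mC i * X + mC j) + psi (-1)%Z * / (mC i * X - mC j))
                 <= 2 * (kap * / (INR (S i) + INR (S j))))%R).
    { eapply Rle_trans; [apply Cmod_triangle|].
      rewrite Cmod_opp, Cmod_mult, (Ps psi M psi_primitive), !Cmod_inv by auto.
      pose proof (HLp i j). pose proof (HLm i j). lra. }
    assert (Ps0 : (0 < / (INR (S i) + INR (S j)))%R) by (apply Rinv_0_lt_compat; lra).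
    assert (Pj : (0 < / INR (S j))%R) by (apply Rinv_0_lt_compat; lra).
    assert (Pi : (0 < / INR (S i) ^ (q + 2) * INR (S i))%R).
    { apply Rmult_lt_0_compat; [|lra]. apply Rinv_0_lt_compat, pow_lt; lra. }
    apply Rle_trans with (B1 * B2 * (/ INR (S i) * Cmod X * / INR (S j))
       * (2 * (kap * / (INR (S i) + INR (S j)))))%R.
    + apply Rmult_le_compat; auto using Cmod_ge_0.
      * repeat apply Rmult_le_pos; auto using Cmod_ge_0; try lra.
        left. apply Rinv_0_lt_compat, pow_lt; lra.
      * apply Rmult_le_compat.
        -- apply Rmult_le_pos; apply Cmod_ge_0.
        -- apply Rmult_le_pos; [|lra]. apply Rmult_le_pos; lra.
        -- apply Rmult_le_compat; auto using Cmod_ge_0; [apply HB1' | apply HB2'].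
        -- apply Rmult_le_compat_r; [lra|]. apply Rmult_le_compat_r; [lra|]. apply HP.
    + replace (B1 * B2 * (/ INR (S i) * Cmod X * / INR (S j))
         * (2 * (kap * / (INR (S i) + INR (S j)))))%R
        with (B1 * B2 * (2 * kap) * Cmod X
              * (/ INR (S i) * (/ INR (S j) * / (INR (S i) + INR (S j)))))%R by ring.
      rewrite !(Rmult_assoc _ (weight i) (weight j)).
      apply Rmult_le_compat.
      * apply Rmult_le_pos; auto. lra.
      * apply Rmult_le_pos; [left; apply Rinv_0_lt_compat; lra|]. apply Rmult_le_pos; lra.
      * apply Rmult_le_compat_l; auto. lra.
      * apply HW.
  - intros i j. pose proof (INR_S_ge_1 i) as Hi. pose proof (INR_S_ge_1 j) as Hj.
    pose proof (mC_neq_0 i) as Zi. pose proof (mC_neq_0 j) as Zj.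
    pose proof (mX_plus_neq_0 i j) as N1. pose proof (mX_minus_neq_0 i j) as N2.
    assert (E : D2 i j = psi (-1)%Z * (chi_ i * psi_ j
        * (X ^ (q + 2) * / X * (/ mC j ^ (q + 2) * mC j * / mC i)))
        * (- / (mC i * X - mC j) + - (chi (-1)%Z * / (mC i * X + mC j)))).
    { unfold D2. field. repeat split; auto. now apply Cpow_nz. }
    rewrite E, !Cmod_mult, !Cmod_inv, !Cmod_pow, !Hm, (Ps psi M psi_primitive), Rmult_1_l
      by (auto; now apply Cpow_nz).
    assert (T : (Cmod (- / (mC i * X - mC j) + - (chi (-1)%Z * / (mC i * X + mC j)))
                 <= 2 * (kap * / (INR (S i) + INR (S j))))%R).
    { eapply Rle_trans; [apply Cmod_triangle|].
      rewrite !Cmod_opp, Cmod_mult, (Ps chi L chi_primitive), !Cmod_inv by auto.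
      pose proof (HLp i j). pose proof (HLm i j). lra. }
    assert (Ps0 : (0 < / (INR (S i) + INR (S j)))%R) by (apply Rinv_0_lt_compat; lra).
    assert (Pj : (0 < / INR (S j))%R) by (apply Rinv_0_lt_compat; lra).
    assert (Pi : (0 < / INR (S i))%R) by (apply Rinv_0_lt_compat; lra).
    assert (Pj' : (0 < / INR (S j) ^ (q + 2) * INR (S j))%R).
    { apply Rmult_lt_0_compat; [|lra]. apply Rinv_0_lt_compat, pow_lt; lra. }
    apply Rle_trans with (B1 * B2 * (Cmod X ^ (q + 2) * / Cmod X * (/ INR (S j) * / INR (S i)))
       * (2 * (kap * / (INR (S i) + INR (S j)))))%R.
    + apply Rmult_le_compat; auto using Cmod_ge_0.
      * apply Rmult_le_pos. apply Rmult_le_pos; apply Cmod_ge_0.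
        apply Rmult_le_pos; auto. apply Rmult_le_pos; lra.
      * apply Rmult_le_compat.
        -- apply Rmult_le_pos; apply Cmod_ge_0.
        -- apply Rmult_le_pos; auto. apply Rmult_le_pos; lra.
        -- apply Rmult_le_compat; auto using Cmod_ge_0; [apply HB1' | apply HB2'].
        -- apply Rmult_le_compat_l; auto. apply Rmult_le_compat_r; [lra|]. apply HP.
    + replace (B1 * B2 * (Cmod X ^ (q + 2) * / Cmod X * (/ INR (S j) * / INR (S i)))
         * (2 * (kap * / (INR (S i) + INR (S j)))))%R
        with (B1 * B2 * (2 * kap) * (Cmod X ^ (q + 2) * / Cmod X)
              * (/ INR (S i) * (/ INR (S j) * / (INR (S i) + INR (S j)))))%R by ring.
      rewrite !(Rmult_assoc _ (weight i) (weight j)).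
      apply Rmult_le_compat.
      * apply Rmult_le_pos; auto.
      * apply Rmult_le_pos; [lra|]. apply Rmult_le_pos; lra.
      * apply Rmult_le_compat_l; auto. lra.
      * apply HW.
Qed.

Lemma L_series_chi (j : nat) :
  (2 <= j)%nat -> Csum (fun i => chi_ i / mC i ^ j) (Lchi j).
Proof. intros Hj. apply (dirichlet_L_series L); auto; lia. Qed.

Lemma L_series_psi (j : nat) :
  (2 <= j)%nat -> Csum (fun i => psi_ i / mC i ^ j) (Lpsi j).
Proof. intros Hj. apply (dirichlet_L_series M); auto; lia. Qed.

(** [D1] is evaluated by rows and [D2] by columns, each order leading to one of the given series.
    Absolute convergence equates both with limits over square boxes, where the two are added. *)
Lemma combination (S1 S2 : C) :
  Csum (fun i => chi_ i / mC i ^ (q + 2) * lattice_sum psi 1 (mC i * X)) S1 ->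
  Csum (fun j => psi_ j / mC j ^ (q + 2) * lattice_sum chi 1 (mC j * (- (1) / X))) S2 ->
  S1 - psi (-1)%Z * X ^ (q + 1) * S2
  = csum (fun s => (1 + psi (-1)%Z * (- (1)) ^ (q - s + 1)) * (- X) ^ (q - s)
                   * (Lchi (s + 2) * Lpsi (q - s + 1))) q
    + psi 0%Z / X * Lchi (q + 3) + (1 - psi (-1)%Z) * Lpsi 1 * Lchi (q + 2)
    + psi (-1)%Z * X ^ (q + 1) * (chi 0%Z * X * Lpsi (q + 3)
                                  - (1 - chi (-1)%Z) * Lchi 1 * Lpsi (q + 2)).
Proof.
  intros H1 H2. pose proof X_neq_0 as ZX.
  destruct combination_bounds as [K [HK [HD1 HD2]]].
  assert (HKw : forall i, (0 <= K * weight i)%R)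
    by (intros; apply Rmult_le_pos; auto using weight_pos).
  destruct (dominated_fubini D1 (fun i => K * weight i)%R weight HKw weight_pos HD1
              (ex_series_Rscal _ _ ex_series_weight) ex_series_weight)
    as [r1 [_ [l1 [Hr1 [_ [Hl1 [_ HB1]]]]]]].
  destruct (dominated_fubini D2 (fun i => K * weight i)%R weight HKw weight_pos HD2
              (ex_series_Rscal _ _ ex_series_weight) ex_series_weight)
    as [_ [c2 [l2 [_ [Hc2 [_ [Hl2 HB2]]]]]]].
  assert (E1 : l1 = S1 - psi 0%Z / X * Lchi (q + 3) - (1 - psi (-1)%Z) * Lpsi 1 * Lchi (q + 2)).
  { apply Csum_unique with (1 := Hl1).
    apply Csum_ext with (2 := Csum_minus _ _ _ _ (Csum_minus _ _ _ _ H1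
      (Csum_scal (psi 0%Z / X) _ _ (L_series_chi (q + 3) ltac:(lia))))
      (Csum_scal ((1 - psi (-1)%Z) * Lpsi 1) _ _ (L_series_chi (q + 2) ltac:(lia)))).
    intros i. rewrite (Csum_unique _ _ _ (Hr1 i) (D1_row i)).
    pose proof (mC_neq_0 i). replace (q + 3)%nat with (S (q + 2)) by lia. rewrite Cpow_S.
    field. repeat split; auto. now apply Cpow_nz. }
  assert (E2 : l2 = - psi (-1)%Z * X ^ (q + 1) * (S2 + chi 0%Z * X * Lpsi (q + 3)
                      - (1 - chi (-1)%Z) * Lchi 1 * Lpsi (q + 2))).
  { apply Csum_unique with (1 := Hl2).
    apply Csum_ext with (2 := Csum_scal (- psi (-1)%Z * X ^ (q + 1)) _ _
      (Csum_minus _ _ _ _ (Csum_plus _ _ _ _ H2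
      (Csum_scal (chi 0%Z * X) _ _ (L_series_psi (q + 3) ltac:(lia))))
      (Csum_scal ((1 - chi (-1)%Z) * Lchi 1) _ _ (L_series_psi (q + 2) ltac:(lia))))).
    intros j. rewrite (Csum_unique _ _ _ (Hc2 j) (D2_column j)).
    pose proof (mC_neq_0 j). replace (q + 3)%nat with (S (q + 2)) by lia. rewrite !(Cpow_S (mC j)).
    field. repeat split; auto. now apply Cpow_nz. }
  (* For each s the box sum factors into a partial sum for chi and one for psi, so its limit is a
     product of two L-values. *)
  assert (E12 : l1 + l2 = csum (fun s => (1 + psi (-1)%Z * (- (1)) ^ (q - s + 1)) * (- X) ^ (q - s)
                   * (Lchi (s + 2) * Lpsi (q - s + 1))) q).
  { apply Clim_unique with (1 := Clim_plus _ _ _ _ HB1 HB2).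
    apply Clim_ext with (fun N => csum (fun s =>
        (1 + psi (-1)%Z * (- (1)) ^ (q - s + 1)) * (- X) ^ (q - s)
        * (csum (fun i => chi_ i / mC i ^ (s + 2)) N * csum (fun j => psi_ j / mC j ^ (q - s + 1)) N)) q).
    - intros N. rewrite <- csum_plus.
      rewrite (csum_ext (fun i => csum (D1 i) N + csum (D2 i) N)
        (fun i => csum (fun s => (1 + psi (-1)%Z * (- (1)) ^ (q - s + 1)) * (- X) ^ (q - s)
           * ((chi_ i / mC i ^ (s + 2)) * csum (fun j => psi_ j / mC j ^ (q - s + 1)) N)) q)).
      + rewrite csum_swap. apply csum_ext. intros s _. rewrite csum_scal. f_equal.
        rewrite Cmult_comm, <- csum_scal. apply csum_ext. intros; ring.
      + intros i _. rewrite <- csum_plus. rewrite (csum_ext _ _ N (fun j _ => D1_plus_D2 i j)).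
        rewrite csum_swap. apply csum_ext. intros s _. now rewrite !csum_scal.
    - apply (Clim_csum (fun s N => (1 + psi (-1)%Z * (- (1)) ^ (q - s + 1)) * (- X) ^ (q - s)
        * (csum (fun i => chi_ i / mC i ^ (s + 2)) N * csum (fun j => psi_ j / mC j ^ (q - s + 1)) N))).
      intros s Hs. apply Clim_scal. apply Clim_mult.
      + apply L_series_chi. lia.
      + apply L_series_psi. lia. }
  rewrite <- E12, E1, E2. ring.
Qed.

End Combination.

(** * Comparison with the sum of L-values *)

Lemma pow_m1_cases (n : nat) : (- (1)) ^ n = 1 \/ (- (1)) ^ n = - (1).
Proof.
  induction n as [|n [E|E]]; [now left| |]; rewrite Cpow_S, E; [right|left]; ring.
Qed.

Lemma one_neq_m1 : RtoC 1 <> - (1).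
Proof. intros E. apply (f_equal Re) in E. simpl in E. lra. Qed.

(** The indices s = 0, 1, k - 1 and k are split off; they match the terms with chi(0), L(1, chi),
    L(1, psi) and psi(0). The other s are shifted by 2, and there the parity test becomes the factor
    1 + psi(-1) (-1)^(k-s), which is 2 or 0. *)
Lemma L_value_sum (q : nat) (L M : Z) (chi psi : Z -> C) (X : C) :
  primitive_character L chi -> primitive_character M psi ->
  chi (-1)%Z * psi (-1)%Z = (- (1)) ^ (q + 3) -> X <> 0 ->
  - 2 * psi (-1)%Z * csum (fun s : nat =>
       if Ceq_dec (chi (-1)%Z) ((- (1)) ^ s)
       then dirichlet_L chi (RtoC (INR s)) * dirichlet_L psi (RtoC (INR (q + 3 - s)))
            * Cpowz X (Z.of_nat (q + 3) - Z.of_nat s - 1)%Z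
       else RtoC 0) (S (q + 3))
  = csum (fun s => (1 + psi (-1)%Z * (- (1)) ^ (q - s + 1)) * (- X) ^ (q - s)
        * (dirichlet_L chi (RtoC (INR (s + 2))) * dirichlet_L psi (RtoC (INR (q - s + 1))))) q
    + psi 0%Z / X * dirichlet_L chi (RtoC (INR (q + 3)))
    + (1 - psi (-1)%Z) * dirichlet_L psi (RtoC (INR 1)) * dirichlet_L chi (RtoC (INR (q + 2)))
    + psi (-1)%Z * X ^ (q + 1) * (chi 0%Z * X * dirichlet_L psi (RtoC (INR (q + 3)))
        - (1 - chi (-1)%Z) * dirichlet_L chi (RtoC (INR 1)) * dirichlet_L psi (RtoC (INR (q + 2)))).
Proof.
  intros Hc Hp Hpar ZX.
  pose proof one_neq_m1 as N1.
  pose proof (pow_m1_neq_0 1) as Nm. rewrite Cpow_1_r in Nm.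
  set (f := fun s : nat => if Ceq_dec (chi (-1)%Z) ((- (1)) ^ s) then _ else _).
  set (mid := csum (fun i => f (2 + i)%nat) q).
  assert (ES : csum f (S (q + 3)) = f 0%nat + f 1%nat + (mid + (f (2 + (q + 0))%nat
                                                             + f (2 + (q + 1))%nat))).
  { replace (S (q + 3)) with (2 + (q + 2))%nat by lia.
    rewrite (csum_add f 2 (q + 2)), (csum_add (fun i => f (2 + i)%nat) q 2). fold mid.
    change (csum f 2) with (0 + f 0%nat + f 1%nat).
    change (csum (fun i => f (2 + (q + i))%nat) 2)
      with (0 + f (2 + (q + 0))%nat + f (2 + (q + 1))%nat). ring. }
  rewrite ES.
  (* For even chi this is L(0, chi) = -chi(0)/2; for odd chi the summand is absent and chi(0) =
     0. *)
  assert (E0 : - 2 * psi (-1)%Z * f 0%nat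
    = psi (-1)%Z * X ^ (q + 1) * (chi 0%Z * X * dirichlet_L psi (RtoC (INR (q + 3))))).
  { unfold f. rewrite Nat.sub_0_r.
    replace (Z.of_nat (q + 3) - Z.of_nat 0 - 1)%Z with (Z.of_nat (S (q + 1))) by lia.
    rewrite Cpowz_of_nat, Cpow_S. change ((- (1)) ^ 0) with (RtoC 1).
    destruct (Ceq_dec (chi (-1)%Z) 1) as [E|E].
    - simpl (INR 0). rewrite (dirichlet_L_even_0 L chi Hc E). field.
    - destruct (dirichlet_character_parity L chi (proj1 Hc)) as [E'|E']; [contradiction|].
      assert (Z0 : chi 0%Z = 0).
      { pose proof (dirichlet_character_opp L chi 0 (proj1 Hc)) as H. simpl in H. rewrite E' in H.
        replace (chi 0%Z) with (/ 2 * (chi 0%Z - - (1) * chi 0%Z)) by field.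
        rewrite <- H. ring. }
      rewrite Z0. ring. }
  assert (E1 : - 2 * psi (-1)%Z * f 1%nat
    = - psi (-1)%Z * X ^ (q + 1) * ((1 - chi (-1)%Z) * dirichlet_L chi (RtoC (INR 1))
         * dirichlet_L psi (RtoC (INR (q + 2))))).
  { unfold f. replace (q + 3 - 1)%nat with (q + 2)%nat by lia.
    replace (Z.of_nat (q + 3) - Z.of_nat 1 - 1)%Z with (Z.of_nat (q + 1)) by lia.
    rewrite Cpowz_of_nat, Cpow_1_r.
    destruct (Ceq_dec (chi (-1)%Z) (- (1))) as [E|E].
    - rewrite E. ring.
    - destruct (dirichlet_character_parity L chi (proj1 Hc)) as [E'|E']; [|contradiction].
      rewrite E'. ring. }
  (* The parity hypothesis translates the test on chi at s into the test on psi at n = k - s. *)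
  assert (P : forall n s, (n + s = q + 3)%nat ->
            chi (-1)%Z = (- (1)) ^ s <-> psi (-1)%Z = (- (1)) ^ n).
  { intros n s Ens. pose proof Hpar as H. rewrite <- Ens, Cpow_add_r in H.
    pose proof (pow_m1_square s) as Qs. pose proof (pow_m1_square n) as Qn. split; intros E.
    - transitivity ((- (1)) ^ s * (- (1)) ^ s * psi (-1)%Z); [rewrite Qs; ring|].
      rewrite <- E at 2. rewrite <- Cmult_assoc, H.
      transitivity ((- (1)) ^ s * (- (1)) ^ s * (- (1)) ^ n); [ring|]. rewrite Qs; ring.
    - transitivity ((- (1)) ^ n * (- (1)) ^ n * chi (-1)%Z); [rewrite Qn; ring|].
      rewrite <- E at 2. rewrite <- Cmult_assoc, (Cmult_comm (psi _)), H.
      transitivity ((- (1)) ^ n * (- (1)) ^ n * (- (1)) ^ s); [ring|]. rewrite Qn; ring. }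
  assert (E2 : - 2 * psi (-1)%Z * f (2 + (q + 0))%nat
    = (1 - psi (-1)%Z) * dirichlet_L psi (RtoC (INR 1)) * dirichlet_L chi (RtoC (INR (q + 2)))).
  { replace (2 + (q + 0))%nat with (q + 2)%nat by lia.
    unfold f. replace (q + 3 - (q + 2))%nat with 1%nat by lia.
    replace (Z.of_nat (q + 3) - Z.of_nat (q + 2) - 1)%Z with (Z.of_nat 0) by lia.
    rewrite Cpowz_of_nat. simpl (X ^ 0).
    pose proof (P 1%nat (q + 2)%nat ltac:(lia)) as P1. rewrite Cpow_1_r in P1.
    destruct (Ceq_dec (chi (-1)%Z) ((- (1)) ^ (q + 2))) as [E|E].
    - apply P1 in E. rewrite E. ring.
    - destruct (dirichlet_character_parity M psi (proj1 Hp)) as [E'|E']; [|tauto].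
      rewrite E'. ring. }
  assert (E3 : - 2 * psi (-1)%Z * f (2 + (q + 1))%nat
    = psi 0%Z / X * dirichlet_L chi (RtoC (INR (q + 3)))).
  { replace (2 + (q + 1))%nat with (q + 3)%nat by lia.
    unfold f. replace (q + 3 - (q + 3))%nat with 0%nat by lia.
    replace (Z.of_nat (q + 3) - Z.of_nat (q + 3) - 1)%Z with (-1)%Z by lia.
    replace (Cpowz X (-1)) with (/ X) by (simpl; f_equal; ring).
    pose proof (P 0%nat (q + 3)%nat ltac:(lia)) as P0. change ((- (1)) ^ 0) with (RtoC 1) in P0.
    destruct (Ceq_dec (chi (-1)%Z) ((- (1)) ^ (q + 3))) as [E|E].
    - apply P0 in E. simpl (INR 0). rewrite (dirichlet_L_even_0 M psi Hp E), E. field. auto.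
    - destruct (dirichlet_character_parity M psi (proj1 Hp)) as [E'|E']; [tauto|].
      assert (Z0 : psi 0%Z = 0).
      { pose proof (dirichlet_character_opp M psi 0 (proj1 Hp)) as H. simpl in H. rewrite E' in H.
        replace (psi 0%Z) with (/ 2 * (psi 0%Z - - (1) * psi 0%Z)) by field.
        rewrite <- H. ring. }
      rewrite Z0. unfold Cdiv. ring. }
  assert (EM : - 2 * psi (-1)%Z * mid
    = csum (fun s => (1 + psi (-1)%Z * (- (1)) ^ (q - s + 1)) * (- X) ^ (q - s)
        * (dirichlet_L chi (RtoC (INR (s + 2))) * dirichlet_L psi (RtoC (INR (q - s + 1))))) q).
  { unfold mid. rewrite <- csum_scal. apply csum_ext. intros s Hs.
    replace (2 + s)%nat with (s + 2)%nat by lia. unfold f.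
    replace (q + 3 - (s + 2))%nat with (q - s + 1)%nat by lia.
    replace (Z.of_nat (q + 3) - Z.of_nat (s + 2) - 1)%Z with (Z.of_nat (q - s)) by lia.
    rewrite Cpowz_of_nat, (pow_opp X).
    pose proof (P (q - s + 1)%nat (s + 2)%nat ltac:(lia)) as P1.
    assert (Eq : (- (1)) ^ (q - s + 1) = - (- (1)) ^ (q - s)).
    { rewrite Nat.add_1_r, Cpow_S. ring. }
    destruct (Ceq_dec (chi (-1)%Z) ((- (1)) ^ (s + 2))) as [E|E].
    - apply P1 in E. rewrite E, Eq.
      pose proof (pow_m1_square (q - s)) as Sq.
      transitivity (2 * (- (1)) ^ (q - s) * X ^ (q - s)
        * (dirichlet_L chi (RtoC (INR (s + 2))) * dirichlet_L psi (RtoC (INR (q - s + 1))))); [ring|].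
      replace (- (- (1)) ^ (q - s) * - (- (1)) ^ (q - s)) with ((- (1)) ^ (q - s) * (- (1)) ^ (q - s))
        by ring. rewrite Sq. ring.
    - assert (E' : 1 + psi (-1)%Z * (- (1)) ^ (q - s + 1) = 0).
      { destruct (dirichlet_character_parity M psi (proj1 Hp)) as [E'|E'];
        destruct (pow_m1_cases (q - s + 1)) as [E''|E''];
          first [exfalso; apply E; apply P1; congruence | rewrite E', E''; ring]. }
      rewrite E'. ring. }
  transitivity (- 2 * psi (-1)%Z * f 0%nat + - 2 * psi (-1)%Z * f 1%nat
    + (- 2 * psi (-1)%Z * mid + (- 2 * psi (-1)%Z * f (2 + (q + 0))%nat
       + - 2 * psi (-1)%Z * f (2 + (q + 1))%nat))); [ring|].
  rewrite E0, E1, E2, E3, EM. ring.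
Qed.

Theorem theorem4 :
  forall (k : nat) (L M : Z) (chi psi : Z -> C),
    (3 <= k)%nat ->
    primitive_character L chi ->
    primitive_character M psi ->
    chi (-1)%Z * psi (-1)%Z = (- (1)) ^ k ->
    forall X : C, (0 < Im X)%R ->
      period_function k (eisenstein k chi psi) X
      = - (4 * psi (-1)%Z / RtoC (INR (k - 1)))
          * sum_n (G := C_AbelianMonoid)
              (fun s : nat =>
                 if Ceq_dec (chi (-1)%Z) ((- (1)) ^ s)
                 then dirichlet_L chi (RtoC (INR s))
                      * dirichlet_L psi (RtoC (INR (k - s)))
                      * Cpowz X (Z.of_nat k - Z.of_nat s - 1)%Z
                 else RtoC 0) k
        - 2 * psi (-1)%Z / RtoC (INR (k - 1)) * RtoC PI * Ci
          * (epsilon_char chi * dirichlet_L psi (RtoC (INR (k - 1)))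
               * X ^ (k - 2)
             - epsilon_char psi * dirichlet_L chi (RtoC (INR (k - 1)))).
Proof.
  intros k L M chi psi Hk Hc Hp Hpar X HX.
  assert (Hq : exists q, k = (q + 3)%nat) by (exists (k - 3)%nat; lia).
  destruct Hq as [q ->].
  assert (ZX : X <> 0) by (intros E; rewrite E in HX; simpl in HX; lra).
  assert (Zk : RtoC (INR (q + 3 - 1)) <> 0) by (apply RtoC_neq_0, not_0_INR; lia).
  assert (Hpar' : psi (-1)%Z * chi (-1)%Z = (- (1)) ^ (q + 3)) by (rewrite <- Hpar; ring).
  pose proof (Im_opp_inv_pos X HX) as HX'.
  destruct (tilde_eisenstein (q + 3) L M chi psi Hk Hc Hp Hpar
              (eisenstein (q + 3) chi psi) 1 ltac:(intros; ring) X HX) as [T1 [H1 E1]].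
  destruct (tilde_eisenstein (q + 3) M L psi chi Hk Hp Hc Hpar'
              (slash (q + 3) (eisenstein (q + 3) chi psi) (SL2Z_inv SL2Z_S)) (psi (-1)%Z)
              (fun z => eisenstein_slash (q + 3) L M chi psi z Hk Hc Hp Hpar) _ HX')
    as [T2 [H2 E2]].
  replace (q + 3 - 1)%nat with (q + 2)%nat in * by lia.
  pose proof (dirichlet_L_series L chi (q + 2) Hc ltac:(lia) ltac:(lia)) as Lc.
  pose proof (dirichlet_L_series M psi (q + 2) Hp ltac:(lia) ltac:(lia)) as Lp.
  set (e1 := RtoC PI * Ci * epsilon_char psi) in *.
  set (e2 := RtoC PI * Ci * epsilon_char chi) in *.
  (* The constants PI i epsilon multiply the convergent series of L(k - 1, chi) and L(k - 1, psi)
     and can be separated; they become the bracket of the theorem. *)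
  assert (C1 : Csum (fun i => chi (Z.of_nat (S i)) / RtoC (INR (S i)) ^ (q + 2)
                  * lattice_sum psi 1 (RtoC (INR (S i)) * X))
                (T1 - e1 * dirichlet_L chi (RtoC (INR (q + 2))))).
  { apply Csum_ext with (2 := Csum_minus _ _ _ _ H1 (Csum_scal e1 _ _ Lc)). intros i. ring. }
  assert (C2 : Csum (fun i => psi (Z.of_nat (S i)) / RtoC (INR (S i)) ^ (q + 2)
                  * lattice_sum chi 1 (RtoC (INR (S i)) * (- (1) / X)))
                (T2 - e2 * dirichlet_L psi (RtoC (INR (q + 2))))).
  { apply Csum_ext with (2 := Csum_minus _ _ _ _ H2 (Csum_scal e2 _ _ Lp)). intros i. ring. }
  pose proof (combination q L M chi psi X Hc Hp Hpar HX _ _ C1 C2) as HC.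
  pose proof (L_value_sum q L M chi psi X Hc Hp Hpar ZX) as HS.
  cbv zeta beta in HC. rewrite <- HS, (csum_sum_n _ (q + 3)) in HC. clear HS.
  (* The theorem has a factor psi(-1) in front of the term with epsilon_psi, the computation has
     none; they agree as epsilon_psi is nonzero only for psi = 1. *)
  assert (Epsi : psi (-1)%Z * epsilon_char psi = epsilon_char psi).
  { unfold epsilon_char. destruct (excluded_middle_informative _) as [T|T].
    - rewrite T. ring.
    - ring. }
  unfold period_function.
  replace (- 1 / X) with (- (1) / X) by (f_equal; apply injective_projections; simpl; ring).
  rewrite E1, E2.
  replace (q + 3 - 2)%nat with (q + 1)%nat by lia.
  set (Sum := sum_n _ _) in *.
  set (Lc1 := dirichlet_L chi (RtoC (INR (q + 2)))) in *.
  set (Lp1 := dirichlet_L psi (RtoC (INR (q + 2)))) in *.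
  transitivity (2 / RtoC (INR (q + 2)) *
    ((T1 - e1 * Lc1 - psi (-1)%Z * X ^ (q + 1) * (T2 - e2 * Lp1))
     + (e1 * Lc1 - psi (-1)%Z * X ^ (q + 1) * e2 * Lp1))).
  { field. exact Zk. }
  rewrite HC. unfold e1, e2. rewrite <- Epsi at 1. field. exact Zk.
Qed.
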